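(* Let $\beta>0$ and $1\le p<2$, and let $R=(r_1,r_2)$ be a non-degenerate ground state of the elliptic system $$-\tfrac12 \partial_{xx} r_1+r_1=r_1^{2p+1}+\beta r_1^{p}r_2^{p+1},\qquad -\tfrac12 \partial_{xx} r_2+r_2=r_2^{2p+1}+\beta r_2^{p}r_1^{p+1}\quad\text{in }\mathbb{R}.$$ Then $R$ is orbitally stable: for every $\varepsilon>0$ there exists $\delta=\delta(\varepsilon)>0$ such that, whenever $\Psi^0\in H^1(\mathbb{R},\mathbb{C})\times H^1(\mathbb{R},\mathbb{C})$ satisfies $$\inf_{x\in\mathbb{R},\ \theta\in[0,2\pi)^2}\big\|\Psi^0-\big(e^{\mathrm{i}\theta_1}r_1(\cdot-x),e^{\mathrm{i}\theta_2}r_2(\cdot-x)\big)\big\|_{H^1\times H^1}<\delta,$$ the solution $\Psi$ of the Schrödinger system $$\mathrm{i}\partial_t\phi_1+\tfrac12\partial_{xx}\phi_1+\big(|\phi_1|^{2p}+\beta|\phi_2|^{p+1}|\phi_1|^{p-1}\big)\phi_1=0,$$ $$\mathrm{i}\partial_t\phi_2+\tfrac12\partial_{xx}\phi_2+\big(|\phi_2|^{2p}+\beta|\phi_1|^{p+1}|\phi_2|^{p-1}\big)\phi_2=0$$ on $[0,\infty)\times\mathbb{R}$ with initial datum $\Psi(0,\cdot)=\Psi^0$ satisfies $$\sup_{t\in[0,\infty)}\ \inf_{x\in\mathbb{R},\ \theta\in[0,2\pi)^2}\big\|\Psi(t,\cdot)-\big(e^{\mathrm{i}\theta_1}r_1(\cdot-x),e^{\mathrm{i}\theta_2}r_2(\cdot-x)\big)\big\|_{H^1\times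 H^1}<\varepsilon.$$
   Context: Norm: $\|\Phi\|_{H^1\times H^1}^2=\|\partial_x\Phi\|_2^2+\|\Phi\|_2^2$, where $\|\Phi\|_2^2=\|\phi_1\|_2^2+\|\phi_2\|_2^2$. Energy: $\mathcal{E}(V)=\frac12\|\partial_xV\|_2^2-\frac1{p+1}\int_{\mathbb{R}}\big(|v_1|^{2p+2}+|v_2|^{2p+2}+2\beta|v_1v_2|^{p+1}\big)\,dx$ for $V=(v_1,v_2)$. Action: $\mathcal{I}(V)=\mathcal{E}(V)+\|V\|_2^2$. Known facts assumed for the Cauchy problem ($0<p<2$): for every initial datum in $H^1(\mathbb{R},\mathbb{C})^2$ the Schrödinger system has a unique solution, global in time and continuous in time with values in $H^1(\mathbb{R},\mathbb{C})^2$, and along it $\|\phi_1(t)\|_2$, $\|\phi_2(t)\|_2$ and $\mathcal{E}(\Phi(t))$ are conserved. Ground state: a solution $R=(r_1,r_2)\in H^1(\mathbb{R},\mathbb{R})^2$, $R\neq(0,0)$, with nonnegative components, of the elliptic system, having least action $\mathcal{I}$ among all such nonzero solutions. As standing facts (known for $1\le p<2$), a ground state $R$ is taken with $r_i\in C^2(\mathbb{R})\cap W^{2,s}(\mathbb{R})$ for every $s$, $r_i\ge 0$ even, decreasing on $(0,\infty)$ and exponentially decaying, and it satisfies $\mathcal{E}(R)=\inf\{\mathcal{E}(V): V\in H^1\times H^1,\ \|V\|_2=\|R\|_2\}$. Non-degenerate: the set of solutions $(\phi,\psi)\in H^1(\mathbb{R},\mathbb{R})^2$ of the linearized system $$-\tfrac12\partial_{xx}\phi+\phi=[(2p+1)r_1^{2p}+\beta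 p\,r_1^{p-1}r_2^{p+1}]\phi+\beta(p+1)r_1^pr_2^p\psi,$$ $$-\tfrac12\partial_{xx}\psi+\psi=[(2p+1)r_2^{2p}+\beta p\,r_1^{p+1}r_2^{p-1}]\psi+\beta(p+1)r_1^pr_2^p\phi$$ in $\mathbb{R}$ is a $1$-dimensional vector space, and every solution is of the form $\theta\,\partial_xR$ with $\theta\in\mathbb{R}$. (Convention: $r^{p-1}=1$ when $p=1$.) *)

(* Defs.v *)
From HB Require Import structures.
From mathcomp Require Import all_boot all_order all_algebra.
From mathcomp Require Import all_classical all_reals all_analysis.
From mathcomp Require Import complex.
Set Implicit Arguments.
Unset Strict Implicit.
Unset Printing Implicit Defensive.
Import Order.TTheory GRing.Theory Num.Theory.
Import numFieldNormedType.Exports.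
Import ComplexField.

(* [Re] and [Im] of [complex] are shadowed by those of numeric closed fields. *)
Notation reC := complex.Re.
Notation imC := complex.Im.

Local Open Scope classical_set_scope.
Local Open Scope ring_scope.
Local Open Scope complex_scope.

(* Elements of Lebesgue and Sobolev spaces are represented by honest functions
   on the line; they are compared up to a Lebesgue-null set. *)

Section Sobolev.
Context {R : realType}.

Definition mu : set (measurableTypeR R) -> \bar R := @lebesgue_measure R.

Definition ae_eq0 (f : R -> R) : Prop := {ae mu, forall x, f x = 0}.

Definition ae_eqC (f g : R -> R[i]) : Prop := {ae mu, forall x, f x = g x}.

(* C^1 functions with compact support. Replacing them by C^oo ones yields the
   same weak derivatives and the same weak solutions below, by density. *)
Definition test_function (eta : R -> R) : Prop :=
  [/\ forall x, derivable eta x 1, continuous (derive1 eta)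
    & compact (closure [set x | eta x != 0])].

Definition weak_deriv (f g : R -> R) : Prop :=
  [/\ locally_integrable setT f, locally_integrable setT g &
    forall eta : R -> R, test_function eta ->
      \int[mu]_x (f x * derive1 eta x) = - \int[mu]_x (g x * eta x)].

Definition W1 (s : \bar R) (f : R -> R) : Prop :=
  f \in Lfun mu s /\ exists2 g, g \in Lfun mu s & weak_deriv f g.

Definition W2 (s : \bar R) (f : R -> R) : Prop :=
  f \in Lfun mu s /\ exists2 g, W1 s g & weak_deriv f g.

Definition H1r (f : R -> R) : Prop := W1 2%:E f.

(* A chosen representative of the weak derivative, which is unique up to a
   null set; it is the zero function when there is no weak derivative. *)
Definition wderiv (f : R -> R) : R -> R :=
  xget (fun=> 0) [set g | weak_deriv f g].

Definition H1c (f : R -> R[i]) : Prop :=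
  H1r (fun x => reC (f x)) /\ H1r (fun x => imC (f x)).

Definition wderivC (f : R -> R[i]) : R -> R[i] := fun x =>
  wderiv (fun y => reC (f y)) x +i* wderiv (fun y => imC (f y)) x.

Definition integralC (f : R -> R[i]) : R[i] :=
  (\int[mu]_x reC (f x)) +i* (\int[mu]_x imC (f x)).

Definition pairC : Type := ((R -> R[i]) * (R -> R[i]))%type.
Definition pairR : Type := ((R -> R) * (R -> R))%type.

Definition H1xH1 (V : pairC) : Prop := H1c V.1 /\ H1c V.2.

Definition pair_ae_eq (V W : pairC) : Prop :=
  ae_eqC V.1 W.1 /\ ae_eqC V.2 W.2.

Definition pair_sub (V W : pairC) : pairC :=
  (fun x => V.1 x - W.1 x, fun x => V.2 x - W.2 x).

Definition pair_dx (V : pairC) : pairC := (wderivC V.1, wderivC V.2).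

Definition l2norm (f : R -> R[i]) : R :=
  Num.sqrt (\int[mu]_x (Normc.normc (f x) ^+ 2)).

Definition L2norm (V : pairC) : R :=
  Num.sqrt (l2norm V.1 ^+ 2 + l2norm V.2 ^+ 2).

Definition H1norm (V : pairC) : R :=
  Num.sqrt (L2norm (pair_dx V) ^+ 2 + L2norm V ^+ 2).

Definition complexify (r : pairR) : pairC :=
  (fun x => (r.1 x)%:C, fun x => (r.2 x)%:C).

End Sobolev.

Section System.
Context {R : realType}.
Variables p beta : R.
Implicit Types (V : @pairC R) (r : @pairR R).

(* The power [a `^ e] is only used with [0 <= a] here; it satisfies
   [0 `^ 0 = 1], which is the convention for [p - 1] at [p = 1]. *)

Definition energy V : R :=
  2^-1 * L2norm (pair_dx V) ^+ 2
  - (p + 1)^-1 * \int[mu]_x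
      (Normc.normc (V.1 x) `^ (2 * p + 2) + Normc.normc (V.2 x) `^ (2 * p + 2)
       + 2 * beta * Normc.normc (V.1 x * V.2 x) `^ (p + 1)).

Definition action V : R := energy V + L2norm V ^+ 2.

(* - 1/2 u'' + u = h in the sense of distributions, for u in H^1(R) *)
Definition weak_elliptic (u h : R -> R) : Prop :=
  forall eta : R -> R, test_function eta ->
    2^-1 * \int[mu]_x (wderiv u x * derive1 eta x) + \int[mu]_x (u x * eta x)
    = \int[mu]_x (h x * eta x).

Definition elliptic_solution r : Prop :=
  [/\ H1r r.1, H1r r.2,
      {ae mu, forall x, 0 <= r.1 x}, {ae mu, forall x, 0 <= r.2 x} &
      weak_elliptic r.1 (fun x =>
        r.1 x `^ (2 * p + 1) + beta * r.1 x `^ p * r.2 x `^ (p + 1)) /\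
      weak_elliptic r.2 (fun x =>
        r.2 x `^ (2 * p + 1) + beta * r.2 x `^ p * r.1 x `^ (p + 1))].

Definition nonzero r : Prop := ~ (ae_eq0 r.1 /\ ae_eq0 r.2).

Definition ground_state r : Prop :=
  [/\ elliptic_solution r, nonzero r &
    forall s, elliptic_solution s -> nonzero s ->
      action (complexify r) <= action (complexify s)].

(* "Decreasing" is understood in the wide sense, since one of the two
   components of a ground state may vanish identically. *)
Definition regular_profile (u : R -> R) : Prop :=
  [/\ [/\ forall x, derivable u x 1, forall x, derivable (derive1 u) x 1
        & continuous (derive1 (derive1 u))],
      forall s : \bar R, (1 <= s)%E -> W2 s u,
      forall x, 0 <= u x,
      (forall x, u (- x) = u x) /\ (forall x y, 0 < x -> x <= y -> u y <= u x)
    & exists C c : R, 0 < c /\ forall x, `|u x| <= C * expR (- c * `|x|)].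

Definition energy_minimizer r : Prop :=
  (energy (complexify r))%:E =
  ereal_inf [set e | exists V, [/\ H1xH1 V,
    L2norm V = L2norm (complexify r) & e = (energy V)%:E]].

Definition linearized_solution r (u : @pairR R) : Prop :=
  [/\ H1r u.1, H1r u.2,
      weak_elliptic u.1 (fun x =>
        ((2 * p + 1) * r.1 x `^ (2 * p)
         + beta * p * r.1 x `^ (p - 1) * r.2 x `^ (p + 1)) * u.1 x
        + beta * (p + 1) * r.1 x `^ p * r.2 x `^ p * u.2 x) &
      weak_elliptic u.2 (fun x =>
        ((2 * p + 1) * r.2 x `^ (2 * p)
         + beta * p * r.1 x `^ (p + 1) * r.2 x `^ (p - 1)) * u.2 x
        + beta * (p + 1) * r.1 x `^ p * r.2 x `^ p * u.1 x)].

Definition ae_multiple (u e : @pairR R) (c : R) : Prop :=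
  ae_eq0 (fun x => u.1 x - c * e.1 x) /\ ae_eq0 (fun x => u.2 x - c * e.2 x).

Definition nondegenerate_state r : Prop :=
  (exists e, [/\ linearized_solution r e, nonzero e &
     forall u, linearized_solution r u <->
       [/\ H1r u.1, H1r u.2 & exists c, ae_multiple u e c]]) /\
  (forall u, linearized_solution r u ->
     exists theta, ae_multiple u (wderiv r.1, wderiv r.2) theta).

Definition nonlinear_term (f g : R -> R[i]) : R -> R[i] := fun x =>
  (Normc.normc (f x) `^ (2 * p)
   + beta * Normc.normc (g x) `^ (p + 1) * Normc.normc (f x) `^ (p - 1))%:C
  * f x.

(* One component of the Schroedinger system, paired with a test function in
   space: the equation holds in H^{-1}(R) at every time t > 0. Real test
   functions suffice since the equation is linear in the test function. *)
Definition schrodinger_component (f g : R -> R -> R[i]) : Prop :=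
  forall eta : R -> R, test_function eta -> forall t : R, 0 < t ->
    exists d : R[i],
      [/\ is_derive t 1 (fun s => reC (integralC (fun x => f s x * (eta x)%:C)))
            (reC d),
          is_derive t 1 (fun s => imC (integralC (fun x => f s x * (eta x)%:C)))
            (imC d) &
          (0 +i* 1) * d
          - (2^-1)%:C * integralC (fun x => wderivC (f t) x * (derive1 eta x)%:C)
          + integralC (fun x => nonlinear_term (f t) (g t) x * (eta x)%:C) = 0].

(* Global solutions in C([0, +oo[; H^1 x H^1); values at negative times are
   irrelevant. *)
Definition schrodinger_solution (Psi : R -> @pairC R) : Prop :=
  [/\ forall t : R, 0 <= t -> H1xH1 (Psi t),
      forall t : R, 0 <= t ->
        H1norm (pair_sub (Psi s) (Psi t))
          @[s --> within [set s | 0 <= s] (nbhs t)] --> (0 : R),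
      schrodinger_component (fun t => (Psi t).1) (fun t => (Psi t).2) &
      schrodinger_component (fun t => (Psi t).2) (fun t => (Psi t).1)].

Definition cauchy_solution (Psi0 : @pairC R) (Psi : R -> @pairC R) : Prop :=
  schrodinger_solution Psi /\ pair_ae_eq (Psi 0) Psi0.

Definition cauchy_well_posed : Prop :=
  forall Psi0, H1xH1 Psi0 ->
    [/\ exists Psi, cauchy_solution Psi0 Psi,
        forall Psi Phi, cauchy_solution Psi0 Psi -> cauchy_solution Psi0 Phi ->
          forall t : R, 0 <= t -> pair_ae_eq (Psi t) (Phi t) &
        forall Psi, cauchy_solution Psi0 Psi -> forall t : R, 0 <= t ->
          [/\ l2norm (Psi t).1 = l2norm Psi0.1,
              l2norm (Psi t).2 = l2norm Psi0.2 &
              energy (Psi t) = energy Psi0]].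

Definition expi (theta : R) : R[i] := cos theta +i* sin theta.

Definition orbit_point r (y theta1 theta2 : R) : @pairC R :=
  (fun x => expi theta1 * (r.1 (x - y))%:C,
   fun x => expi theta2 * (r.2 (x - y))%:C).

Definition orbit_dist r V : \bar R :=
  ereal_inf [set d | exists y theta1 theta2,
    [/\ 0 <= theta1 < 2 * pi, 0 <= theta2 < 2 * pi &
        d = (H1norm (pair_sub V (orbit_point r y theta1 theta2)))%:E]].

Definition orbitally_stable r : Prop :=
  forall eps : R, 0 < eps -> exists2 delta : R, 0 < delta &
    forall Psi0, H1xH1 Psi0 -> (orbit_dist r Psi0 < delta%:E)%E ->
    forall Psi, cauchy_solution Psi0 Psi ->
      (ereal_sup [set orbit_dist r (Psi t) | t in [set t | (0 <= t)%R]]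
       < eps%:E)%E.

End System.

(* Main.v *)
Require Import Defs.
From HB Require Import structures.
From mathcomp Require Import all_boot all_order all_algebra.
From mathcomp Require Import all_classical all_reals all_analysis.
From mathcomp Require Import complex.
From mathcomp Require Import measurable_realfun.
From mathcomp Require Import ring lra.
Set Implicit Arguments.
Unset Strict Implicit.
Unset Printing Implicit Defensive.
Import Order.TTheory GRing.Theory Num.Theory.
Import numFieldNormedType.Exports.
Import ComplexField.
Local Open Scope classical_set_scope.
Local Open Scope ring_scope.
Local Open Scope complex_scope.

(* Scaling U(x) into c U(c^p x) turns the minimality of the energy of R at fixed
   mass into E(U) >= E(R) (M(U) / M(R))^((2 + p) / (2 - p)). Expanding at R, the
   second variation of the action plus K <R, .>^2 is nonnegative for some K.
   The kernel of the form with K + 1 instead of K is the tangent space of the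
   orbit, by non-degeneracy for the real parts and by a Wronskian argument for
   the imaginary parts. As the potentials decay at infinity, a bounded sequence
   on which this form tends to 0 has an H^1 convergent subsequence; hence the
   Lyapunov function I(U) + (K + 1) / 4 (M(U) - M(R))^2 controls the squared
   distance to the orbit close to it. It is conserved by the flow, and the
   distance is continuous in time. *)

(** The mass constraint is the obstacle, since minimality compares only states of equal mass. The
    scaling inequality removes it: the second variation is read off along R + t w with w
    unrestricted. This needs gamma E(R) = - M(R) with gamma = (2 + p) / (2 - p), which falls out of
    the same inequality along (1 + t) R; the quadratic remainder of x^gamma at x = 1 then produces
    K. The extra unit in K + 1 makes kernel vectors orthogonal to R, so that they solve the
    linearised system exactly. Compactness avoids weak topologies: pointwise limits of continuous
    representatives along one ultrafilter, needed only on finite grids, yield a Cauchy subsequence.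
    No modulation equations are solved: a base point on the orbit that is optimal up to a constant
    factor suffices. The powers x^(q - 2) may be merely Hölder continuous at 0, so the Taylor
    expansions carry a remainder small relative to the square of the displacement, without a
    rate. *)

(** * Integrals on the line, almost everywhere equality and square integrable functions *)

Section Integration.
Context {R : realType}.
Implicit Types f g h : R -> R.
Local Notation mu := (@mu R).

#[local] Instance ae_mu_filter : Filter (almost_everywhere mu).
Proof. exact: (ae_filter_ringOfSetsType (lebesgue_measure : {measure set (measurableTypeR R) -> \bar R})). Qed.

Definition itg f := (mu : {measure set _ -> \bar R}).-integrable setT (EFin \o f).
Definition mble f := measurable_fun [set: measurableTypeR R] (f : _ -> measurableTypeR R).

Lemma itg_mble f : itg f -> mble f.
Proof. by move=> /integrableP[/measurable_EFinP]. Qed.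

Lemma itgD f g : itg f -> itg g -> itg (fun x => f x + g x).
Proof. move=> hf hg; exact: (integrableD measurableT hf hg). Qed.

Lemma itgZ f c : itg f -> itg (fun x => c * f x).
Proof. move=> hf; exact: (integrableZl measurableT c hf). Qed.

Lemma IntD f g : itg f -> itg g -> \int[mu]_x (f x + g x) = \int[mu]_x f x + \int[mu]_x g x.
Proof. exact: RintegralD. Qed.

Lemma IntZ f c : itg f -> \int[mu]_x (c * f x) = c * \int[mu]_x f x.
Proof. exact: RintegralZl. Qed.

Lemma itgN f : itg f -> itg (fun x => - f x).
Proof. by move=> /(itgZ (-1)); apply: eq_integrable => // x _ /=; rewrite mulN1r. Qed.

Lemma IntN f : itg f -> \int[mu]_x (- f x) = - \int[mu]_x f x.
Proof.
move=> hf; rewrite -mulN1r -IntZ//.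
by apply: eq_Rintegral => x _; rewrite mulN1r.
Qed.

Lemma itgB f g : itg f -> itg g -> itg (fun x => f x - g x).
Proof. by move=> hf /itgN; exact: itgD. Qed.

Lemma IntB f g : itg f -> itg g -> \int[mu]_x (f x - g x) = \int[mu]_x f x - \int[mu]_x g x.
Proof. exact: RintegralB. Qed.

Lemma itg0 : itg (fun=> 0).
Proof. exact: integrable0. Qed.

Lemma Int0 : \int[mu]_x (0 : R) = 0.
Proof. by rewrite /Rintegral integral0. Qed.

Lemma itg_sum (I : Type) (s : seq I) (F : I -> R -> R) :
  (forall i, itg (F i)) -> itg (fun x => \sum_(i <- s) F i x).
Proof.
move=> hF; elim: s => [|i s ih].
  by apply: eq_integrable itg0 => // x _ /=; rewrite big_nil.
by apply: eq_integrable (itgD (hF i) ih) => // x _ /=; rewrite big_cons.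
Qed.

Lemma Int_sum (I : Type) (s : seq I) (F : I -> R -> R) :
  (forall i, itg (F i)) ->
  \int[mu]_x (\sum_(i <- s) F i x) = \sum_(i <- s) \int[mu]_x F i x.
Proof.
move=> hF; elim: s => [|i s ih].
  by under eq_Rintegral do rewrite big_nil; rewrite Int0 big_nil.
under eq_Rintegral do rewrite big_cons.
by rewrite IntD ?ih ?big_cons//; exact: itg_sum.
Qed.

Lemma Int_le f g : itg f -> itg g -> (forall x, f x <= g x) ->
  \int[mu]_x f x <= \int[mu]_x g x.
Proof. by move=> hf hg fg; exact: le_Rintegral. Qed.

Lemma Int_ge0 f : (forall x, 0 <= f x) -> 0 <= \int[mu]_x f x.
Proof. by move=> f0; exact: Rintegral_ge0. Qed.

Lemma Int_normr f : itg f -> `|\int[mu]_x f x| <= \int[mu]_x `|f x|.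
Proof. exact: le_normr_Rintegral. Qed.

Lemma itg_abs f : itg f -> itg (fun x => `|f x|).
Proof. by move=> hf; exact: (integrable_norm hf). Qed.

Lemma itg_le f g : mble f -> itg g -> (forall x, `|f x| <= `|g x|) -> itg f.
Proof.
move=> mf hg fg; apply: le_integrable hg => //.
  exact/measurable_EFinP.
by move=> x _ /=; rewrite lee_fin.
Qed.

Definition aeq f g := {ae mu, forall x, f x = g x}.

Lemma ae_and (P Q : R -> Prop) : {ae mu, forall x, P x} -> {ae mu, forall x, Q x} ->
  {ae mu, forall x, P x /\ Q x}.
Proof. by move=> hP hQ; apply: filterS2 hP hQ => x; split. Qed.

Lemma ae_mono (P Q : R -> Prop) : (forall x, P x -> Q x) ->
  {ae mu, forall x, P x} -> {ae mu, forall x, Q x}.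
Proof. by move=> PQ hP; apply: filterS hP. Qed.

Lemma ae_all (P : R -> Prop) : (forall x, P x) -> {ae mu, forall x, P x}.
Proof. by move=> hP; exact: aeW. Qed.

Lemma aeq_sym f g : aeq f g -> aeq g f.
Proof. by apply: ae_mono. Qed.

Lemma itg_ae f g : aeq f g -> mble g -> itg f -> itg g.
Proof.
move=> fg mg /[dup] /itg_mble mf /integrableP[_ hi]; apply/integrableP; split.
  exact/measurable_EFinP.
apply: le_lt_trans hi; rewrite le_eqVlt; apply/orP; left; apply/eqP.
apply: ae_eq_integral => //.
- by apply: measurableT_comp => //; exact/measurable_EFinP.
- by apply: measurableT_comp => //; exact/measurable_EFinP.
- by apply: ae_mono fg => x /= ->.
Qed.

Lemma Int_ae f g : aeq f g -> mble f -> mble g -> \int[mu]_x f x = \int[mu]_x g x.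
Proof.
move=> fg mf mg; rewrite /Rintegral; congr fine; apply: ae_eq_integral => //.
- exact/measurable_EFinP.
- exact/measurable_EFinP.
- by apply: ae_mono fg => x /= ->.
Qed.

Lemma Int_eq0 f : itg f -> (forall x, 0 <= f x) -> \int[mu]_x f x = 0 -> aeq f (fun=> 0).
Proof.
move=> hf f0 h; have mf := itg_mble hf.
have mfE : measurable_fun [set: measurableTypeR R] (EFin \o f) by exact/measurable_EFinP.
have := (ae_eq_integral_abs mu measurableT mfE).1.
have -> : (\int[mu]_(x in [set: R]) `|(EFin \o f) x| = 0)%E.
  under eq_integral do rewrite /= ger0_norm ?f0//.
  move: h; rewrite /Rintegral => h.
  by rewrite -[LHS]fineK ?h//; exact: integrable_fin_num.
by move=> /(_ erefl); apply: ae_mono => x /= /(_ I) [].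
Qed.

Lemma DCT (f_ : nat -> R -> R) f g : (forall n, mble (f_ n)) -> mble f -> itg g ->
  {ae mu, forall x, (f_ n x @[n --> \oo] --> f x)} ->
  {ae mu, forall x, forall n, `|f_ n x| <= g x} ->
  itg f /\ ((\int[mu]_x f_ n x) @[n --> \oo] --> \int[mu]_x f x).
Proof.
move=> mf_ mf ig cv dom.
have [|||||h1 h2 h3] := @dominated_convergence _ _ _ mu setT measurableT
  (fun n => EFin \o f_ n) (EFin \o f) (EFin \o g).
- by move=> n; apply: measurableT_comp => //; exact: mf_.
- exact/measurable_EFinP.
- by apply: ae_mono cv => x h _; apply/fine_cvgP; split; [exact: nearW|].
- exact: ig.
- by apply: ae_mono dom => x h n _ /=; rewrite lee_fin.
split=> //; apply: (@fine_cvg _ _ _ _ _ (\int[mu]_x f x)).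
by rewrite /Rintegral fineK //; exact: integrable_fin_num.
Qed.

Definition L2 f := mble f /\ itg (fun x => f x ^+ 2).

Lemma L2P f : f \in Lfun mu 2%:E <-> L2 f.
Proof.
split=> [h|[mf hf]].
  split; last exact: Lfun2_integrable_sqr.
  by move: h; rewrite inE => /andP[]; rewrite inE.
rewrite inE; apply/andP; split; rewrite inE//= /finite_norm unlock /=.
apply: poweR_lty; move/integrableP: hf => [_]; apply: le_lt_trans.
rewrite le_eqVlt; apply/orP; left; apply/eqP; apply: eq_integral => x _ /=.
by rewrite -[2%:R]/(2%:R) powR_mulrn// real_normK ?num_real// ger0_norm// sqr_ge0.
Qed.

Lemma L2_mul f g : L2 f -> L2 g -> itg (fun x => f x * g x).
Proof.
move=> /L2P hf /L2P hg; apply/Lfun1_integrable; exact: Lfun2_mul_Lfun1.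
Qed.

Lemma mbleD f g : mble f -> mble g -> mble (fun x => f x + g x).
Proof. exact: measurable_funD. Qed.
Lemma mbleM f g : mble f -> mble g -> mble (fun x => f x * g x).
Proof. exact: measurable_funM. Qed.
Lemma mbleC c : mble (fun=> c).
Proof. exact: measurable_cst. Qed.
Lemma mbleN f : mble f -> mble (fun x => - f x).
Proof. by move=> mf; apply: measurableT_comp. Qed.
Lemma mbleB f g : mble f -> mble g -> mble (fun x => f x - g x).
Proof. by move=> mf /mbleN; exact: mbleD. Qed.
Lemma mbleX f n : mble f -> mble (fun x => f x ^+ n).
Proof. exact: measurable_funX. Qed.
Lemma mble_powR f a : mble f -> mble (fun x => f x `^ a).
Proof. by move=> mf; apply: (measurableT_comp (measurable_powR a)). Qed.
Lemma mble_norm f : mble f -> mble (fun x => `|f x|).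
Proof. by move=> mf; apply: measurableT_comp. Qed.
Lemma mble_sqrt f : mble f -> mble (fun x => Num.sqrt (f x)).
Proof.
move=> mf; apply: (measurableT_comp _ mf).
by apply: continuous_measurable_fun; exact: sqrt_continuous.
Qed.
Lemma mble_cont f : continuous f -> mble f.
Proof. exact: continuous_measurable_fun. Qed.

Lemma L2Z f c : L2 f -> L2 (fun x => c * f x).
Proof.
move=> [mf hf]; split; first exact: mbleM (mbleC c) mf.
by apply: eq_integrable (itgZ (c ^+ 2) hf) => // x _ /=; rewrite exprMn.
Qed.

Lemma L2D f g : L2 f -> L2 g -> L2 (fun x => f x + g x).
Proof.
move=> hf hg; have [mf if2] := hf; have [mg ig2] := hg; split; first exact: mbleD.
apply: eq_integrable (itgD (itgD if2 ig2) (itgZ 2 (L2_mul hf hg))) => // x _ /=.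
by congr (_%:E); ring.
Qed.

Lemma L2N f : L2 f -> L2 (fun x => - f x).
Proof.
move=> [mf hf]; split; first exact: mbleN.
by apply: eq_integrable hf => // x _ /=; rewrite sqrrN.
Qed.

Lemma L2B f g : L2 f -> L2 g -> L2 (fun x => f x - g x).
Proof. by move=> hf /L2N; exact: L2D. Qed.

Lemma L2_0 : L2 (fun=> 0).
Proof. by split; [exact: mbleC|apply: eq_integrable itg0 => // x _ /=; rewrite expr0n]. Qed.

Lemma L2_le f g : mble f -> L2 g -> (forall x, `|f x| <= `|g x|) -> L2 f.
Proof.
move=> mf [mg hg] fg; split=> //; apply: itg_le hg _; first exact: mbleX.
by move=> x; rewrite !normrX lerXn2r ?nnegrE.
Qed.

Lemma L2_bdd f g (C : R) : mble g -> (forall x, `|g x| <= C) -> L2 f ->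
  L2 (fun x => g x * f x).
Proof.
move=> mg gC hf; apply: (@L2_le _ (fun x => C * f x)).
- exact: mbleM mg hf.1.
- exact: L2Z.
- by move=> x; rewrite !normrM ler_wpM2r// (le_trans (gC x))// ler_norm.
Qed.

Lemma itg_bdd f g (C : R) : mble g -> (forall x, `|g x| <= C) -> itg f ->
  itg (fun x => g x * f x).
Proof.
move=> mg gC hf; apply: (@itg_le _ (fun x => C * f x)).
- exact: mbleM mg (itg_mble hf).
- exact: itgZ.
- by move=> x; rewrite !normrM ler_wpM2r// (le_trans (gC x))// ler_norm.
Qed.

Lemma L2_ae f g : aeq f g -> mble g -> L2 f -> L2 g.
Proof.
move=> fg mg [mf hf]; split=> //; apply: itg_ae hf; last exact: mbleX.
by apply: ae_mono fg => x ->.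
Qed.

(* [0 <= int (f - t g)^2] for all [t] *)
Lemma L2_CauchySchwarz f g : L2 f -> L2 g ->
  (\int[mu]_x (f x * g x)) ^+ 2 <= (\int[mu]_x (f x ^+ 2)) * \int[mu]_x (g x ^+ 2).
Proof.
move=> hf hg; have ifg := L2_mul hf hg.
set a := \int[mu]_x (f x ^+ 2); set b := \int[mu]_x (f x * g x).
set c := \int[mu]_x (g x ^+ 2).
have key s t : 0 <= s ^+ 2 * a - 2 * s * t * b + t ^+ 2 * c.
  have -> : s ^+ 2 * a - 2 * s * t * b + t ^+ 2 * c =
      \int[mu]_x ((s * f x - t * g x) ^+ 2).
    rewrite -IntZ ?hf.2// -IntZ// -IntB; [|exact: itgZ hf.2|exact: itgZ].
    rewrite -IntZ ?hg.2// -IntD; [|exact: itgB (itgZ _ hf.2) (itgZ _ ifg)|exact: itgZ hg.2].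
    by apply: eq_Rintegral => x _; ring.
  by apply: Int_ge0 => x; exact: sqr_ge0.
have a0 : 0 <= a by apply: Int_ge0 => x; exact: sqr_ge0.
have c0 : 0 <= c by apply: Int_ge0 => x; exact: sqr_ge0.
have [c00|cn0] := eqVneq c 0.
  (* With c = 0 the choice s = b, t = 1 + a turns the form into - b^2 (2 + a). *)
  have := key b (1 + a); rewrite c00 !mulr0 addr0 => h.
  have : b ^+ 2 * (2 + a) <= 0 by nra.
  by rewrite pmulr_lle0//; lra.
have cp : 0 < c by rewrite lt_neqAle eq_sym cn0.
rewrite -subr_ge0 -(pmulr_rge0 _ cp); apply: le_trans (key c b) _.
by rewrite le_eqVlt; apply/orP; left; apply/eqP; ring.
Qed.
End Integration.

(** * Affine change of variables *)

Section Affine.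
Context {R : realType}.
Implicit Types f g h : R -> R.
Local Notation mu := (@mu R).

Definition affine (a b : R) : measurableTypeR R -> measurableTypeR R := fun x => b * x + a.

Lemma affine_measurable a b : measurable_fun setT (affine a b).
Proof. exact: mbleD (mbleM (mbleC b) (@measurable_id _ _ setT)) (mbleC a). Qed.

Definition affine_push a b : {measure set (measurableTypeR R) -> \bar R} :=
  measure_function_pushforward__canonical__measure_function_Measure
    lebesgue_measure (affine_measurable a b).

(** Lebesgue measure is determined by its values on the intervals ]c, d], and the preimage of such
    an interval has length (d - c) / b. *)
Lemma affine_measure (a b : R) (b0 : 0 < b) (A : set (measurableTypeR R)) : measurable A ->
  lebesgue_measure A = mscale (NngNum (ltW b0)) (affine_push a b) A.
Proof.
move=> mA; apply: lebesgue_measure_unique => //= _ [[c d]] _ <-.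
rewrite /mscale /affine_push /pushforward/=.
have e : affine a b @^-1` `]c, d] = `](c - a) / b, (d - a) / b]%classic.
  apply/seteqP; split=> x /=; rewrite !in_itv/= /affine ltr_pdivrMr// ler_pdivlMr//.
    by rewrite ltrBlDr lerBrDr mulrC.
  by rewrite ltrBlDr lerBrDr mulrC.
rewrite -[pushforward _ _ _]/(lebesgue_measure (affine a b @^-1` `]c, d])) e.
rewrite !lebesgue_measure_itv/= !lte_fin ltr_pM2r ?invr_gt0// ltrD2r.
case: ifP => _; last by rewrite mule0.
by rewrite -!EFinB -EFinM; congr (_%:E); field; rewrite gt_eqF.
Qed.

Lemma ge0_integral_affine (a b : R) (f : measurableTypeR R -> \bar R) : 0 < b ->
  measurable_fun setT f -> (forall x, 0 <= f x)%E ->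
  (\int[lebesgue_measure]_x f x = b%:E * \int[lebesgue_measure]_x f (affine a b x))%E.
Proof.
move=> b0 mf f0; pose mu' := mscale (NngNum (ltW b0)) (affine_push a b).
rewrite (@eq_measure_integral _ _ _ _ mu'); last first.
  by move=> A mA _; exact: affine_measure.
rewrite ge0_integral_mscale//=; congr (_ * _)%E.
by rewrite ge0_integral_pushforward ?preimage_setT//; exact: affine_measurable.
Qed.

Lemma itg_affine (a b : R) f : 0 < b -> itg f -> itg (fun x => f (b * x + a)).
Proof.
move=> b0 /[dup] /itg_mble mf /integrableP[_ hf].
have mf' : mble (fun x => f (b * x + a)).
  by apply: (measurableT_comp mf); exact: affine_measurable.
apply/integrableP; split; first exact/measurable_EFinP.
move: hf; rewrite (@ge0_integral_affine a b)//; last first.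
  by apply: measurableT_comp => //; exact/measurable_EFinP.
have fin (I : \bar R) : (0 <= I -> b%:E * I < +oo -> I < +oo)%E.
  by case: I => [r| |]//; rewrite ?ltry// gt0_muley ?lte_fin.
by apply: fin; exact: integral_ge0.
Qed.

Lemma Int_affine (a b : R) f : 0 < b -> itg f ->
  \int[mu]_x f (b * x + a) = b^-1 * \int[mu]_x f x.
Proof.
move=> b0 hf; have mf := itg_mble hf; have hf' := itg_affine a b0 hf.
have mfE : measurable_fun [set: measurableTypeR R] (EFin \o f) by exact/measurable_EFinP.
apply: (mulfI (lt0r_neq0 b0)); rewrite mulrA divff ?gt_eqF// mul1r.
rewrite /Rintegral [in RHS]integralE [in LHS]integralE.
rewrite (@ge0_integral_affine a b (EFin \o f)^\+%E)//; last exact: measurable_funepos.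
rewrite (@ge0_integral_affine a b (EFin \o f)^\-%E)//; last exact: measurable_funeneg.
have h1 := integrable_pos_fin_num measurableT hf'; have h2 := integrable_neg_fin_num measurableT hf'.
move: h1 h2; set P := (X in X \is a fin_num -> _) => h1.
set N := (X in X \is a fin_num -> _) => h2.
have -> : (\int[lebesgue_measure]_x (EFin \o f)^\+ (affine a b x) = P)%E.
  by apply: eq_integral => x _; rewrite !funeposE.
have -> : (\int[lebesgue_measure]_x (EFin \o f)^\- (affine a b x) = N)%E.
  by apply: eq_integral => x _; rewrite !funenegE.
change (b * fine (P - N)%E = fine (b%:E * P - b%:E * N)%E).
clearbody P N; by rewrite !fineB ?fin_numM// !fineM// mulrBr.
Qed.

Lemma mble_affine (a b : R) f : mble f -> mble (fun x => f (b * x + a)).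
Proof. by move=> mf; apply: (measurableT_comp mf); exact: affine_measurable. Qed.

Lemma L2_affine (a b : R) f : 0 < b -> L2 f -> L2 (fun x => f (b * x + a)).
Proof. by move=> b0 [mf hf]; split; [exact: mble_affine|exact: (itg_affine a b0 hf)]. Qed.

End Affine.

(** * Continuously differentiable functions and test functions *)

Section Calculus.
Context {R : realType}.
Implicit Types f g h : R -> R.
Local Notation mu := (@mu R).

(** Relational form of C^1 regularity: the derivative is an explicit function, which the chain rule
    and the mean value theorem can use directly. *)
Definition C1d f f' := (forall x : R, is_derive x 1 f (f' x)) /\ continuous f'.
Definition C1 f := (forall x : R, derivable f x 1) /\ continuous (derive1 f).

Lemma C1dE f f' : C1d f f' -> derive1 f = f'.
Proof. by move=> [h _]; apply/funext => x; rewrite derive1E derive_val. Qed.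

Lemma C1d_C1 f f' : C1d f f' -> C1 f.
Proof.
by move=> /[dup] /C1dE e [h c]; split; [move=> x; have := h x; case|rewrite e].
Qed.

Lemma C1_C1d f : C1 f -> C1d f (derive1 f).
Proof.
by move=> [h c]; split=> // x; rewrite derive1E; apply: derivableP; exact: h.
Qed.

Lemma C1_continuous f : C1 f -> continuous f.
Proof. by move=> [h _] x; apply/differentiable_continuous/derivable1_diffP. Qed.

Lemma C1M f g : C1 f -> C1 g -> C1 (fun x => f x * g x) /\
  derive1 (fun x => f x * g x) = fun x => derive1 f x * g x + f x * derive1 g x.
Proof.
move=> /[dup] /C1_continuous cf /C1_C1d[hf cf'] /[dup] /C1_continuous cg /C1_C1d[hg cg'].
have h : C1d (fun x => f x * g x) (fun x => derive1 f x * g x + f x * derive1 g x).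
  split.
    move=> x; have hfx := hf x; have hgx := hg x.
    rewrite (_ : (fun x => _) = f * g)//; apply: is_derive_eq.
    by rewrite /GRing.scale/=; ring.
  move=> x; apply: cvgD; apply: cvgM; [exact: cf'|exact: cg|exact: cf|exact: cg'].
by split; [exact: C1d_C1 h|exact: C1dE h].
Qed.

Lemma C1D f g : C1 f -> C1 g -> C1 (fun x => f x + g x) /\
  derive1 (fun x => f x + g x) = fun x => derive1 f x + derive1 g x.
Proof.
move=> /C1_C1d[hf cf'] /C1_C1d[hg cg'].
have h : C1d (fun x => f x + g x) (fun x => derive1 f x + derive1 g x).
  split; last by move=> x; apply: cvgD; [exact: cf'|exact: cg'].
  move=> x; have hfx := hf x; have hgx := hg x.
  by rewrite (_ : (fun x => _) = f + g)//; apply: is_derive_eq.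
by split; [exact: C1d_C1 h|exact: C1dE h].
Qed.

Lemma C1_cst (c : R) : C1d (fun=> c) (fun=> 0).
Proof. by split; [move=> x; exact: is_derive_cst|move=> x; exact: cvg_cst]. Qed.

Lemma C1Z f c : C1 f -> C1 (fun x => c * f x) /\
  derive1 (fun x => c * f x) = fun x => c * derive1 f x.
Proof.
move=> hf; have [h1 h2] := C1M (C1d_C1 (C1_cst c)) hf; split=> //.
by rewrite h2; apply/funext => x; rewrite (C1dE (C1_cst c)) mul0r add0r.
Qed.

Lemma C1V f : C1 f -> (forall x, f x != 0) -> C1 (fun x => (f x)^-1) /\
  derive1 (fun x => (f x)^-1) = fun x => - derive1 f x / f x ^+ 2.
Proof.
move=> /[dup] /C1_continuous cf /C1_C1d[hf cf'] f0.
have h : C1d (fun x => (f x)^-1) (fun x => - derive1 f x / f x ^+ 2).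
  split.
    move=> x; have hfx := hf x; have h' := is_deriveV (f0 x) hfx.
    by apply: (is_derive_eq h'); rewrite /GRing.scale/=; ring.
  move=> x; apply: cvgM; first by apply: cvgN; exact: cf'.
  by apply: cvgV; [rewrite expf_neq0|have := @continuous_comp _ _ _ f (fun y : R => y ^+ 2) x (cf x) (@exprn_continuous _ 2 _)].
by split; [exact: C1d_C1 h|exact: C1dE h].
Qed.

(** Replaces compactness of the support by a radius beyond which the function vanishes; conversely
    the closure of the support is a closed subset of a segment. *)
Lemma testP eta : test_function eta <->
  C1 eta /\ exists2 A : R, 0 < A & forall x, A < `|x| -> eta x = 0.
Proof.
split=> [[h1 h2 h3]|[[h1 h2] [A A0 hA]]];
  [split; first exact (conj h1 h2)|refine (And3 h1 h2 _)].
  have [A [Ar hA]] := compact_bounded h3.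
  exists (Num.max A 0 + 1); first by rewrite ltr_wpDl// le_max lexx orbT.
  move=> x Ax; apply: contrapT => /eqP ex.
  have /(_ (Num.max A 0 + 1)) := hA; rewrite ltr_pwDr ?le_max ?lexx// => /(_ erefl x).
  have : closure [set x | eta x != 0] x by exact: subset_closure.
  by move=> cx /(_ cx); rewrite /= leNgt Ax.
apply: (subclosed_compact _ (@segment_compact _ (- A) A)).
  exact: closed_closure.
have cl : closed (`[- A, A]%classic : set R) by exact: interval_closed.
rewrite [X in _ `<=` X](iffLR (closure_id _) cl).
apply: closure_subset => x /= ex; rewrite in_itv/= -ler_norml leNgt.
by apply/negP => /hA e0; rewrite e0 eqxx in ex.
Qed.

Lemma itg_cont_compact f (A : R) : 0 < A -> continuous f ->
  (forall x, A < `|x| -> f x = 0) -> itg f.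
Proof.
move=> A0 cf hA.
have h : (lebesgue_measure : {measure set (measurableTypeR R) -> \bar R}).-integrable `[- A, A] (EFin \o f).
  apply: continuous_compact_integrable; first exact: segment_compact.
  exact: continuous_subspaceT.
have mI : measurable (`[- A, A]%classic : set (measurableTypeR R)) by exact: measurable_itv.
apply: eq_integrable (iffLR (integrable_mkcond _ mI) h) => // x _ /=.
rewrite patchE; case: ifPn => // /negP; rewrite inE/= in_itv/= -ler_norml => /negP.
by rewrite -ltNge => /hA ->.
Qed.

Lemma Int_itv f (A : R) : (forall x : R, A < `|x| -> f x = 0) ->
  \int[mu]_x f x = \int[mu]_(x in `[- A, A]) f x.
Proof.
move=> hA; rewrite [RHS]Rintegral_mkcond; apply: eq_Rintegral => x _.
rewrite patchE; case: ifPn => // /negP; rewrite inE/= in_itv/= -ler_norml => /negP.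
by rewrite -ltNge => /hA ->.
Qed.

Lemma C1_FTC f a b : C1 f -> a < b -> \int[mu]_(x in `[a, b]) derive1 f x = f b - f a.
Proof.
move=> Cf ab; rewrite /Rintegral (@continuous_FTC2 _ _ f)//.
- by apply: continuous_subspaceT; exact: Cf.2.
- split; first by move=> x _; exact: Cf.1.
  + exact/cvg_at_right_filter/C1_continuous.
  + exact/cvg_at_left_filter/C1_continuous.
Qed.

(** The strict inequality makes the outer region open, so [eta] vanishes in a whole neighbourhood of
    the point. *)
Lemma test_derive_out (eta : R -> R) (A : R) : (forall x : R, A < `|x| -> eta x = 0) -> forall x : R, A < `|x| -> derive1 eta x = 0.
Proof.
move=> hA x Ax.
have h : \forall y \near x, eta y = cst 0 y.
  have := @norm_continuous R R x; move=> /cvgr_gt /(_ _ Ax).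
  by apply: filterS => y; exact: hA.
by rewrite derive1E (near_eq_derive _ h) derive_cst.
Qed.

End Calculus.

(** * Explicit test functions and local integrability *)

Section TestFunctions.
Context {R : realType}.
Implicit Types f g h eta : R -> R.

(** Reduces differentiability of piecewise or polynomial formulas to an algebraic inequality on the
    remainder. *)
Lemma is_derive_quad (f : R -> R) (x l C : R) :
  (forall h : R, `|h| <= 1 -> `|f (x + h) - f x - h * l| <= C * h ^+ 2) -> is_derive x 1 f l.
Proof.
move=> H; have C0 : 0 <= C.
  by have := le_trans (normr_ge0 _) (H 1 _); rewrite normr1 expr1n mulr1; apply.
have cv : (h^-1 *: (f (h *: (1 : R) + x) - f x)) @[h --> 0^'] --> l.
  apply/cvgrPdist_le => e e0; near=> h.
  have h0 : h != 0 by near: h; exact: nbhs_dnbhs_neq.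
  have h1 : `|h| <= 1 by near: h; apply: dnbhs0_le.
  have h2 : `|h| <= e / (C + 1) by near: h; apply: dnbhs0_le; rewrite divr_gt0// ltr_wpDl.
  have -> : l - h^-1 *: (f (h *: (1 : R) + x) - f x) = - (h^-1 * (f (x + h) - f x - h * l)).
    rewrite /GRing.scale/= mulr1 [h + x]addrC; by field.
  rewrite normrN normrM normfV ler_pdivrMl ?normr_gt0//.
  apply: le_trans (H h h1) _; rewrite -[h ^+ 2]real_normK ?num_real// expr2 mulrCA.
  apply: ler_wpM2l => //; have C1 : 0 < C + 1 by rewrite ltr_wpDl.
  move: h2; rewrite ler_pdivlMr// => h2; have := normr_ge0 h; nra.
by apply: DeriveDef; [exact: cvgP cv|exact: cvg_lim cv].
Unshelve. all: by end_near. Qed.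

(** This is max(y, 0)^2, a C^1 function that vanishes exactly on the nonpositive half-line. *)
Definition posq (y : R) := (y ^+ 2 + y * `|y|) / 2.

Lemma posq_C1d : C1d posq (fun y => y + `|y|).
Proof.
split; last by move=> x; apply: cvgD; [exact: cvg_id|exact: (@norm_continuous R R x)].
move=> x; apply: (@is_derive_quad _ _ _ 1) => h _; rewrite mul1r /posq.
have p1 := sqr_ge0 (x + h); have p2 := sqr_ge0 x; have p3 := sqr_ge0 h.
rewrite ler_norml; case: (lerP 0 x) => hx; case: (lerP 0 (x + h)) => hxh.
- by rewrite (ger0_norm hx) (ger0_norm hxh); apply/andP; split; lra.
- have p4 : x * (x + h) <= 0 by rewrite mulr_ge0_le0 // ltW.
  by rewrite (ger0_norm hx) (ltr0_norm hxh); apply/andP; split; lra.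
- have p4 : x * (x + h) <= 0 by rewrite mulr_le0_ge0 // ltW.
  by rewrite (ltr0_norm hx) (ger0_norm hxh); apply/andP; split; lra.
- by rewrite (ltr0_norm hx) (ltr0_norm hxh); apply/andP; split; lra.
Qed.

Lemma posq_ge0 y : 0 <= posq y.
Proof. rewrite /posq; have := sqr_ge0 y; case: (lerP 0 y) => hy; [rewrite ger0_norm//|rewrite ltr0_norm//]; nra. Qed.
Lemma posq_gt0 y : 0 < y -> 0 < posq y.
Proof. by move=> y0; rewrite /posq gtr0_norm//; nra. Qed.
Lemma posq_le0 y : y <= 0 -> posq y = 0.
Proof. by move=> y0; rewrite /posq ler0_norm//; ring. Qed.

Lemma C1_comp (F F' G G' : R -> R) : C1d F F' -> C1d G G' ->
  C1d (fun x => F (G x)) (fun x => F' (G x) * G' x).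
Proof.
move=> [hF cF] hG; have cG := C1_continuous (C1d_C1 hG); case: hG => hG cG'.
split; first by move=> x; exact: (is_derive1_comp (hF (G x)) (hG x)).
move=> x; apply: cvgM; last exact: cG'.
exact: (@continuous_comp _ _ _ G F' x (cG x) (cF _)).
Qed.

Lemma C1d_poly2 (a b c : R) : C1d (fun x => a + b * x + c * x ^+ 2) (fun x => b + 2 * c * x).
Proof.
split; last by move=> x; apply: cvgD; [exact: cvg_cst|apply: cvgM; [exact: cvg_cst|exact: cvg_id]].
move=> x; apply: (@is_derive_quad _ _ _ `|c|) => h _.
have -> : a + b * (x + h) + c * (x + h) ^+ 2 - (a + b * x + c * x ^+ 2) - h * (b + 2 * c * x) = c * h ^+ 2 by ring.
by rewrite normrM (ger0_norm (sqr_ge0 h)).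
Qed.

(** The argument of [posq] is (x - a) (c - x), expanded to match [C1d_poly2]; hence a C^1 bump
    carried by ]a, c[. *)
Definition hump (a c x : R) := posq (- (a * c) + (a + c) * x + (-1) * x ^+ 2).

Lemma hump_C1 a c : C1 (hump a c).
Proof. exact: C1d_C1 (C1_comp posq_C1d (C1d_poly2 _ _ _)). Qed.

Lemma hump_gt0 a c x : a < x < c -> 0 < hump a c x.
Proof. by move=> /andP[h1 h2]; apply: posq_gt0; nra. Qed.

Lemma hump_out a c x : a <= c -> ~~ (a < x < c) -> hump a c x = 0.
Proof.
move=> ac; rewrite negb_and -!leNgt => /orP[h|h]; apply: posq_le0; nra.
Qed.

(** With h the bump, n h / (1 + n h) stays between 0 and 1 and tends to the indicator function of
    ]a, c[ as n grows. *)
Definition plateau n (a c x : R) := 1 - (1 + n%:R * hump a c x)^-1.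

Lemma plateau_test n a c : a <= c -> test_function (plateau n a c).
Proof.
move=> ac; apply/testP.
have b0 x : 1 + n%:R * hump a c x != 0.
  by rewrite lt0r_neq0// ltr_wpDr// mulr_ge0//; exact: posq_ge0.
have [hZ _] := C1Z n%:R (hump_C1 a c).
have [hD _] := C1D (C1d_C1 (C1_cst 1)) hZ.
have [hV _] := C1V hD b0.
have [hN _] := C1Z (-1) hV.
have [h _] := C1D (C1d_C1 (C1_cst 1)) hN.
split; first by move: h; congr C1; apply/funext => x; rewrite /plateau mulN1r.
exists (`|a| + `|c| + 1); first by rewrite ltr_wpDl.
move=> x hx; rewrite /plateau hump_out ?mulr0 ?addr0 ?invr1 ?subrr//.
apply/negP => /andP[h1 h2]; move: hx; rewrite ltNge => /negP; apply.
rewrite ler_norml; have := ler_norm a; have := ler_norm c; have := ler_norm (- a); have := ler_norm (- c).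
rewrite !normrN => *; apply/andP; split; have := normr_ge0 a; have := normr_ge0 c; lra.
Qed.

Lemma plateau_bd n a c x : 0 <= plateau n a c x <= 1.
Proof.
have b0 : 1 <= 1 + n%:R * hump a c x by rewrite lerDl mulr_ge0//; exact: posq_ge0.
have b1 : 0 < 1 + n%:R * hump a c x by exact: lt_le_trans b0.
by rewrite /plateau subr_ge0 lerBlDr lerDl invr_ge0 (ltW b1) invf_le1// b0.
Qed.

Lemma plateau_cvg a c x : a < x < c -> plateau n a c x @[n --> \oo] --> (1 : R).
Proof.
move=> hx; have b0 := hump_gt0 hx; apply/cvgrPdist_le => e e0.
near=> n; have bn : 0 <= n%:R * hump a c x by rewrite mulr_ge0// ltW.
rewrite /plateau opprB addrC subrK ger0_norm ?invr_ge0 ?addr_ge0//.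
have n1 : (e * hump a c x)^-1 <= n%:R by near: n; exact: nbhs_infty_ger.
have eb : 0 < e * hump a c x by exact: mulr_gt0.
have : 1 <= n%:R * (e * hump a c x) by rewrite -ler_pdivrMr// div1r.
move=> h; rewrite invf_ple ?posrE//; last by rewrite ltr_wpDr// mulr_ge0// ltW.
by rewrite -[e^-1]mul1r ler_pdivrMr//; nra.
Unshelve. all: by end_near. Qed.

Lemma plateau_out n a c x : a <= c -> ~~ (a < x < c) -> plateau n a c x = 0.
Proof. by move=> ac h; rewrite /plateau hump_out// mulr0 addr0 invr1 subrr. Qed.

Lemma mble_indic (A : set R) : measurable (A : set (measurableTypeR R)) -> mble (\1_A : R -> R).
Proof. by move=> mA; exact: (@measurable_indic _ (measurableTypeR R) R setT A mA). Qed.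

Definition loc f := locally_integrable setT f.

Lemma loc_itg_itv f (A : R) : loc f -> itg (fun x => f x * \1_(`[- A, A]%classic) x).
Proof.
move=> [mf _ hf].
have mI : measurable (`[- A, A]%classic : set (measurableTypeR R)) by exact: measurable_itv.
have h : (lebesgue_measure : {measure set (measurableTypeR R) -> \bar R}).-integrable `[- A, A] (EFin \o f).
  apply/integrableP; split; first exact: measurable_funTS (measurableT_comp _ mf).
  by apply: hf => //; exact: segment_compact.
apply: eq_integrable (iffLR (integrable_mkcond _ mI) h) => // x _ /=.
by rewrite patchE indicE; case: ifPn => _ /=; rewrite ?mulr1 ?mulr0.
Qed.

Lemma loc_itg f g (A C : R) : loc f -> mble g -> (forall x : R, `|g x| <= C) ->
  (forall x : R, A < `|x| -> g x = 0) -> itg (fun x => f x * g x).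
Proof.
move=> lf mg gC gA; apply: itg_le (itgZ C (loc_itg_itv A lf)) _.
  by apply: mbleM mg; case: lf.
move=> x; have C0 : 0 <= C by exact: le_trans (gC x).
case: (ltrP A `|x|) => hx; first by rewrite gA// mulr0 normr0.
rewrite indicE mem_set/= ?mulr1; last by rewrite in_itv/= -ler_norml.
by rewrite !normrM mulrC ler_wpM2r// (le_trans (gC x))// ler_norm.
Qed.

Lemma locP f : mble f -> (forall A : R, itg (fun x => f x * \1_(`[- A, A]%classic) x)) -> loc f.
Proof.
move=> mf hf; split=> //; first exact: openT.
move=> K _ cK; have [A [Ar hA]] := compact_bounded cK.
have {}hA : forall x, K x -> `|x| <= A + 1 by move=> x Kx; apply: (hA (A + 1)) => //; rewrite ltrDl.
have mK : measurable (K : set (measurableTypeR R)) by exact: compact_measurable.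
have /integrableP[_] := hf (A + 1); apply: le_lt_trans.
rewrite integral_mkcond; apply: ge0_le_integral => //.
- by move=> x _; rewrite patchE; case: ifP.
- apply: (iffLR (measurable_restrictT _ mK)); apply: measurable_funTS.
  by apply/measurable_EFinP; exact: mble_norm mf.
- apply: measurableT_comp => //; apply/measurable_EFinP; apply: mbleM mf _.
  by apply: mble_indic; exact: measurable_itv.
- move=> x _; rewrite patchE; case: ifPn => [|_]; last exact: abse_ge0.
  rewrite inE => /hA hx /=; rewrite indicE mem_set/= ?mulr1//.
  by rewrite in_itv/= -ler_norml.
Qed.

Lemma indic_itg (A : R) : itg (\1_(`[- A, A]%classic) : R -> R).
Proof.
exact: integrable_indic_itv.
Qed.

Lemma L2_loc f : L2 f -> loc f.
Proof.
move=> hf; apply: locP => [|A]; first exact: hf.1.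
apply: (L2_mul hf); split; first by apply: mble_indic; exact: measurable_itv.
by apply: eq_integrable (indic_itg A) => // x _ /=; rewrite indicE; case: (_ \in _); rewrite ?expr1n ?expr0n.
Qed.

Lemma itg_loc f : itg f -> loc f.
Proof.
move=> hf; apply: locP => [|A]; first exact: itg_mble hf.
apply: eq_integrable (itg_bdd (g := \1_(`[- A, A]%classic)) (C := 1) _ _ hf) => //.
- by move=> x _ /=; rewrite mulrC.
- by apply: mble_indic; exact: measurable_itv.
- by move=> x; rewrite indicE; case: (_ \in _); rewrite ?normr1 ?normr0.
Qed.

Lemma cont_loc f : continuous f -> loc f.
Proof.
move=> cf; split; [exact: mble_cont|exact: openT|move=> K _ cK].
have := @continuous_compact_integrable _ f K cK (continuous_subspaceT cf).
by move=> /integrableP[].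
Qed.

Lemma cont_compact_bdd f (A : R) : 0 < A -> continuous f -> (forall x : R, A < `|x| -> f x = 0) ->
  exists2 C : R, 0 <= C & forall x : R, `|f x| <= C.
Proof.
move=> A0 cf fA; have cI : {within `[- A, A], continuous (fun x => `|f x|)}.
  apply: continuous_subspaceT => x.
  exact: (@continuous_comp _ _ _ f (fun y : R => `|y|) x (cf x) (@norm_continuous R R _)).
have AA : - A <= A by rewrite ge0_cp// ltW.
have [c _ hc] := EVT_max AA cI.
exists (`|f c|) => // x; case: (ltrP A `|x|) => hx; first by rewrite fA ?normr0.
by apply: hc; rewrite in_itv/= -ler_norml.
Qed.

Lemma loc_test f eta : loc f -> test_function eta -> itg (fun x => f x * eta x).
Proof.
move=> lf /testP[/C1_continuous ce [A A0 hA]].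
by have [C _ hC] := cont_compact_bdd A0 ce hA; apply: (loc_itg (A := A) (C := C)) => //; exact: mble_cont.
Qed.

Lemma loc_testd f eta : loc f -> test_function eta -> itg (fun x => f x * derive1 eta x).
Proof.
move=> lf /testP[[_ ce] [A A0 hA]]; have hA' := test_derive_out hA.
by have [C _ hC] := cont_compact_bdd A0 ce hA'; apply: (loc_itg (A := A) (C := C)) => //; exact: mble_cont.
Qed.

End TestFunctions.

(** * Weak derivatives and the fundamental lemma of the calculus of variations *)

Section WeakDerivative.
Context {R : realType}.
Implicit Types f g h eta : R -> R.
Local Notation mu := (@mu R).

(** For each n the primitive of f started at - n vanishes identically, so Lebesgue differentiation
    gives f = 0 almost everywhere to the right of - n. *)
Lemma loc_int_eq0 f : loc f -> (forall a b : R, a < b -> \int[mu]_(x in `]a, b[) f x = 0) ->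
  aeq f (fun=> 0).
Proof.
move=> lf hf.
have key (n : nat) : {ae mu, forall x, - n%:R < x -> f x = 0}.
  have hi (y : R) : (lebesgue_measure : {measure set (measurableTypeR R) -> \bar R}).-integrable
      [set` Interval (BRight (- n%:R)) (BRight y)] (EFin \o f).
    have : (lebesgue_measure : {measure set (measurableTypeR R) -> \bar R}).-integrable
      `[- n%:R, y] (EFin \o f).
      case: lf => mf _ hK; apply/integrableP; split.
        exact: measurable_funTS (measurableT_comp _ mf).
      by apply: hK => //; exact: segment_compact.
    by apply: integrableS => //; apply: subset_itvr; rewrite bnd_simp.
  have := FTC1 hi lf; rewrite /=.
  rewrite (_ : (fun x : R => _) = fun=> 0); last first.
    apply/funext => y; case: (ltrP (- n%:R) y) => ny.
      rewrite -Rintegral_itv_bndo_bndc; first exact: hf.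
      by apply: integrableS (hi y) => //; apply: subset_itvl; rewrite bnd_simp.
    by rewrite set_itv_ge ?Rintegral_set0// bnd_simp -leNgt.
  apply: ae_mono => x /= h nx; have [|_ <-] := h; first by rewrite lte_fin.
  by rewrite derive1_cst.
have : {ae mu, forall x, forall n : nat, - n%:R < x -> f x = 0}.
  by apply/ae_foralln => n; exact: key.
apply: ae_mono => x h; apply: (h (Num.Def.truncn `|x|).+1).
rewrite ltrNl; apply: le_lt_trans (ler_norm _) _; rewrite normrN.
by rewrite -truncn_le_nat.
Qed.

(** Testing against [plateau n a b] and letting n grow, dominated convergence shows that the
    integral over every ]a, b[ is zero. *)
Lemma fundamental_lemma f : loc f ->
  (forall eta, test_function eta -> \int[mu]_x (f x * eta x) = 0) -> aeq f (fun=> 0).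
Proof.
move=> lf hf; apply: loc_int_eq0 => // a b ab.
have mf : mble f by case: lf.
have out (x : R) : `|a| + `|b| < `|x| -> ~~ (a < x < b).
  move=> hx; apply/negP => /andP[h1 h2]; move: hx; rewrite ltNge => /negP; apply.
  rewrite ler_norml; have := ler_norm a; have := ler_norm b; have := ler_norm (- a).
  have := ler_norm (- b); rewrite !normrN => *.
  by apply/andP; split; have := normr_ge0 a; have := normr_ge0 b; lra.
have [|||||_ cv] := @DCT R (fun n x => f x * plateau n a b x) (fun x => f x * \1_(`]a, b[%classic) x)
   (fun x => `|f x * \1_(`[- (`|a| + `|b|), `|a| + `|b|]%classic) x|).
- by move=> n; apply: itg_mble; apply: loc_test => //; apply: plateau_test; exact: ltW.
- by apply: mbleM => //; apply: mble_indic; exact: measurable_itv.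
- exact/itg_abs/loc_itg_itv.
- apply: ae_all => x; apply: cvgM; first exact: cvg_cst.
  rewrite indicE; have [hx|hx] := boolP (a < x < b).
    by rewrite mem_set /= ?in_itv//=; exact: plateau_cvg.
  rewrite memNset/=; last by rewrite in_itv/=; exact/negP.
  by rewrite (_ : (fun n => _) = fun=> 0); [exact: cvg_cst|apply/funext => n; rewrite plateau_out// ltW].
- apply: ae_all => x n; case: (ltrP (`|a| + `|b|) `|x|) => hx.
    by rewrite (plateau_out n (ltW ab) (out _ hx)) mulr0 normr0.
  rewrite indicE mem_set/= ?mulr1; last by rewrite in_itv/= -ler_norml.
  have /andP[p0 p1] := plateau_bd n a b x.
  by rewrite normrM (ger0_norm p0) ler_piMr.
rewrite Rintegral_mkcond; transitivity (\int[mu]_x (f x * \1_(`]a, b[%classic) x)).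
  by apply: eq_Rintegral => x _; rewrite patchE indicE; case: ifP => _ /=; rewrite ?mulr1 ?mulr0.
apply: (cvg_unique (@Rhausdorff R) cv).
rewrite (_ : (fun n => _) = fun=> 0); first exact: cvg_cst.
by apply/funext => n; apply: hf; apply: plateau_test; exact: ltW.
Qed.

Lemma weak_deriv_unique f g h : weak_deriv f g -> weak_deriv f h -> aeq g h.
Proof.
move=> [_ lg hg] [_ lh hh].
have : aeq (fun x => g x - h x) (fun=> 0).
  apply: fundamental_lemma; first exact: locally_integrableB.
  move=> eta te; transitivity (\int[mu]_x (g x * eta x - h x * eta x)).
    by apply: eq_Rintegral => x _; rewrite mulrBl.
  rewrite IntB; [|exact: loc_test|exact: loc_test].
  by apply/eqP; rewrite subr_eq0 -(inj_eq oppr_inj) -hg// -hh.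
by apply: ae_mono => x /eqP; rewrite subr_eq0 => /eqP.
Qed.

Lemma cont_cst (c : R) : continuous (fun _ : R => c).
Proof. by move=> x; exact: cvg_cst. Qed.

Lemma locD f g : loc f -> loc g -> loc (fun x => f x + g x).
Proof. exact: locally_integrableD. Qed.

Lemma locM f g : loc f -> continuous g -> loc (fun x => f x * g x).
Proof.
move=> lf cg; apply: locP; first by apply: mbleM; [case: lf|exact: mble_cont].
move=> A; have [A0|A0] := ltrP A 0.
  apply: eq_integrable itg0 => // x _ /=; rewrite indicE memNset ?mulr0//=.
  rewrite in_itv/= -ler_norml; apply/negP; rewrite -ltNge.
  exact: lt_le_trans A0 _.
have AA : - A <= A by rewrite ge0_cp.
have cI : {within `[- A, A], continuous (fun x => `|g x|)}.
  apply: continuous_subspaceT => x.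
  exact: (@continuous_comp _ _ _ g (fun y : R => `|y|) x (cg x) (@norm_continuous R R _)).
have [c _ hc] := EVT_max AA cI.
have := @itg_bdd _ (fun x => f x * \1_(`[- A, A]%classic) x) (fun x => g x * \1_(`[- A, A]%classic) x) `|g c|.
move=> /(_ _ _ (loc_itg_itv A lf)) h.
apply: eq_integrable (h _ _) => //.
- move=> x _ /=; congr (_%:E); rewrite indicE; case: (_ \in _) => /=; ring.
- by apply: mbleM; [exact: mble_cont|apply: mble_indic; exact: measurable_itv].
- move=> x; rewrite indicE; have [hx|hx] := boolP (x \in _) => /=; last by rewrite mulr0 normr0.
  by rewrite mulr1; apply: hc; move: hx; rewrite inE.
Qed.

Lemma locZ f c : loc f -> loc (fun x => c * f x).
Proof.
move=> lf.
by have := locM lf (@cont_cst c); congr loc; apply/funext => x; rewrite mulrC.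
Qed.

Lemma weak_derivD f1 g1 f2 g2 : weak_deriv f1 g1 -> weak_deriv f2 g2 ->
  weak_deriv (fun x => f1 x + f2 x) (fun x => g1 x + g2 x).
Proof.
move=> [lf1 lg1 h1] [lf2 lg2 h2]; split; [exact: locD|exact: locD|move=> eta te].
transitivity (\int[mu]_x (f1 x * derive1 eta x + f2 x * derive1 eta x)).
  by apply: eq_Rintegral => x _; rewrite mulrDl.
rewrite IntD; [|exact: loc_testd|exact: loc_testd]; rewrite h1// h2// -opprD.
rewrite -IntD; [|exact: loc_test|exact: loc_test].
by congr (- _); apply: eq_Rintegral => x _; rewrite mulrDl.
Qed.

Lemma weak_derivZ f g c : weak_deriv f g -> weak_deriv (fun x => c * f x) (fun x => c * g x).
Proof.
move=> [lf lg h]; split; [exact: locZ|exact: locZ|move=> eta te].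
transitivity (\int[mu]_x (c * (f x * derive1 eta x))).
  by apply: eq_Rintegral => x _; rewrite mulrA.
rewrite IntZ; last exact: loc_testd; rewrite h// mulrN -IntZ; last exact: loc_test.
by congr (- _); apply: eq_Rintegral => x _; rewrite mulrA.
Qed.

Lemma loc_ae f g : aeq f g -> mble g -> loc f -> loc g.
Proof.
move=> fg mg lf; apply: locP => // A.
have h := loc_itg_itv A lf; apply: itg_ae h; last first.
  by apply: mbleM mg _; apply: mble_indic; exact: measurable_itv.
by apply: ae_mono fg => x ->.
Qed.

Lemma weak_deriv_ae f g f' g' : aeq f f' -> aeq g g' -> mble f' -> mble g' ->
  weak_deriv f g -> weak_deriv f' g'.
Proof.
move=> ff gg mf mg [lf lg h].
have lf' := loc_ae ff mf lf; have lg' := loc_ae gg mg lg.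
split=> // eta te.
rewrite (@Int_ae _ _ (fun x => f x * derive1 eta x)).
- rewrite h//; congr (- _); apply: Int_ae.
  + by apply: ae_mono gg => x ->.
  + exact: itg_mble (loc_test lg te).
  + exact: itg_mble (loc_test lg' te).
- by apply: ae_mono ff => x ->.
- exact: itg_mble (loc_testd lf' te).
- exact: itg_mble (loc_testd lf te).
Qed.

Lemma C1_Int0 f : C1 f -> (exists2 A : R, 0 < A & forall x : R, A < `|x| -> f x = 0) ->
  \int[mu]_x derive1 f x = 0.
Proof.
move=> Cf [A A0 fA].
have fA' (x : R) : A + 1 < `|x| -> f x = 0 by move=> h; apply: fA; apply: lt_trans h; rewrite ltrDl.
rewrite (Int_itv (test_derive_out fA')) C1_FTC//; last by rewrite gtrN// addr_gt0.
by rewrite !fA ?subrr// ?normrN gtr0_norm ?addr_gt0// ltrDl.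
Qed.

Lemma testM f eta : C1 f -> test_function eta -> test_function (fun x => f x * eta x).
Proof.
move=> Cf /testP[Ce [A A0 hA]]; apply/testP; split; first exact: (C1M Cf Ce).1.
by exists A => // x /hA ->; rewrite mulr0.
Qed.

Lemma C1_weak_deriv f : C1 f -> weak_deriv f (derive1 f).
Proof.
move=> Cf; have lf := cont_loc (C1_continuous Cf); have lf' := cont_loc Cf.2.
split=> // eta te; have [Ce _] := iffLR (testP eta) te.
have [_ eD] := C1M Cf Ce; have := C1_Int0 (iffLR (testP _) (testM Cf te)).1 (iffLR (testP _) (testM Cf te)).2.
rewrite eD IntD; [|exact: loc_test|exact: loc_testd].
by move=> /eqP; rewrite addrC addr_eq0 => /eqP.
Qed.

(** The zero mean is what makes the primitive vanish to the right of the support, so that it is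
    again a test function. *)
Lemma test_primitive (phi : R -> R) (A : R) : 0 < A -> continuous phi ->
  (forall x : R, A < `|x| -> phi x = 0) -> \int[mu]_x phi x = 0 ->
  exists2 eta, test_function eta & derive1 eta = phi.
Proof.
move=> A0 cp pA p0.
pose eta (x : R) := \int[mu]_(t in `]-oo, x]) phi t.
have ip := itg_cont_compact A0 cp pA.
have hd : C1d eta phi.
  split=> // x.
  have [||||dx ex] := @continuous_FTC1 R phi (BInfty _ true) x (x + 1).
  - by rewrite ltrDl.
  - by apply: integrableS ip.
  - by rewrite ltNyr.
  - exact: cp.
  - by apply: DeriveDef; [exact: dx|rewrite -derive1E].
exists eta; last exact: C1dE.
apply/testP; split; first exact: C1d_C1 hd.
exists A => // x hx; rewrite /eta Rintegral_mkcond.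
have [x0|x0] := lerP x 0.
  rewrite (_ : (fun t => _) = fun=> 0) ?Int0//; apply/funext => t.
  rewrite patchE; case: ifPn => //; rewrite inE/= in_itv/= => tx.
  by apply: pA; apply: lt_le_trans hx _; rewrite !ler0_norm ?lerN2// (le_trans tx).
rewrite -[RHS]p0; apply: eq_Rintegral => t _.
rewrite patchE; case: ifPn => //; rewrite notin_setE/= in_itv/= => /negP; rewrite -ltNge => tx.
apply/esym/pA; apply: lt_trans hx _; rewrite !gtr0_norm//; exact: lt_trans tx.
Qed.

(** Two continuous functions that differ at a point differ on an interval, and no interval of
    positive length lies in a null set. *)
Lemma aeq_continuous f g : continuous f -> continuous g -> aeq f g -> f =1 g.
Proof.
move=> cf cg fg x; apply/eqP; apply: contrapT => /negP fgx.
have [e e0 he] : exists2 e : R, 0 < e & forall y : R, `|x - y| < e -> f y != g y.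
  have : \forall y \near x, f y - g y != 0.
    have cfg : (fun y => f y - g y) @ x --> f x - g x by apply: cvgB; [exact: cf|exact: cg].
    by apply: (cvgr_neq0 _ cfg); rewrite subr_eq0.
  by move=> /nbhs_ballP[e /= e0 he]; exists e => // y hy; rewrite -subr_eq0; apply: he.
case: fg => N [mN N0 hN].
have sub : `]x - e, x + e[%classic `<=` N.
  move=> y /=; rewrite in_itv/= => /andP[h1 h2]; apply: hN => /= fgy.
  have : f y != g y by apply: he; rewrite ltr_norml; apply/andP; split; lra.
  by rewrite fgy eqxx.
have : (mu `](x - e)%R, (x + e)%R[%classic <= mu N)%E.
  by apply: (le_measure lebesgue_measure) => //; rewrite inE//; exact: measurable_itv.
rewrite N0 /Defs.mu lebesgue_measure_itv/= lte_fin ltrD2l gtrN// -EFinB lee_fin.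
by rewrite leNgt => /negP; apply; lra.
Qed.

(** Fix a test function [rho0] of nonzero integral. Every test function minus its multiple of [rho0]
    of the same mean is the derivative of a test function, so f pairs with it to zero; this
    identifies f with a constant. *)
Lemma weak_deriv0_cst f : weak_deriv f (fun=> 0) -> exists c : R, aeq f (fun=> c).
Proof.
move=> [lf _ hf].
pose rho0 := plateau 1 (-1 : R) 1.
have t0 : test_function rho0 by apply: plateau_test; lra.
have [/C1_continuous c0 [A A0 hA]] := iffLR (testP _) t0.
have i0 : itg rho0 by exact: itg_cont_compact c0 hA.
set I := \int[mu]_x rho0 x.
have I0 : I != 0.
  apply/eqP => /(Int_eq0 i0) h.
  have {}h : aeq rho0 (fun=> 0).
    by apply: h => x; have /andP[] := plateau_bd 1 (-1 : R) 1 x.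
  have := aeq_continuous c0 (@cont_cst 0) h 0.
  have b0 : 0 < hump (-1 : R) 1 0 by apply: hump_gt0; apply/andP; split; lra.
  rewrite /rho0 /plateau mul1r => /eqP; rewrite subr_eq0 eq_sym invr_eq1.
  by rewrite -subr_eq0 addrC addKr gt_eqF.
exists (I^-1 * \int[mu]_x (f x * rho0 x)).
have : aeq (fun x => f x + (- (I^-1 * \int[mu]_x (f x * rho0 x)))) (fun=> 0); last first.
  by apply: ae_mono => x /eqP; rewrite addr_eq0 opprK => /eqP.
set c := I^-1 * _.
have lc : loc (fun=> - c) by apply: cont_loc => x; exact: cvg_cst.
apply: fundamental_lemma => [|phi tphi]; first exact: locD.
have [/C1_continuous cp [B B0 hB]] := iffLR (testP _) tphi.
have ip : itg phi by exact: itg_cont_compact cp hB.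
set J := \int[mu]_x phi x.
have [||||eta te eD] := @test_primitive (fun x => phi x - (J / I) * rho0 x) (A + B).
- exact: addr_gt0.
- move=> x; apply: cvgB; first exact: cp.
  by apply: cvgM; [exact: cvg_cst|exact: c0].
- move=> x hx; rewrite hA ?hB ?mulr0 ?subr0//; apply: lt_trans hx; rewrite ?ltrDl ?ltrDr//.
- rewrite IntB//; last exact: itgZ.
  by rewrite IntZ// -/I -/J divfK// subrr.
have := hf _ te; rewrite eD.
rewrite (_ : \int[mu]_x (0 * eta x) = 0); last first.
  by rewrite (_ : (fun x => _) = fun=> 0) ?Int0//; apply/funext => x; rewrite mul0r.
rewrite oppr0 => h.
transitivity (\int[mu]_x (f x * (phi x - (J / I) * rho0 x))); last by [].
have lp := loc_test lf tphi; have lr := loc_test lf t0.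
transitivity (\int[mu]_x (f x * phi x - c * phi x)).
  by apply: eq_Rintegral => x _; ring.
transitivity (\int[mu]_x (f x * phi x - J / I * (f x * rho0 x))); last first.
  by apply: eq_Rintegral => x _; ring.
rewrite IntB//; last exact: itgZ.
rewrite IntB//; last exact: itgZ.
by rewrite !IntZ// /c -/J; ring.
Qed.

End WeakDerivative.

(** * Primitives and continuous representatives of Sobolev functions *)

Section Representative.
Context {R : realType}.
Implicit Types f g h eta : R -> R.
Local Notation mu := (@mu R).
Local Notation leb := (lebesgue_measure : {sigma_finite_measure set (measurableTypeR R) -> \bar R}).

(** A product bound reduces integrability in the plane to one-dimensional integrals, by Tonelli. *)
Lemma Fubini_dominated (k : R -> R -> R) (a b : R -> R) :
  measurable_fun [set: (measurableTypeR R * measurableTypeR R)%type] (fun z => k z.1 z.2 : measurableTypeR R) ->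
  itg a -> itg b -> (forall x t, `|k x t| <= a x * b t) ->
  \int[mu]_x (\int[mu]_t k x t) = \int[mu]_t (\int[mu]_x k x t).
Proof.
move=> mk ia ib kab.
pose f (z : (measurableTypeR R * measurableTypeR R)%type) := (k z.1 z.2)%:E.
have mf : measurable_fun setT f by exact/measurable_EFinP.
have m1 x : mble (k x) by exact: (measurableT_comp mk (pair1_measurable (x : measurableTypeR R))).
have m2 t : mble (k ^~ t) by exact: (measurableT_comp mk (pair2_measurable (t : measurableTypeR R))).
have i1 x : itg (k x).
  apply: itg_le (itgZ (a x) ib) _; first exact: m1.
  by move=> t; apply: le_trans (kab x t) (ler_norm _).
have i2 t : itg (k ^~ t).
  apply: itg_le (itgZ (b t) ia) _; first exact: m2.
  by move=> x; rewrite [b t * _]mulrC; apply: le_trans (kab x t) (ler_norm _).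
have imf : (leb \x leb)%E.-integrable setT f.
  apply: (iffRL (@integrable12ltyP _ _ _ _ _ leb leb _ mf)).
  have /integrableP[_] := itgZ (\int[mu]_t b t) ia.
  apply: le_lt_trans; apply: ge0_le_integral => //.
  - by move=> x _; exact: integral_ge0.
  - apply: (measurable_fun_fubini_tonelli_F (m2 := leb) (abse \o f)) => //=.
    exact: measurableT_comp.
  - apply: measurableT_comp => //; apply/measurable_EFinP.
    exact: mbleM (mbleC _) (itg_mble ia).
  - move=> x _.
    have -> : (\int[leb]_y `|f (x, y)| = (\int[mu]_t `|k x t|)%:E)%E.
      rewrite /Rintegral fineK//.
      by apply: integrable_fin_num => //; exact: (itg_abs (i1 x)).
    rewrite lee_fin; apply: le_trans (ler_norm _); rewrite mulrC -IntZ//.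
    by apply: Int_le => //; [exact: itg_abs|exact: itgZ].
have e1 : (\int[leb]_x (\int[mu]_t k x t)%:E = \int[leb \x leb]_z f z)%E.
  rewrite -(integral12_prod_meas1 imf); apply: eq_integral => x _.
  by rewrite /Rintegral /fubini_F fineK//; exact: integrable_fin_num (i1 x).
have e2 : (\int[leb]_t (\int[mu]_x k x t)%:E = \int[leb \x leb]_z f z)%E.
  rewrite -(integral21_prod_meas1 imf); apply: eq_integral => x _.
  by rewrite /Rintegral /fubini_G fineK//; exact: integrable_fin_num (i2 x).
by rewrite [LHS]/Rintegral [RHS]/Rintegral; congr fine; rewrite [LHS]e1 -e2.
Qed.

(* [int_0^x g = int (ker x t) (g t) dt] *)
Definition ker (x t : R) : R :=
  if (0 <= t) && (t < x) then 1 else if (x <= t) && (t < 0) then -1 else 0.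

Definition primitive g (x : R) := \int[mu]_t (ker x t * g t).

Lemma ker_measurable :
  measurable_fun [set: (measurableTypeR R * measurableTypeR R)%type] (fun z => ker z.1 z.2 : measurableTypeR R).
Proof.
apply: measurable_fun_ifT => //.
  apply: measurable_and; first exact: measurable_fun_ler.
  exact: measurable_fun_ltr.
apply: measurable_fun_ifT => //.
apply: measurable_and; first exact: measurable_fun_ler.
exact: measurable_fun_ltr.
Qed.

Lemma ker_bd x t : `|ker x t| <= 1.
Proof. by rewrite /ker; case: ifP => _; [|case: ifP => _]; rewrite ?normrN ?normr1 ?normr0. Qed.

Lemma ker_out (x t A : R) : `|x| <= A -> A < `|t| -> ker x t = 0.
Proof.
rewrite ler_norml => /andP[h1 h2] ht; rewrite /ker; case: ifP => [/andP[a1 a2]|_].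
  by move: ht; rewrite ger0_norm// => ht; lra.
by case: ifP => // /andP[a1 a2]; move: ht; rewrite ltr0_norm// => ht; lra.
Qed.

Lemma ker_mble x : mble (ker x).
Proof. by exact: (measurableT_comp ker_measurable (pair1_measurable (x : measurableTypeR R))). Qed.

Lemma primitive_itg g x : L2 g -> itg (fun t => ker x t * g t).
Proof.
move=> /L2_loc lg.
have := @loc_itg _ _ (ker x) `|x| 1 lg (ker_mble x) (ker_bd x).
by move=> /(_ (fun t => ker_out (lexx _))); congr itg; apply/funext => t; rewrite mulrC.
Qed.

Lemma primitive_sub g (x y : R) : L2 g -> x <= y ->
  primitive g y - primitive g x = \int[mu]_t (\1_(`[x, y[%classic) t * g t).
Proof.
move=> hg xy; rewrite /primitive -IntB; [|exact: primitive_itg|exact: primitive_itg].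
apply: eq_Rintegral => t _; rewrite -mulrBl; congr (_ * _).
rewrite indicE /ker; have [hx|hx] := boolP (t \in `[x, y[%classic).
  move: hx; rewrite inE/= in_itv/= => /andP[h1 h2].
  case: (lerP 0 t) => h0 /=; first by rewrite h2 (ltNge t x) h1 /= ?andbF subr0.
  by rewrite (leNgt y t) h2 h1 /= sub0r opprK.
move: hx; rewrite notin_setE/= in_itv/= => /negP; rewrite negb_and -leNgt -ltNge.
case: (lerP 0 t) => h0 /=; last first.
  rewrite !andbT => /orP[h|h].
    by rewrite leNgt (lt_le_trans h xy) (leNgt x) h subr0.
  by rewrite h (le_trans xy h) subrr.
rewrite !andbF => /orP[h|h]; first by rewrite h (lt_le_trans h xy) subrr.
by rewrite (ltNge t y) h (ltNge t x) (le_trans xy h) subr0.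
Qed.

Lemma Int_indic_co (x y : R) : x <= y -> \int[mu]_t (\1_(`[x, y[%classic) t ^+ 2) = y - x.
Proof.
move=> xy; transitivity (\int[mu]_t (\1_(`[x, y[%classic) t : R)).
  by apply: eq_Rintegral => t _; rewrite indicE; case: (_ \in _); rewrite ?expr1n ?expr0n.
have mI : measurable (`[x, y[%classic : set (measurableTypeR R)) by exact: measurable_itv.
rewrite /Rintegral integral_indic//.
rewrite setIT [X in fine X](lebesgue_measure_itv `[x, y[)/= lte_fin.
by case: ltrP => // yx; rewrite (le_anti (introT andP (conj xy yx))) subrr.
Qed.

Lemma L2_indic_co (x y : R) : L2 (\1_(`[x, y[%classic) : R -> R).
Proof.
split; first by apply: mble_indic; exact: measurable_itv.
apply: eq_integrable (integrable_indic_itv x y true true) => // t _ /=.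
by rewrite indicE; case: (_ \in _); rewrite ?expr1n ?expr0n.
Qed.

(** Cauchy-Schwarz against the indicator function of the interval between x and y. *)
Lemma primitive_holder g (x y : R) : L2 g ->
  (primitive g y - primitive g x) ^+ 2 <= `|y - x| * \int[mu]_t (g t ^+ 2).
Proof.
move=> hg; wlog xy : x y / x <= y => [wl|].
  have /orP[xy|yx] := le_total x y; first exact: wl.
  by have := wl _ _ yx; rewrite -sqrrN opprB distrC.
rewrite primitive_sub// ger0_norm ?subr_ge0// -(Int_indic_co xy).
exact: L2_CauchySchwarz (L2_indic_co x y) hg.
Qed.

Lemma holder_continuous f (C : R) : (forall x y, (f y - f x) ^+ 2 <= `|y - x| * C) -> continuous f.
Proof.
move=> H x; have C0 : 0 <= C.
  have := le_trans (sqr_ge0 _) (H 0 1); rewrite subr0 normr1 mul1r; exact.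
apply/cvgrPdist_le => e e0; near=> y.
have h : `|x - y| <= e ^+ 2 / (C + 1).
  near: y; apply: (@cvgr_dist_le _ _ _ _ _ idfun x) => //.
  by rewrite divr_gt0 ?exprn_gt0// ltr_wpDl.
rewrite -(@ler_pXn2r _ 2)// ?nnegrE ?(ltW e0)// real_normK ?num_real//.
apply: le_trans (H y x) _; apply: le_trans (ler_wpM2r C0 h) _.
rewrite mulrAC ler_pdivrMr ?ltr_wpDl// ler_wpM2l ?sqr_ge0// lerDl//.
Unshelve. all: by end_near. Qed.

Lemma primitive_continuous g : L2 g -> continuous (primitive g).
Proof. by move=> hg; apply: holder_continuous => x y; exact: primitive_holder. Qed.

Lemma Int_derive_le eta (t : R) : test_function eta ->
  \int[mu]_x (if x <= t then derive1 eta x else 0) = eta t.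
Proof.
move=> /testP[Ce [A A0 hA]]; have hA' := test_derive_out hA.
have [tA|At] := lerP t (- A - 1).
  rewrite (_ : (fun x => _) = fun=> 0).
    by rewrite Int0 hA// ltr0_norm; lra.
  apply/funext => x; case: ifPn => // xt; apply: hA'; rewrite ltr0_norm; lra.
transitivity (\int[mu]_(x in `[- A - 1, t]) derive1 eta x).
  rewrite [RHS]Rintegral_mkcond; apply: eq_Rintegral => x _; rewrite patchE.
  case: ifPn => xt.
    case: ifPn => //; rewrite notin_setE/= in_itv/= => /negP; rewrite xt andbT -ltNge => xA.
    by apply: hA'; rewrite ltr0_norm; lra.
  by rewrite memNset//= in_itv/= (negPf xt) andbF.
by rewrite C1_FTC// (hA (- A - 1)) ?subr0// ltr0_norm; lra.
Qed.

(** As a function of x, the kernel is 1 on x > t when t >= 0 and - 1 on x <= t when t < 0. Both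
    cases give the same value because the derivative of [eta] has zero mean. *)
Lemma Int_ker_derive eta (t : R) : test_function eta -> \int[mu]_x (ker x t * derive1 eta x) = - eta t.
Proof.
move=> te; have [Ce [A A0 hA]] := iffLR (testP _) te.
have ie : itg (derive1 eta) by exact: itg_cont_compact A0 Ce.2 (test_derive_out hA).
have il : itg (fun x => if x <= t then derive1 eta x else 0).
  apply: (itg_le _ ie).
    apply: measurable_fun_ifT => //; last exact: itg_mble ie.
    exact: measurable_fun_ler.
  by move=> x; case: ifP; rewrite ?normr0.
have [t0|t0] := lerP 0 t.
  transitivity (\int[mu]_x (derive1 eta x - (if x <= t then derive1 eta x else 0))).
    apply: eq_Rintegral => x _; rewrite /ker t0/= ltNge (ltNge t 0) t0 andbF.
    by case: (lerP x t) => _ /=; rewrite ?mul0r ?subrr ?mul1r ?subr0.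
  by rewrite IntB// Int_derive_le// C1_Int0 ?sub0r//; exists A.
transitivity (\int[mu]_x (- (if x <= t then derive1 eta x else 0))).
  apply: eq_Rintegral => x _; rewrite /ker t0/= (leNgt 0) t0/= andbT.
  by case: (lerP x t) => _ /=; rewrite ?mul0r ?oppr0 ?mulN1r.
by rewrite IntN// Int_derive_le.
Qed.

(** Fubini lets the derivative of the test function be integrated against [ker] first, and that
    integral is minus the test function. *)
Lemma primitive_weak_deriv g : L2 g -> weak_deriv (primitive g) g.
Proof.
move=> hg; split; [exact/cont_loc/primitive_continuous|exact: L2_loc|move=> eta te].
have [Ce [A A0 hA]] := iffLR (testP _) te; have hA' := test_derive_out hA.
have [C C0 hC] := cont_compact_bdd A0 Ce.2 hA'.
have lg := L2_loc hg; have mg := hg.1.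
transitivity (\int[mu]_x \int[mu]_t (ker x t * g t * derive1 eta x)).
  apply: eq_Rintegral => x _; rewrite /primitive mulrC -IntZ; last exact: primitive_itg.
  by apply: eq_Rintegral => t _; rewrite mulrC.
rewrite (@Fubini_dominated _ (fun x => C * \1_(`[- A, A]%classic) x)
    (fun t => `|g t * \1_(`[- A, A]%classic) t|)).
- rewrite -IntN; last exact: loc_test.
  apply: eq_Rintegral => t _; rewrite -mulrN -Int_ker_derive// -IntZ.
    by apply: eq_Rintegral => x _; ring.
  apply: itg_le (itg_cont_compact A0 Ce.2 hA') _.
    apply: mbleM; last exact: mble_cont Ce.2.
    by exact: (measurableT_comp ker_measurable (pair2_measurable (t : measurableTypeR R))).
  by move=> x; rewrite normrM ler_piMl// ker_bd.
- apply: measurable_funM; first apply: measurable_funM.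
  + exact: ker_measurable.
  + by apply: (measurableT_comp mg).
  + by apply: (measurableT_comp (mble_cont Ce.2)).
- exact: itgZ (indic_itg A).
- exact: itg_abs (loc_itg_itv A lg).
- have ind1 (y : R) : `|y| <= A -> \1_(`[- A, A]%classic) y = 1 :> R.
    by move=> hy; rewrite indicE mem_set//= in_itv/= -ler_norml.
  have ind0 (y : R) : 0 <= \1_(`[- A, A]%classic) y :> R by rewrite indicE.
  move=> x t; have [hx|hx] := lerP `|x| A; last first.
    by rewrite hA'// mulr0 normr0 !mulr_ge0.
  have [ht|ht] := lerP `|t| A; last first.
    by rewrite (ker_out hx ht) !mul0r normr0 !mulr_ge0.
  rewrite !ind1// !mulr1 normrM normrM mulrC; apply: ler_pM => //.
  by rewrite ler_piMl// ker_bd.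
Qed.

(** The difference between f and [primitive g] has zero weak derivative, so f is a primitive of g up
    to a constant, and the Hölder bound is inherited. *)
Lemma H1_representative f g : L2 f -> L2 g -> weak_deriv f g ->
  exists F : R -> R, [/\ continuous F, aeq f F,
    forall x y, (F y - F x) ^+ 2 <= `|y - x| * \int[mu]_t (g t ^+ 2) &
    forall x, F x ^+ 2 <= 2 * \int[mu]_t (f t ^+ 2) + 2 * \int[mu]_t (g t ^+ 2)].
Proof.
move=> hf hg fg; have pg := primitive_weak_deriv hg.
have wd0 : weak_deriv (fun x => f x + (-1) * primitive g x) (fun=> 0).
  have := weak_derivD fg (weak_derivZ (-1) pg); congr weak_deriv.
  by apply/funext => x; rewrite mulN1r subrr.
have [c hc] := weak_deriv0_cst wd0.
have hol x y : (primitive g y + c - (primitive g x + c)) ^+ 2 <= `|y - x| * \int[mu]_t (g t ^+ 2).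
  by rewrite opprD addrACA subrr addr0; exact: primitive_holder.
have fF : aeq f (fun x => primitive g x + c).
  by apply: ae_mono hc => x <-; ring.
exists (fun x => primitive g x + c); split=> //; first exact: holder_continuous hol.
move=> x; set F := (fun x => primitive g x + c).
have cF : continuous F := holder_continuous hol.
have hF : L2 F by apply: L2_ae fF _ hf; exact: mble_cont.
have -> : \int[mu]_t (f t ^+ 2) = \int[mu]_t (F t ^+ 2).
  apply: Int_ae; last exact: mbleX hF.1; last exact: mbleX hf.1.
  by apply: ae_mono fF => t ->.
set G := \int[mu]_t (g t ^+ 2).
have l1 := L2_indic_co x (x + 1); have e1 : \int[mu]_t (\1_(`[x, (x + 1)[%classic) t ^+ 2) = (1 : R).
  have xx : x <= x + 1 by rewrite lerDl.
  by rewrite (Int_indic_co xx) [x + 1]addrC addrK.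
(* For t in [x, x + 1[ one has F(x)^2 <= 2 F(t)^2 + 2 (F(x) - F(t))^2; this is integrated over that
   interval of length 1. *)
have -> : F x ^+ 2 = \int[mu]_t (F x ^+ 2 * \1_(`[x, (x + 1)[%classic) t ^+ 2).
  by rewrite (IntZ (F x ^+ 2) l1.2) e1 mulr1.
have -> : 2 * \int[mu]_t (F t ^+ 2) + 2 * G =
    \int[mu]_t (2 * F t ^+ 2 + 2 * G * \1_(`[x, (x + 1)[%classic) t ^+ 2).
  have i1 := itgZ 2 hF.2; have i2 := itgZ (2 * G) l1.2.
  by rewrite (IntD i1 i2) (IntZ 2 hF.2) (IntZ (2 * G) l1.2) e1 mulr1.
apply: Int_le; [exact: itgZ l1.2|by apply: itgD; apply: itgZ; [exact: hF.2|exact: l1.2]|].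
move=> t; rewrite indicE; have [ht|ht] := boolP (t \in _) => /=; last first.
  by rewrite expr0n/= !mulr0 addr0 mulr_ge0// sqr_ge0.
rewrite expr1n !mulr1; move: ht; rewrite inE/= in_itv/= => /andP[h1 h2].
have G0 : 0 <= G by apply: Int_ge0 => s; exact: sqr_ge0.
have := hol x t; rewrite -/(F x) -/(F t) -/G ger0_norm ?subr_ge0// => h3.
have : (t - x) * G <= G by rewrite ler_piMl//; lra.
by have := sqr_ge0 (F x - 2 * F t); have := sqr_ge0 (F x - F t); nra.
Qed.

End Representative.

(** Locked, so that inner products remain opaque atoms in algebraic manipulations. *)
HB.lock Definition ip (R : realType) (f g : R -> R) : R := \int[@mu R]_x (f x * g x).

(** * The Hilbert space structure of H^1 *)

Section SobolevSpace.
Context {R : realType}.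
Implicit Types f g h : R -> R.
Local Notation mu := (@mu R).
Local Notation D := (@wderiv R).

(** One operation stands for sums, differences and multiples, so bilinearity is stated once for all
    of them. *)
Definition lin a f b g := fun x : R => a * f x + b * g x.

Lemma ipE f g : ip f g = \int[mu]_x (f x * g x).
Proof. by rewrite ip.unlock. Qed.

Lemma ipC f g : ip f g = ip g f.
Proof. by rewrite !ipE; apply: eq_Rintegral => x _; rewrite mulrC. Qed.

Lemma L2_lin a f b g : L2 f -> L2 g -> L2 (lin a f b g).
Proof. by move=> hf hg; apply: L2D; exact: L2Z. Qed.

Lemma ip_linl a f b g h : L2 f -> L2 g -> L2 h ->
  ip (lin a f b g) h = a * ip f h + b * ip g h.
Proof.
move=> hf hg hh; rewrite !ipE.
have i1 := L2_mul hf hh; have i2 := L2_mul hg hh.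
rewrite -(IntZ a i1) -(IntZ b i2) -(IntD (itgZ a i1) (itgZ b i2)).
by apply: eq_Rintegral => x _; rewrite /lin; ring.
Qed.

Lemma ip_ae f g f' g' : aeq f f' -> aeq g g' -> L2 f -> L2 f' -> L2 g -> L2 g' ->
  ip f g = ip f' g'.
Proof.
move=> ff gg hf hf' hg hg'; rewrite !ipE; apply: Int_ae.
- by apply: ae_mono (ae_and ff gg) => x [-> ->].
- exact: mbleM hf.1 hg.1.
- exact: mbleM hf'.1 hg'.1.
Qed.

Lemma ip_ge0 f : 0 <= ip f f.
Proof. by rewrite ipE; apply: Int_ge0 => x; rewrite -expr2 sqr_ge0. Qed.

Lemma ip_sqr f : ip f f = \int[mu]_x (f x ^+ 2).
Proof. by rewrite ipE; apply: eq_Rintegral => x _; rewrite expr2. Qed.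

Lemma ip_CS f g : L2 f -> L2 g -> ip f g ^+ 2 <= ip f f * ip g g.
Proof. by move=> hf hg; rewrite !ip_sqr ipE; exact: L2_CauchySchwarz. Qed.

Lemma ip_eq0 f : L2 f -> ip f f = 0 -> aeq f (fun=> 0).
Proof.
move=> hf; rewrite ip_sqr => h.
have := Int_eq0 hf.2 (fun x => sqr_ge0 (f x)) h.
by apply: ae_mono => x /eqP; rewrite sqrf_eq0 => /eqP.
Qed.

Definition H1 f := [/\ L2 f, L2 (D f) & weak_deriv f (D f)].

Lemma H1I f g : L2 f -> L2 g -> weak_deriv f g -> H1 f /\ aeq (D f) g.
Proof.
move=> hf hg fg.
have dD : weak_deriv f (D f) by rewrite /wderiv; exact: (xgetI (fun=> 0) (x := g)).
have e := weak_deriv_unique dD fg; split=> //; split=> //.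
by apply: L2_ae (aeq_sym e) _ hg; case: dD => _ [].
Qed.

Lemma H1P f : H1r f <-> H1 f.
Proof.
split=> [[/L2P hf [g /L2P hg fg]]|[/L2P hf /L2P hg fg]]; first by case: (H1I hf hg fg).
by split=> //; exists (D f).
Qed.

Lemma H1_L2 f : H1 f -> L2 f. Proof. by case. Qed.
Lemma H1_DL2 f : H1 f -> L2 (D f). Proof. by case. Qed.

Lemma H1_ae f g : aeq f g -> mble g -> H1 f -> H1 g /\ aeq (D g) (D f).
Proof.
move=> fg mg [hf hd w]; apply: H1I => //; first exact: L2_ae fg mg hf.
by apply: weak_deriv_ae fg (ae_all (fun=> erefl)) mg hd.1 w.
Qed.

Lemma H1_lin a f b g : H1 f -> H1 g ->
  H1 (lin a f b g) /\ aeq (D (lin a f b g)) (lin a (D f) b (D g)).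
Proof.
move=> [f1 f2 f3] [g1 g2 g3]; apply: H1I; [exact: L2_lin|exact: L2_lin|].
exact: weak_derivD (weak_derivZ a f3) (weak_derivZ b g3).
Qed.

Lemma H1_Z a f : H1 f -> H1 (fun x => a * f x) /\ aeq (D (fun x => a * f x)) (fun x => a * D f x).
Proof. by move=> [f1 f2 f3]; apply: H1I; [exact: L2Z|exact: L2Z|exact: weak_derivZ]. Qed.

Lemma H1_0 : H1 (fun=> 0).
Proof.
have w : weak_deriv (fun=> 0 : R) (fun=> 0).
  by have := C1_weak_deriv (C1d_C1 (C1_cst (0 : R))); rewrite (C1dE (C1_cst 0)).
by case: (H1I L2_0 L2_0 w).
Qed.

Definition dip f g := ip (D f) (D g).

Lemma dip_linl a f b g h : H1 f -> H1 g -> H1 h ->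
  dip (lin a f b g) h = a * dip f h + b * dip g h.
Proof.
move=> hf hg hh; have [h1 h2] := H1_lin a b hf hg.
rewrite /dip -(ip_linl a b (H1_DL2 hf) (H1_DL2 hg) (H1_DL2 hh)).
apply: ip_ae => //; first exact: ae_all.
- exact: H1_DL2.
- by apply: L2_lin; exact: H1_DL2.
- exact: H1_DL2.
- exact: H1_DL2.
Qed.

Definition h1 f g := ip f g + dip f g.

Lemma h1C f g : h1 f g = h1 g f.
Proof. by rewrite /h1 /dip ipC [X in _ + X]ipC. Qed.

Lemma h1_ge0 f : 0 <= h1 f f.
Proof. by rewrite addr_ge0// ip_ge0. Qed.

Lemma h1_linl a f b g h : H1 f -> H1 g -> H1 h ->
  h1 (lin a f b g) h = a * h1 f h + b * h1 g h.
Proof.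
move=> hf hg hh; rewrite /h1 dip_linl// ip_linl; [ring|exact: H1_L2..].
Qed.

(* Continuous representative; the constants come from averaging over [x, x + 1]. *)
Lemma H1_rep f : H1 f -> exists F : R -> R, [/\ continuous F, aeq f F,
    forall x y, (F y - F x) ^+ 2 <= `|y - x| * h1 f f &
    forall x, F x ^+ 2 <= 2 * h1 f f].
Proof.
move=> [hf hd w]; have [F [c e h b]] := H1_representative hf hd w.
exists F; rewrite /h1 /dip !ip_sqr; split=> //; last by move=> x; rewrite mulrDr.
move=> x y; apply: le_trans (h x y) _; rewrite ler_wpM2l// lerDr.
by apply: Int_ge0 => t; exact: sqr_ge0.
Qed.

Lemma H1_sup f : H1 f -> {ae mu, forall x, f x ^+ 2 <= 2 * h1 f f}.
Proof. by move=> /H1_rep[F [_ e _ b]]; apply: ae_mono e => x ->. Qed.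

End SobolevSpace.

(** * Completeness of L^2 for rapidly converging sequences *)

Section Completeness.
Context {R : realType}.
Implicit Types f g h : R -> R.
Local Notation mu := (@mu R).
Local Notation leb := (lebesgue_measure : {measure set (measurableTypeR R) -> \bar R}).

Lemma cvg_half : (2^-1 : R) ^+ n @[n --> \oo] --> (0 : R).
Proof. by apply: cvg_expr; rewrite ger0_norm ?invr_ge0//; lra. Qed.

Lemma cvg_halving_increments (a : nat -> R) (s : R) : 0 <= s ->
  (forall k, `|a k.+1 - a k| <= 2^-1 ^+ k * s) ->
  exists2 l, a n @[n --> \oo] --> l & forall m, `|l - a m| <= 2 * 2^-1 ^+ m * s.
Proof.
move=> s0 H; have qS k : 2 * (2^-1 : R) ^+ k.+1 = 2^-1 ^+ k by rewrite exprS; field.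
have q0 k : 0 <= (2^-1 : R) ^+ k by rewrite exprn_ge0// invr_ge0.
have inc m n : `|a (m + n)%N - a m| <= (2 * 2^-1 ^+ m - 2 * 2^-1 ^+ (m + n)) * s.
  elim: n => [|n ih]; first by rewrite addn0 !subrr normr0 mul0r.
  rewrite addnS; apply: le_trans (ler_distD (a (m + n)%N) _ _) _.
  apply: le_trans (lerD (H _) ih) _; rewrite -[X in X + _]mulr1 qS.
  have := qS (m + n)%N; set x := 2^-1 ^+ (m + n); set y := 2^-1 ^+ m => _.
  by rewrite le_eqVlt; apply/orP; left; apply/eqP; ring.
(* Subtracting the tail of the geometric bound makes the sequence nondecreasing, so monotone
   convergence provides the limit. *)
pose b n := a n - 2 * 2^-1 ^+ n * s.
have nb : nondecreasing_seq b.
  apply/nondecreasing_seqP => n; rewrite /b qS.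
  by have := H n; rewrite ler_norml => /andP[h1 h2]; lra.
have ub : has_ubound (range b).
  exists (a 0%N + 2 * s) => _ [n _ <-]; rewrite /b.
  have := inc 0%N n; rewrite add0n expr0 ler_norml => /andP[_ h].
  by have := mulr_ge0 (q0 n) s0; lra.
have cb := nondecreasing_is_cvgn nb ub.
have ca : a n @[n --> \oo] --> limn b.
  rewrite (_ : a = fun n => b n + 2^-1 ^+ n * (2 * s)); last first.
    by apply/funext => n; rewrite /b; ring.
  rewrite -[limn b]addr0; apply: cvgD; first exact: cb.
  by rewrite -(mul0r (2 * s)); apply: cvgM; [exact: cvg_half|exact: cvg_cst].
exists (limn b) => // m.
have cd : `|a n - a m| @[n --> \oo] --> `|limn b - a m|.
  by apply: cvg_norm; apply: cvgB => //; exact: cvg_cst.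
rewrite -(cvg_lim (@Rhausdorff R) cd); apply: limr_le; first by apply: cvgP cd.
near=> n; have mn : (m <= n)%N by near: n; exact: nbhs_infty_ge.
rewrite -(subnKC mn); apply: le_trans (inc m (n - m)%N) _.
by rewrite ler_wpM2r// lerBlDr lerDl mulr_ge0.
Unshelve. all: by end_near. Qed.

(* If the increments d_k have squared norms 8^-k then G = sum_k 4^k d_k^2 is
   integrable, so that |d_k| <= 2^-k sqrt G almost everywhere. *)
Lemma L2_complete (f_ : nat -> R -> R) : (forall n, L2 (f_ n)) ->
  (forall n, \int[mu]_x ((f_ n.+1 x - f_ n x) ^+ 2) <= 8^-1 ^+ n) ->
  exists f C, L2 f /\ forall n, \int[mu]_x ((f x - f_ n x) ^+ 2) <= C * 4^-1 ^+ n.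
Proof.
move=> hf hd; pose d k x := f_ k.+1 x - f_ k x.
have Ld k : L2 (d k) by exact: L2B.
pose u k (x : measurableTypeR R) := (4 ^+ k * d k x ^+ 2)%:E.
have iu k : itg (fun x => 4 ^+ k * d k x ^+ 2) by apply: itgZ; exact: (Ld k).2.
have u0 k x : (0 <= u k x)%E by rewrite lee_fin mulr_ge0 ?sqr_ge0 ?exprn_ge0.
have mu_ k : measurable_fun setT (u k) by apply/measurable_EFinP; exact: itg_mble (iu k).
pose G (x : measurableTypeR R) := (\sum_(k <oo) u k x)%E.
have G0 x : (0 <= G x)%E by apply: nneseries_ge0 => k _ _; exact: u0.
have mG : measurable_fun setT G 
  by exact: (@ge0_emeasurable_sum _ _ _ setT u xpredT (fun k x _ _ => u0 k x) (fun k _ => mu_ k)).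
have fG : (\int[leb]_x G x < +oo)%E.
  rewrite (@integral_nneseries _ _ _ leb setT measurableT u mu_ (fun k x _ => u0 k x)).
  (* The k-th term is at most 4^k 8^-k = 2^-k, written here as 2 / 2^(k + 1). *)
  apply: (@le_lt_trans _ _ (\sum_(k <oo) ((2 / (2 ^ (k + 1))%:R)%:E : \bar R))%E).
    apply: lee_nneseries => [k _ _|k _]; first by apply: integral_ge0 => *; exact: u0.
    have -> : (\int[leb]_x u k x = (4 ^+ k * \int[mu]_x (d k x ^+ 2))%:E)%E.
      rewrite -(IntZ _ (Ld k).2) /Rintegral fineK//.
      by apply: integrable_fin_num => //; exact: iu.
    rewrite lee_fin; apply: le_trans (ler_wpM2l _ (hd k)) _; first exact: exprn_ge0.
    rewrite -exprMn natrX addn1 exprS invfM mulrA divff// mul1r -exprVn.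
    by rewrite (_ : 4 / 8 = 2^-1 :> R)//; field.
  have := @cvg_geometric_eseries_half R 2 0; rewrite /eseries/= => /cvg_lim.
  by move=> /(_ (@ereal_hausdorff R)) ->; rewrite ltry.
have iG : leb.-integrable setT G.
  by apply/integrableP; split=> //; apply: le_lt_trans fG; apply: ge0_le_integral => //; [exact: measurableT_comp|by move=> x _; rewrite gee0_abs].
pose Gr (x : R) := fine (G x).
have aeG : {ae mu, forall x, G x = (Gr x)%:E}.
  have h : {ae mu, forall x, setT x -> G x \is a fin_num} := integrable_ae measurableT iG.
  by apply: ae_mono h => x /(_ I) h; rewrite /Gr fineK.
have iGr : itg Gr.
  apply/integrableP; split.
    by apply/measurable_EFinP; exact: measurableT_comp mG.
  have/integrableP[_] := iG; apply: le_lt_trans; apply: ge0_le_integral => //.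
  - do 2! apply: measurableT_comp => //; exact: measurableT_comp mG.
  - exact: measurableT_comp.
  - move=> x _; rewrite /Gr/=; case: (G x) (G0 x) => //= _.
    by rewrite normr0 leey.
have Gr0 x : 0 <= Gr x by rewrite /Gr fine_ge0.
have bd : {ae mu, forall x, forall k, `|f_ k.+1 x - f_ k x| <= 2^-1 ^+ k * Num.sqrt (Gr x)}.
  apply: ae_mono aeG => x ex k.
  have h : 4 ^+ k * d k x ^+ 2 <= Gr x.
    have := @nneseries_lim_ge R (fun i => u i x) xpredT 0 k.+1 (fun i _ _ => u0 i x).
    rewrite -lee_fin -ex; apply: le_trans.
    by rewrite big_nat_recr//= leeDr// sume_ge0.
  rewrite -[leRHS]ger0_norm ?mulr_ge0 ?sqrtr_ge0 ?exprn_ge0 ?invr_ge0//.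
  rewrite -(@ler_pXn2r _ 2)// ?nnegrE// !real_normK ?num_real//.
  rewrite exprMn sqr_sqrtr// -exprM mulnC exprM exprVn -natrX -/(d k x).
  by rewrite exprVn mulrC ler_pdivlMr ?exprn_gt0// mulrC.
(* The upper limit is measurable without any convergence, and equals the limit at almost every
   point. *)
pose f x := fine (limn_esup (fun n => (f_ n x)%:E)).
have mf : mble f.
  apply: measurableT_comp => //; apply: measurable_fun_limn_esup => n.
  by apply/measurable_EFinP; exact: (hf n).1.
have fP : {ae mu, forall x, forall m, (f x - f_ m x) ^+ 2 <= 4 * (4^-1 ^+ m * Gr x)}.
  apply: ae_mono bd => x hx m.
  have [l cl hl] := cvg_halving_increments (sqrtr_ge0 (Gr x)) hx.
  have cE : (f_ n x)%:E @[n --> \oo] --> l%:E by apply: cvg_EFin cl; exact: nearW.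
  have -> : f x = l.
    rewrite /f is_cvg_limn_esupE; last exact: cvgP cE.
    by rewrite (cvg_lim (@ereal_hausdorff R) cE).
  have h := hl m; have h2 := ler_pM (normr_ge0 _) (normr_ge0 _) h h.
  move: h2; rewrite -expr2 real_normK ?num_real// => /le_trans; apply.
  rewrite -expr2 !exprMn sqr_sqrtr// -exprM mulnC exprM.
  have -> : (2^-1 : R) ^+ 2 = 4^-1 by field.
  have -> : (2 : R) ^+ 2 = 4 by ring.
  by rewrite mulrA.
have Lfn m : L2 (fun x => f x - f_ m x) /\
    \int[mu]_x ((f x - f_ m x) ^+ 2) <= 4 * (\int[mu]_x Gr x) * 4^-1 ^+ m.
  have mm := mbleB mf (hf m).1.
  have ii := itgZ 4 (itgZ (4^-1 ^+ m) iGr).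
  have i2 : itg (fun x => (f x - f_ m x) ^+ 2).
    (* The pointwise bound holds only almost everywhere; the minimum is dominated everywhere and
       agrees with the square almost everywhere. *)
    pose t x := Num.min ((f x - f_ m x) ^+ 2) (4 * (4^-1 ^+ m * Gr x)).
    have mt : mble t by apply: measurable_minr; [exact: mbleX|exact: itg_mble ii].
    have p0 x : 0 <= 4 * (4^-1 ^+ m * Gr x) by rewrite !mulr_ge0 ?exprn_ge0 ?invr_ge0.
    apply: (@itg_ae _ t); last 2 [exact: mbleX].
      by apply: ae_mono fP => x /(_ m) h; rewrite /t min_l.
    apply: itg_le mt ii _ => x.
    by rewrite !ger0_norm// ?ge_min ?lexx ?orbT// le_min sqr_ge0 p0.
  split=> //.
  have -> : 4 * (\int[mu]_x Gr x) * 4^-1 ^+ m = \int[mu]_x (4 * (4^-1 ^+ m * Gr x)).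
    by rewrite (IntZ _ (itgZ _ iGr)) (IntZ _ iGr); ring.
  pose t x := Num.max ((f x - f_ m x) ^+ 2) (4 * (4^-1 ^+ m * Gr x)).
  have mt : mble t by apply: measurable_maxr; [exact: mbleX|exact: itg_mble ii].
  have et : aeq (fun x => 4 * (4^-1 ^+ m * Gr x)) t.
    by apply: ae_mono fP => x /(_ m) h; rewrite /t max_r.
  rewrite (Int_ae et (itg_mble ii) mt); apply: Int_le => //; first exact: itg_ae et mt ii.
  by move=> x; rewrite /t le_max lexx.
exists f, (4 * \int[mu]_x Gr x); split=> [|n]; last by case: (Lfn n).
have := L2D (Lfn 0%N).1 (hf 0%N); congr L2; apply/funext => x; exact: subrK.
Qed.

End Completeness.

(** * Completeness of H^1 for rapidly converging sequences *)

Section SobolevCompleteness.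
Context {R : realType}.
Implicit Types f g h eta : R -> R.
Local Notation mu := (@mu R).
Local Notation D := (@wderiv R).

Lemma L2_cont_compact f (A : R) : 0 < A -> continuous f ->
  (forall x, A < `|x| -> f x = 0) -> L2 f.
Proof.
move=> A0 cf hA; split; first exact: mble_cont.
apply: (itg_cont_compact A0); last by move=> x /hA ->; rewrite expr0n.
by move=> x; exact: (@continuous_comp _ _ _ f (fun y : R => y ^+ 2) x (cf x) (@exprn_continuous _ 2 _)).
Qed.

Lemma test_L2 eta : test_function eta -> L2 eta /\ L2 (derive1 eta).
Proof.
move=> /testP[Ce [A A0 hA]]; split.
  exact: L2_cont_compact A0 (C1_continuous Ce) hA.
exact: L2_cont_compact A0 Ce.2 (test_derive_out hA).
Qed.

Lemma test_H1 eta : test_function eta -> H1 eta /\ aeq (D eta) (derive1 eta).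
Proof.
move=> te; have [h1 h2] := test_L2 te; apply: H1I => //.
by apply: C1_weak_deriv; case/testP: te.
Qed.

Lemma ip_subl f g h : L2 f -> L2 g -> L2 h -> ip (lin 1 f (-1) g) h = ip f h - ip g h.
Proof. by move=> hf hg hh; rewrite ip_linl// mul1r mulN1r. Qed.

Lemma ip_sub_sqr f g : ip (lin 1 f (-1) g) (lin 1 f (-1) g) = \int[mu]_x ((f x - g x) ^+ 2).
Proof. by rewrite ip_sqr; apply: eq_Rintegral => x _; rewrite /lin mul1r mulN1r. Qed.

Lemma dip_lin_sqr a f b g : H1 f -> H1 g ->
  dip (lin a f b g) (lin a f b g) = ip (lin a (D f) b (D g)) (lin a (D f) b (D g)).
Proof.
move=> hf hg; have [h1 h2] := H1_lin a b hf hg.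
by apply: ip_ae => //; do ?[exact: H1_DL2|apply: L2_lin].
Qed.

Lemma dip_sub_sqr f g : H1 f -> H1 g ->
  dip (lin 1 f (-1) g) (lin 1 f (-1) g) = \int[mu]_x ((D f x - D g x) ^+ 2).
Proof. by move=> hf hg; rewrite dip_lin_sqr// ip_sub_sqr. Qed.

Lemma le_geometric0 (a b : R) : (forall n, a <= b * 4^-1 ^+ n) -> a <= 0.
Proof.
move=> H; have cb : b * 4^-1 ^+ n @[n --> \oo] --> (b * 0 : R).
  apply: cvgM; first exact: cvg_cst.
  by apply: cvg_expr; rewrite ger0_norm ?invr_ge0//; lra.
rewrite mulr0 in cb; rewrite -(cvg_lim (@Rhausdorff R) cb).
by apply: limr_ge; [exact: cvgP cb|exact: nearW].
Qed.

(** Functions and weak derivatives converge separately in L^2. Each approximant satisfies the weak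
    derivative identity, so by Cauchy-Schwarz the squared defect of the limit pair is below a
    multiple of 4^-n for every n, hence zero. *)
Lemma H1_complete (f_ : nat -> R -> R) : (forall n, H1 (f_ n)) ->
  (forall n, h1 (lin 1 (f_ n.+1) (-1) (f_ n)) (lin 1 (f_ n.+1) (-1) (f_ n)) <= 8^-1 ^+ n) ->
  exists f C, H1 f /\ forall n, h1 (lin 1 f (-1) (f_ n)) (lin 1 f (-1) (f_ n)) <= C * 4^-1 ^+ n.
Proof.
move=> hf hd.
have d1 n : \int[mu]_x ((f_ n.+1 x - f_ n x) ^+ 2) <= 8^-1 ^+ n.
  by apply: le_trans (hd n); rewrite /h1 ip_sub_sqr lerDl ip_ge0.
have d2 n : \int[mu]_x ((D (f_ n.+1) x - D (f_ n) x) ^+ 2) <= 8^-1 ^+ n.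
  by apply: le_trans (hd n); rewrite /h1 (dip_sub_sqr (hf _) (hf _)) lerDr ip_ge0.
have [f [C [Lf hC]]] := L2_complete (fun n => H1_L2 (hf n)) d1.
have [g [C' [Lg hC']]] := L2_complete (fun n => H1_DL2 (hf n)) d2.
have w : weak_deriv f g.
  split; [exact: L2_loc|exact: L2_loc|move=> eta te].
  have [Le Le'] := test_L2 te.
  apply/eqP; rewrite -subr_eq0 opprK; change (\int[mu]_x (f x * derive1 eta x) + \int[mu]_x (g x * eta x) == 0).
  rewrite -!ipE -sqrf_eq0 eq_le sqr_ge0 andbT.
  apply: (@le_geometric0 _ (2 * C * ip (derive1 eta) (derive1 eta) + 2 * C' * ip eta eta)) => n.
  have e0 : ip (f_ n) (derive1 eta) + ip (D (f_ n)) eta = 0.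
    by have [_ _ [_ _ /(_ _ te)]] := hf n; rewrite !ipE => ->; rewrite addNr.
  have c1 := ip_CS (L2_lin 1 (-1) Lf (H1_L2 (hf n))) Le'.
  have c2 := ip_CS (L2_lin 1 (-1) Lg (H1_DL2 (hf n))) Le.
  rewrite ip_sub_sqr ip_subl // in c1; last exact: H1_L2.
  rewrite ip_sub_sqr ip_subl // in c2; last exact: H1_DL2.
  have := le_trans c1 (ler_wpM2r (ip_ge0 _) (hC n)).
  have := le_trans c2 (ler_wpM2r (ip_ge0 _) (hC' n)).
  move: e0; set a := ip f _; set b := ip g _; set c := ip (f_ n) _; set d := ip (D _) _.
  move=> e0 k2 k1; have -> : a + b = (a - c) + (b - d) by rewrite -[LHS]subr0 -e0; ring.
  by have := sqr_ge0 ((a - c) - (b - d)); lra.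
have [Hf fg] := H1I Lf Lg w.
exists f, (C + C'); split=> [//|n]; have a1 := hC n; have a2 := hC' n.
rewrite -ip_sub_sqr in a1.
have e : \int[mu]_x ((D f x - D (f_ n) x) ^+ 2) = \int[mu]_x ((g x - D (f_ n) x) ^+ 2).
  apply: Int_ae; first by apply: ae_mono fg => x ->.
  - apply: mbleX; apply: mbleB; [exact: (H1_DL2 Hf).1|exact: (H1_DL2 (hf n)).1].
  - by apply: mbleX; apply: mbleB; [exact: Lg.1|exact: (H1_DL2 (hf n)).1].
rewrite -e -(dip_sub_sqr Hf (hf n)) in a2.
by rewrite mulrDl; exact: lerD a1 a2.
Qed.

End SobolevCompleteness.

(** * Schrödinger-type quadratic forms on vector-valued H^1 *)

Section QuadraticForm.
Context {R : realType} {I : finType}.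
Implicit Types U V : I -> R -> R.
Local Notation mu := (@mu R).

Definition HV U := forall i, H1 (U i).
Definition vlin a U b V : I -> R -> R := fun i => lin a (U i) b (V i).
Definition vip U V := \sum_i ip (U i) (V i).
Definition vdip U V := \sum_i dip (U i) (V i).
Definition vh1 U V := \sum_i h1 (U i) (V i).

Lemma HV_lin a U b V : HV U -> HV V -> HV (vlin a U b V).
Proof. by move=> hU hV i; case: (H1_lin a b (hU i) (hV i)). Qed.

Lemma vh1E U V : vh1 U V = vip U V + vdip U V.
Proof. by rewrite -big_split. Qed.

Lemma vip_linl a U b V X : HV U -> HV V -> HV X ->
  vip (vlin a U b V) X = a * vip U X + b * vip V X.
Proof.
move=> hU hV hX; rewrite !mulr_sumr -big_split; apply: eq_bigr => i _.
by rewrite ip_linl//; exact: H1_L2.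
Qed.

Lemma vdip_linl a U b V X : HV U -> HV V -> HV X ->
  vdip (vlin a U b V) X = a * vdip U X + b * vdip V X.
Proof.
move=> hU hV hX; rewrite !mulr_sumr -big_split; apply: eq_bigr => i _.
exact: dip_linl.
Qed.

Lemma vh1_linl a U b V X : HV U -> HV V -> HV X ->
  vh1 (vlin a U b V) X = a * vh1 U X + b * vh1 V X.
Proof. by move=> hU hV hX; rewrite !vh1E vip_linl// vdip_linl//; ring. Qed.

Lemma vipC U V : vip U V = vip V U.
Proof. by apply: eq_bigr => i _; rewrite ipC. Qed.
Lemma vdipC U V : vdip U V = vdip V U.
Proof. by apply: eq_bigr => i _; rewrite /dip ipC. Qed.
Lemma vh1C U V : vh1 U V = vh1 V U.
Proof. by apply: eq_bigr => i _; rewrite h1C. Qed.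
Lemma vh1_sqr a U b V : HV U -> HV V ->
  vh1 (vlin a U b V) (vlin a U b V) =
  a ^+ 2 * vh1 U U + 2 * a * b * vh1 U V + b ^+ 2 * vh1 V V.
Proof.
move=> hU hV; have hL := HV_lin a b hU hV.
rewrite (vh1_linl a b hU hV hL) (vh1C U) (vh1C V (vlin a U b V)).
by rewrite (vh1_linl a b hU hV hU) (vh1_linl a b hU hV hV) (vh1C V U); ring.
Qed.
Lemma vip_ge0 U : 0 <= vip U U.
Proof. by apply: sumr_ge0 => i _; exact: ip_ge0. Qed.
Lemma vdip_ge0 U : 0 <= vdip U U.
Proof. by apply: sumr_ge0 => i _; exact: ip_ge0. Qed.
Lemma vh1_ge0 U : 0 <= vh1 U U.
Proof. by apply: sumr_ge0 => i _; exact: h1_ge0. Qed.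

Variables (W : I -> I -> R -> R) (rho : I -> R -> R) (kappa C0 : R).
Hypothesis mW : forall i j, mble (W i j).
Hypothesis bW : forall i j x, `|W i j x| <= C0.
Hypothesis symW : forall i j, W i j = W j i.
Hypothesis Lrho : forall i, L2 (rho i).
Hypothesis kappa0 : 0 <= kappa.

Definition pot U V := \sum_i \sum_j ip (fun x => W i j x * U i x) (V j).
Definition moment U := \sum_i ip (U i) (rho i).
(** The form of the operator - 1/2 d_xx + 1 - W, with a rank-one penalty in the direction [rho]. *)
Definition bil U V :=
  2^-1 * vdip U V + vip U V - pot U V + kappa * (moment U * moment V).

Lemma L2_W i j U : HV U -> L2 (fun x => W i j x * U i x).
Proof. by move=> hU; apply: (L2_bdd (C := C0)) => //; exact: H1_L2. Qed.

Lemma pot_linl a U b V X : HV U -> HV V -> HV X ->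
  pot (vlin a U b V) X = a * pot U X + b * pot V X.
Proof.
move=> hU hV hX; rewrite !mulr_sumr -big_split; apply: eq_bigr => i _.
rewrite !mulr_sumr -big_split; apply: eq_bigr => j _ /=.
rewrite -(ip_linl a b (L2_W i j hU) (L2_W i j hV) (H1_L2 (hX j))); congr ip.
by apply/funext => x; rewrite /vlin /lin; ring.
Qed.

Lemma potC U V : pot U V = pot V U.
Proof.
rewrite /pot exchange_big; apply: eq_bigr => i _; apply: eq_bigr => j _.
by rewrite !ipE symW; apply: eq_Rintegral => x _; ring.
Qed.

Lemma moment_lin a U b V : HV U -> HV V -> moment (vlin a U b V) = a * moment U + b * moment V.
Proof.
move=> hU hV; rewrite !mulr_sumr -big_split; apply: eq_bigr => i _.
by rewrite ip_linl//; exact: H1_L2.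
Qed.

Lemma bil_linl a U b V X : HV U -> HV V -> HV X ->
  bil (vlin a U b V) X = a * bil U X + b * bil V X.
Proof.
by move=> hU hV hX; rewrite /bil vdip_linl// vip_linl// pot_linl// moment_lin//; ring.
Qed.

Lemma bilC U V : bil U V = bil V U.
Proof. by rewrite /bil vdipC vipC potC [moment U * _]mulrC. Qed.

Lemma bil_sqr a U b V : HV U -> HV V ->
  bil (vlin a U b V) (vlin a U b V) =
  a ^+ 2 * bil U U + 2 * a * b * bil U V + b ^+ 2 * bil V V.
Proof.
move=> hU hV; have hL := HV_lin a b hU hV.
rewrite bil_linl// ![bil _ (vlin _ _ _ _)]bilC !bil_linl// (bilC V U); ring.
Qed.

Hypothesis bil_ge0 : forall U, HV U -> 0 <= bil U U.

(** If B(U, U) = 0 then B is affine along V + s U, and an affine function bounded below has slope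
    zero. *)
Lemma bil_null U V : HV U -> HV V -> bil U U = 0 -> bil U V = 0.
Proof.
move=> hU hV U0; apply/eqP; apply: contraT => n0.
(* With a nonzero slope, this multiple of U would give the form the value - B(V, V) - 2. *)
have := bil_ge0 (HV_lin (- (bil V V + 1) / bil U V) 1 hU hV).
rewrite bil_sqr// U0 mulr0 add0r mulr1 expr1n mul1r -mulrA divfK//.
by have := bil_ge0 hV; lra.
Qed.

Lemma bil_parallelogram U V : HV U -> HV V ->
  bil (vlin 1 U (-1) V) (vlin 1 U (-1) V) <= 2 * bil U U + 2 * bil V V.
Proof.
move=> hU hV; have := bil_ge0 (HV_lin 1 1 hU hV).
by rewrite !bil_sqr//; lra.
Qed.

Lemma coordinate_le U i : ip (U i) (U i) <= vip U U.
Proof.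
by rewrite /vip (bigD1 i)//= lerDl; apply: sumr_ge0 => j _; exact: ip_ge0.
Qed.

Lemma pot_le U : HV U -> `|pot U U| <= #|I|%:R ^+ 2 * C0 * vip U U.
Proof.
move=> hU.
have key i j : `|ip (fun x => W i j x * U i x) (U j)| <= C0 * vip U U.
  have C00 := le_trans (normr_ge0 _) (bW i i 0).
  have Li := H1_L2 (hU i); have Lj := H1_L2 (hU j).
  rewrite ipE; apply: le_trans (Int_normr (L2_mul (L2_W i j hU) Lj)) _.
  have ii := L2_mul Li Li; have ij := L2_mul Lj Lj.
  have : \int[mu]_x (C0 / 2 * (U i x * U i x) + C0 / 2 * (U j x * U j x)) <= C0 * vip U U.
    rewrite (IntD (itgZ _ ii) (itgZ _ ij)) (IntZ _ ii) (IntZ _ ij) -!ipE.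
    have := ler_wpM2l C00 (coordinate_le U i).
    by have := ler_wpM2l C00 (coordinate_le U j); lra.
  apply: le_trans; apply: Int_le; [exact: itg_abs (L2_mul (L2_W i j hU) Lj)|exact: itgD (itgZ _ ii) (itgZ _ ij)|].
  move=> x; rewrite !normrM -mulrA.
  apply: le_trans (ler_wpM2r (mulr_ge0 (normr_ge0 _) (normr_ge0 _)) (bW i j x)) _.
  have e k : U k x * U k x = `|U k x| * `|U k x| by rewrite -!expr2 real_normK// num_real.
  rewrite !e.
  by have := mulr_ge0 C00 (sqr_ge0 (`|U i x| - `|U j x|)); lra.
have -> : #|I|%:R ^+ 2 * C0 * vip U U = \sum_(i : I) \sum_(j : I) (C0 * vip U U).
  by rewrite !sumr_const -mulr_natl -[in RHS]mulr_natl; ring.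
apply: le_trans (ler_norm_sum _ _ _) _; apply: ler_sum => i _.
by apply: le_trans (ler_norm_sum _ _ _) _; apply: ler_sum => j _.
Qed.

Lemma moment_le U : HV U -> moment U ^+ 2 <= #|I|%:R ^+ 2 * (vip rho rho * vip U U).
Proof.
move=> hU; have s0 := mulr_ge0 (vip_ge0 rho) (vip_ge0 U).
have key i : `|ip (U i) (rho i)| <= Num.sqrt (vip rho rho * vip U U).
  rewrite -sqrtr_sqr ler_wsqrtr//; apply: le_trans (ip_CS (H1_L2 (hU i)) (Lrho i)) _.
  by rewrite mulrC ler_pM ?ip_ge0 ?coordinate_le.
have : `|moment U| <= #|I|%:R * Num.sqrt (vip rho rho * vip U U).
  apply: le_trans (ler_norm_sum _ _ _) _; apply: le_trans (ler_sum _ (fun i _ => key i)) _.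
  by rewrite sumr_const -[leLHS]mulr_natl.
move=> h; have := ler_pM (normr_ge0 _) (normr_ge0 _) h h.
by rewrite -!expr2 real_normK ?num_real// exprMn sqr_sqrtr.
Qed.

Lemma bil_le : exists2 C, 0 <= C & forall U, HV U -> bil U U <= C * vh1 U U.
Proof.
pose n : R := #|I|%:R; pose C := 1 + n ^+ 2 * `|C0| + kappa * (n ^+ 2 * vip rho rho).
have n0 : 0 <= n ^+ 2 by exact: sqr_ge0.
have r0 : 0 <= n ^+ 2 * vip rho rho by rewrite mulr_ge0 ?vip_ge0.
have t1 : 0 <= n ^+ 2 * `|C0| := mulr_ge0 n0 (normr_ge0 _).
have t2 : 0 <= kappa * (n ^+ 2 * vip rho rho) := mulr_ge0 kappa0 r0.
exists C; first exact: addr_ge0 (addr_ge0 ler01 t1) t2.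
move=> U hU; have h1 := pot_le hU; have h2 := moment_le hU.
have h3 : - pot U U <= n ^+ 2 * `|C0| * vip U U.
  apply: le_trans (ler_norm _) _; rewrite normrN; apply: le_trans h1 _.
  by rewrite ler_wpM2r ?vip_ge0// ler_wpM2l// ler_norm.
have := ler_wpM2l kappa0 h2; rewrite expr2 -/n => h4.
have v0 := vip_ge0 U; have d0 := vdip_ge0 U.
rewrite /bil vh1E /C.
have k1 : 0 <= (n ^+ 2 * `|C0| + kappa * (n ^+ 2 * vip rho rho)) * vdip U U.
  exact: mulr_ge0 (addr_ge0 t1 t2) d0.
by lra.
Qed.

End QuadraticForm.

(** * Compactness of bounded sequences on which the form tends to zero *)

(** The image ultrafilter clusters in the segment [- B, B], and for an ultrafilter clustering is
    convergence. A single ultrafilter serves all evaluation points at once, without diagonal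
    extraction. *)
Lemma ultra_limit {R : realType} (G : set_system nat) (a : nat -> R) (B : R) :
  UltraFilter G -> (forall n, `|a n| <= B) ->
  exists l : R, forall e : R, 0 < e -> G [set n | `|a n - l| < e].
Proof.
move=> UG aB; have PG : ProperFilter G := @ultra_proper _ _ UG.
have cK : compact (`[- B, B]%classic : set R) by exact: segment_compact.
have [|l [_ cl]] := cK (a @ G) (fmap_proper_filter a PG).
  change (G [set n | (`[- B, B]%classic : set R) (a n)]); apply: filterE => n.
  by rewrite /= in_itv/= -ler_norml; exact: aB.
exists l => e e0; have [//|h] := in_ultra_setVsetC [set n | `|a n - l| < e] UG.
exfalso.
have bl : nbhs l (ball l e) by exact: nbhsx_ballx.
have gn : (a @ G) (a @` ~` [set n | `|a n - l| < e]).
  change (G [set n | (a @` ~` [set n | `|a n - l| < e]) (a n)]).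
  by apply: filterS h => n hn; exists n.
have [_ [[n hn <-]]] := cl _ _ gn bl.
by rewrite /ball/= distrC => hn'; apply: hn.
Qed.

Section Compactness.
Context {R : realType} {I : finType}.
Implicit Types U V Z : I -> R -> R.
Local Notation mu := (@mu R).
Variables (W : I -> I -> R -> R) (rho : I -> R -> R) (kappa C0 : R).
Hypothesis mW : forall i j, mble (W i j).
Hypothesis bW : forall i j x, `|W i j x| <= C0.
Hypothesis symW : forall i j, W i j = W j i.
Hypothesis Lrho : forall i, L2 (rho i).
Hypothesis kappa0 : 0 <= kappa.
Hypothesis decayW : forall e : R, 0 < e -> exists2 A : R, 0 < A &
  forall i j x, A < `|x| -> `|W i j x| <= e.
Local Notation pot := (pot W).
Local Notation bil := (bil W rho kappa).

Lemma pot_ae U Z : HV U -> HV Z -> (forall i, aeq (U i) (Z i)) -> pot U U = pot Z Z.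
Proof.
move=> hU hZ UZ; apply: eq_bigr => i _; apply: eq_bigr => j _.
have l1 := L2_W mW bW i j hU; have l2 := L2_W mW bW i j hZ.
apply: ip_ae l1 l2 (H1_L2 (hU j)) (H1_L2 (hZ j)) => //.
by apply: ae_mono (UZ i) => x ->.
Qed.

(** Outside a large interval the potential is small and the mass bounded; inside, the Hölder bound
    spreads smallness from a finite grid to the whole interval. Thus only finitely many point values
    have to be controlled. *)
Lemma pot_small (e : R) : 0 < e -> exists (s : seq R) (d : R), 0 < d /\
  forall Z, HV Z -> vip Z Z <= 4 ->
    (forall i x y, (Z i y - Z i x) ^+ 2 <= `|y - x| * 4) ->
    (forall i x, x \in s -> Z i x ^+ 2 <= d) -> pot Z Z <= e.
Proof.
move=> e0; pose n2 : R := #|I|%:R ^+ 2; have n20 : 0 <= n2 by exact: sqr_ge0.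
pose C1 := `|C0| + 1; have C10 : 0 < C1 by rewrite ltr_wpDl.
have e1p : 0 < e / (8 * (n2 + 1)) by rewrite divr_gt0// mulr_gt0// ltr_wpDl.
have [A A0 hA] := decayW e1p.
(* Chosen so that the inner contribution 10 h C1 (2 A + 1) is e / (2 (n2 + 1)), which is also the
   value of the outer contribution 4 e1. *)
pose h := e / (20 * C1 * (2 * A + 1) * (n2 + 1)).
have A1 : 0 < 2 * A + 1 by rewrite addr_gt0// mulr_gt0.
have n21 : 0 < n2 + 1 by rewrite ltr_wpDl.
have h0 : 0 < h by rewrite divr_gt0// !mulr_gt0.
pose N := (Num.truncn (2 * A / h)).+1.
exists [seq - A + k%:R * h | k <- iota 0 N], h; split=> // Z hZ Z4 hol grid.
(* The nearest grid point y on the left is within h, so Z(x)^2 <= 2 Z(y)^2 + 2 (Z(x) - Z(y))^2 <= 2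
   h + 8 h. *)
have inn i x : `|x| <= A -> Z i x ^+ 2 <= 10 * h.
  rewrite ler_norml => /andP[x1 x2]; pose k := Num.truncn ((x + A) / h).
  have xA : 0 <= (x + A) / h by rewrite divr_ge0 ?(ltW h0)//; lra.
  have /andP[k1 k2] := truncn_itv xA.
  rewrite -/k ler_pdivlMr// in k1; rewrite -/k ltr_pdivrMr// in k2.
  have kN : (k < N)%N.
    rewrite ltnS; apply: le_truncn; rewrite ler_pM2r ?invr_gt0//; lra.
  have g : Z i (- A + k%:R * h) ^+ 2 <= h.
    by apply: grid; apply/mapP; exists k; rewrite // mem_iota add0n.
  have := hol i (- A + k%:R * h) x.
  rewrite -natr1 mulrDl mul1r in k2.
  have : `|x - (- A + k%:R * h)| <= h by rewrite ler_norml; apply/andP; split; lra.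
  set y := - A + k%:R * h => a1 a2.
  have := sqr_ge0 (Z i x - 2 * Z i y); lra.
(* The half-open interval is extended to A + 1 so that it contains the endpoint A; its length is 2 A
   + 1. *)
pose chi : R -> R := \1_(`[- A, (A + 1)[%classic).
have lchi : L2 chi by exact: L2_indic_co.
have ichi : \int[mu]_x (chi x ^+ 2) = 2 * A + 1.
  by rewrite (Int_indic_co (x := - A) (y := A + 1)); lra.
have chi0 x : 0 <= chi x ^+ 2 by exact: sqr_ge0.
have chi1 x : `|x| <= A -> chi x = 1.
  rewrite ler_norml => /andP[x1 x2]; rewrite /chi indicE mem_set//= in_itv/=.
  by apply/andP; split=> //; lra.
pose e1 := e / (8 * (n2 + 1)).
have key i j : ip (fun x => W i j x * Z i x) (Z j) <= 4 * e1 + C1 * (10 * h) * (2 * A + 1).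
  have Li := H1_L2 (hZ i); have Lj := H1_L2 (hZ j).
  have i1 := L2_mul (L2_W mW bW i j hZ) Lj.
  pose g x := (e1 / 2 * Z i x ^+ 2 + e1 / 2 * Z j x ^+ 2) + C1 * (10 * h) * chi x ^+ 2.
  have ig1 := itgD (itgZ (e1 / 2) Li.2) (itgZ (e1 / 2) Lj.2).
  have ig2 := itgZ (C1 * (10 * h)) lchi.2.
  have : \int[mu]_x g x <= 4 * e1 + C1 * (10 * h) * (2 * A + 1).
    rewrite /g (IntD ig1 ig2) (IntD (itgZ _ Li.2) (itgZ _ Lj.2)) (IntZ _ Li.2) (IntZ _ Lj.2).
    rewrite (IntZ _ lchi.2) ichi -!ip_sqr lerD2r.
    have z1 := le_trans (coordinate_le Z i) Z4; have z2 := le_trans (coordinate_le Z j) Z4.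
    have e10 : 0 <= e1 := ltW e1p.
    have := ler_wpM2l e10 z1; have := ler_wpM2l e10 z2; lra.
  apply: le_trans; rewrite ipE; apply: Int_le i1 (itgD ig1 ig2) _ => x.
  have sq : `|Z i x| * `|Z j x| <= (Z i x ^+ 2 + Z j x ^+ 2) / 2.
    rewrite -(real_normK (num_real (Z i x))) -(real_normK (num_real (Z j x))).
    by have := sqr_ge0 (`|Z i x| - `|Z j x|); lra.
  apply: le_trans (ler_norm _) _; rewrite !normrM -mulrA /g.
  have zz0 : 0 <= `|Z i x| * `|Z j x| by exact: mulr_ge0.
  have zs0 : 0 <= Z i x ^+ 2 + Z j x ^+ 2 by rewrite addr_ge0 ?sqr_ge0.
  have [xA|Ax] := lerP `|x| A.
    have b1 := inn i x xA; have b2 := inn j x xA.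
    have wC : `|W i j x| <= C1 by apply: le_trans (bW i j x) _; have := ler_norm C0; rewrite /C1; lra.
    rewrite chi1// expr1n mulr1.
    have := ler_pM (normr_ge0 _) zz0 wC sq.
    have := ler_wpM2l (ltW C10) (lerD b1 b2).
    by have := mulr_ge0 (ltW e1p) zs0; rewrite -/e1; lra.
  have := ler_pM (normr_ge0 _) zz0 (hA i j x Ax) sq; rewrite -/e1.
  have := mulr_ge0 (mulr_ge0 (ltW C10) (ltW h0)) (chi0 x); lra.
have : pot Z Z <= \sum_(i : I) \sum_(j : I) (4 * e1 + C1 * (10 * h) * (2 * A + 1)).
  by apply: ler_sum => i _; apply: ler_sum => j _.
move=> /le_trans; apply.
rewrite sumr_const -[leLHS]mulr_natl sumr_const -[X in _ * X]mulr_natl mulrA -expr2 -/n2.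
have -> : 4 * e1 + C1 * (10 * h) * (2 * A + 1) = e / (n2 + 1).
  by rewrite /e1 /h; field; rewrite !gt_eqF.
rewrite mulrA ler_pdivrMr//; nra.
Qed.

Hypothesis bil_ge0 : forall U, HV U -> 0 <= bil U U.

(** Along an ultrafilter the continuous representatives converge at every point, so differences of
    late terms are small on any finite grid and have small potential energy. Smallness of the form
    then controls their H^1 norm: the sequence is Cauchy along the ultrafilter. *)
Theorem bil_compact (w : nat -> I -> R -> R) : (forall n, HV (w n)) ->
  (forall n, vh1 (w n) (w n) <= 1) ->
  bil (w n) (w n) @[n --> \oo] --> (0 : R) ->
  exists2 U, HV U & forall (e : R) (N : nat), 0 < e ->
    exists2 n, (N <= n)%N & vh1 (vlin 1 U (-1) (w n)) (vlin 1 U (-1) (w n)) <= e.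
Proof.
move=> hw w1 wb.
have repP n i : exists F : R -> R, [/\ continuous F, aeq (w n i) F,
    forall x y, (F y - F x) ^+ 2 <= `|y - x| * 1 & forall x, F x ^+ 2 <= 2 * 1].
  have [F [h1_ h2 h3 h4]] := H1_rep (hw n i); exists F.
  have b : h1 (w n i) (w n i) <= 1.
    apply: le_trans (w1 n); rewrite /vh1 (bigD1 i)//= lerDl.
    by apply: sumr_ge0 => j _; exact: h1_ge0.
  split=> // [x y|x]; first by apply: le_trans (h3 x y) _; rewrite ler_wpM2l.
  by apply: le_trans (h4 x) _; rewrite ler_wpM2l.
pose F n i := sval (cid (repP n i)).
have FP n i : [/\ continuous (F n i), aeq (w n i) (F n i),
    forall x y, (F n i y - F n i x) ^+ 2 <= `|y - x| * 1 & forall x, F n i x ^+ 2 <= 2 * 1].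
  exact: svalP (cid (repP n i)).
have [G [UG sG]] := @ultraFilterLemma nat \oo _.
have PG : ProperFilter G := @ultra_proper _ _ UG.
have limP i x : exists l : R, forall e : R, 0 < e -> G [set n | `|F n i x - l| < e].
  apply: (@ultra_limit _ _ _ 2) => n; have [_ _ _ b] := FP n i.
  rewrite -(@ler_pXn2r _ 2)// ?nnegrE// real_normK ?num_real//.
  by have := b x; lra.
have key (e : R) : 0 < e -> exists2 S, G S & forall a b, S a -> S b ->
    vh1 (vlin 1 (w a) (-1) (w b)) (vlin 1 (w a) (-1) (w b)) <= e.
  move=> e0; have e4 : 0 < e / 4 by lra.
  have [s [d [d0 hs]]] := pot_small e4.
  have d2 : 0 < Num.sqrt d / 2 by rewrite divr_gt0// sqrtr_gt0.
  have hG : G [set n | forall x, x \in s -> forall i, `|F n i x - sval (cid (limP i x))| < Num.sqrt d / 2].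
    elim: s {hs} => [|x s ih]; first by apply: filterE => n y.
    have hx : G [set n | forall i, `|F n i x - sval (cid (limP i x))| < Num.sqrt d / 2].
      by apply: filter_forall => i; exact: (svalP (cid (limP i x))).
    apply: filterS2 hx ih => n h1_ h2 y; rewrite inE => /predU1P[->//|]; exact: h2.
  have hb : G [set n | bil (w n) (w n) < e / 16].
    by apply: sG; apply: (cvgr_lt _ wb); lra.
  exists ([set n | forall x, x \in s -> forall i, `|F n i x - sval (cid (limP i x))| < Num.sqrt d / 2]
    `&` [set n | bil (w n) (w n) < e / 16]); first exact: filterI.
  move=> a b [/= a1 a2] [/= b1 b2].
  pose z := vlin 1 (w a) (-1) (w b); pose Z := vlin 1 (F a) (-1) (F b).
  have hz : HV z by exact: HV_lin.
  have zZ i : aeq (z i) (Z i).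
    have [_ q1 _ _] := FP a i; have [_ q2 _ _] := FP b i.
    by apply: ae_mono (ae_and q1 q2) => x [h1_ h2]; rewrite /z /Z /vlin /lin h1_ h2.
  have hZ : HV Z.
    move=> i; case: (H1_ae (zZ i) _ (hz i)) => //.
    have [q1 _ _ _] := FP a i; have [q2 _ _ _] := FP b i.
    by apply: mbleD; apply: mbleM (mbleC _) _; exact: mble_cont.
  have z4 : vh1 z z <= 4.
    have := vh1_ge0 (vlin 1 (w a) 1 (w b)); rewrite /z.
    rewrite (vh1_sqr 1 1 (hw a) (hw b)) (vh1_sqr 1 (-1) (hw a) (hw b)).
    by have := w1 a; have := w1 b; lra.
  have potz : pot z z <= e / 4.
    rewrite (pot_ae hz hZ zZ); apply: hs => //.
    - have -> : vip Z Z = vip z z.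
        apply: eq_bigr => i _; apply: ip_ae; try exact: aeq_sym; try exact: H1_L2.
      by apply: le_trans z4; rewrite vh1E lerDl vdip_ge0.
    - move=> i x y; have [_ _ q1 _] := FP a i; have [_ _ q2 _] := FP b i.
      have := q1 x y; have := q2 x y; rewrite /Z /vlin /lin.
      have := sqr_ge0 ((F a i y - F a i x) + (F b i y - F b i x)); lra.
    - move=> i x xs; have := a1 x xs i; have := b1 x xs i.
      set l := sval _; rewrite /Z /vlin /lin mul1r mulN1r => q1 q2.
      have q : `|F a i x - F b i x| <= Num.sqrt d.
        have -> : F a i x - F b i x = (F a i x - l) - (F b i x - l) by ring.
        by apply: le_trans (ler_normB _ _) _; lra.
      have := ler_pM (normr_ge0 _) (normr_ge0 _) q q.
      by rewrite -!expr2 real_normK ?num_real// sqr_sqrtr// ltW.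
  (* The form of the difference is at most 4 e / 16 and the potential part at most e / 4, while the
     H^1 square is at most twice their sum, the rank-one term being nonnegative. *)
  have := bil_parallelogram mW bW symW Lrho bil_ge0 (hw a) (hw b); rewrite -/z.
  have := vh1E z z; have -> : bil z z = 2^-1 * vdip z z + vip z z - pot z z + kappa * (moment rho z * moment rho z) by [].
  have := mulr_ge0 kappa0 (sqr_ge0 (moment rho z)); rewrite expr2 => m0 -> pg.
  by have := vip_ge0 z; lra.
have q0 k : 0 < (8^-1 : R) ^+ k by rewrite exprn_gt0 ?invr_gt0.
pose S k := s2val (cid2 (key _ (q0 k))).
have SG k : G (S k) := s2valP (cid2 (key _ (q0 k))).
have SP k : forall a b, S k a -> S k b ->
    vh1 (vlin 1 (w a) (-1) (w b)) (vlin 1 (w a) (-1) (w b)) <= 8^-1 ^+ k := s2valP' (cid2 (key _ (q0 k))).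
(* Intersecting the first k + 1 sets puts consecutive chosen indices into a common [S k], and k <= n
   keeps the indices unbounded. *)
have TG k : G [set n | (k <= n)%N /\ forall j, (j <= k)%N -> S j n].
  apply: filterI; first by apply: sG; exact: nbhs_infty_ge.
  elim: k => [|k ih].
    by apply: filterS (SG 0%N) => n hn j; rewrite leqn0 => /eqP->.
  apply: filterS2 ih (SG k.+1) => n h1_ h2 j.
  by rewrite leq_eqVlt => /predU1P[->//|]; rewrite ltnS; exact: h1_.
pose m k := sval (cid (@filter_ex _ G PG _ (TG k))).
have mP k : (k <= m k)%N /\ forall j, (j <= k)%N -> S j (m k) := svalP (cid (@filter_ex _ G PG _ (TG k))).
have fast k : vh1 (vlin 1 (w (m k.+1)) (-1) (w (m k))) (vlin 1 (w (m k.+1)) (-1) (w (m k))) <= 8^-1 ^+ k.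
  by apply: SP; [exact: (mP k.+1).2|exact: (mP k).2].
have lim i : exists f C, H1 f /\ forall n,
    h1 (lin 1 f (-1) (w (m n) i)) (lin 1 f (-1) (w (m n) i)) <= C * 4^-1 ^+ n.
  apply: H1_complete => [n|n]; first exact: hw.
  apply: le_trans (fast n); rewrite /vh1 (bigD1 i)//= lerDl.
  by apply: sumr_ge0 => j _; exact: h1_ge0.
pose U i := sval (cid (lim i)).
have UP i : exists C, H1 (U i) /\ forall n,
    h1 (lin 1 (U i) (-1) (w (m n) i)) (lin 1 (U i) (-1) (w (m n) i)) <= C * 4^-1 ^+ n.
  exact: svalP (cid (lim i)).
pose C i := sval (cid (UP i)).
have CP i : H1 (U i) /\ forall n,
    h1 (lin 1 (U i) (-1) (w (m n) i)) (lin 1 (U i) (-1) (w (m n) i)) <= C i * 4^-1 ^+ n.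
  exact: svalP (cid (UP i)).
exists U => [i|e N e0]; first by case: (CP i).
have c0 : (\sum_i C i) * 4^-1 ^+ n @[n --> \oo] --> (0 : R).
  have := @cvg_geometric R (\sum_i C i) 4^-1; apply.
  by rewrite ger0_norm ?invr_ge0//; lra.
have hA : \forall n \near \oo, (\sum_i C i) * 4^-1 ^+ n < e by apply: (cvgr_lt _ c0).
have [k [hk Nk]] : exists k, (\sum_i C i) * 4^-1 ^+ k < e /\ (N <= k)%N.
  exact: (@filter_ex _ \oo _ _ (filterI hA (nbhs_infty_ge N))).
exists (m k); first exact: leq_trans Nk (mP k).1.
apply: le_trans (ltW hk); rewrite /vh1 mulr_suml; apply: ler_sum => i _.
by have [_ h] := CP i; exact: h.
Qed.

End Compactness.

(** * Second-order Taylor expansion of real powers, uniform up to 0 *)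

Section PowerTaylor.
Context {R : realType}.
Implicit Types (q s x y r : R).

Lemma powR_small s (e : R) : 0 < s -> 0 < e ->
  exists2 d : R, 0 < d & forall x, 0 <= x -> x <= d -> x `^ s <= e.
Proof.
move=> s0 e0; exists (e `^ s^-1); first exact: powR_gt0.
move=> x x0 xd; have := ge0_ler_powR (ltW s0) x0 (powR_ge0 _ _) xd.
by rewrite -powRrM mulVf ?gt_eqF// powRr1// ltW.
Qed.

(** The absolute value gives a function continuous on the whole line, whatever [powR] returns at
    negative arguments. *)
Lemma powR_norm_continuous s : 0 < s -> continuous (fun x : R => `|x| `^ s).
Proof.
move=> s0; suff H (a : R) : {for a, continuous (fun x : R => `|x| `^ s)} by move=> a; exact: H.
have [->|a0] := eqVneq a 0; last first.
  have na : 0 < `|a| by rewrite normr_gt0.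
  have ca : {for `|a|, continuous (fun y : R => y `^ s)}.
    apply/differentiable_continuous/derivable1_diffP.
    by apply: derivable_powR; rewrite in_itv/= na.
  exact: (@continuous_comp _ _ _ (fun x : R => `|x|) (fun y : R => y `^ s) a (@norm_continuous R R a) ca).
apply/cvgrPdist_le => e e0; have [d d0 hd] := powR_small s0 e0.
apply/nbhs_ballP; exists d => //= x; rewrite /ball/= sub0r normrN => /ltW xd.
rewrite normr0 powR0 ?gt_eqF// sub0r normrN ger0_norm ?powR_ge0//.
exact: hd.
Qed.

(** The endpoints come in either order, and differentiability is asked only at positive points, so
    that 0 is allowed as an endpoint. *)
Lemma MVT_between (f f' : R -> R) r x : 0 <= r -> 0 <= x ->
  (forall y, 0 < y -> is_derive y 1 f (f' y)) -> continuous f ->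
  exists c : R, [/\ 0 <= c, `|c - r| <= `|x - r|, c <= Num.max r x & f x - f r = f' c * (x - r)].
Proof.
move=> r0 x0 df cf; have cf' (a b : R) : {within `[a, b], continuous f} by exact: continuous_subspaceT.
have [rx|xr|->] := ltgtP r x; last by exists x; rewrite !subrr mulr0.
- have [|c] := @MVT _ f f' r x rx _ (cf' r x).
    by move=> y; rewrite in_itv/= => /andP[h _]; apply: df; exact: le_lt_trans h.
  rewrite in_itv/= => /andP[h1 h2] e; exists c; split=> //.
  + exact: le_trans r0 (ltW h1).
  + by rewrite !gtr0_norm ?subr_gt0//; lra.
  + by rewrite ltW.
- have [|c] := @MVT _ f f' x r xr _ (cf' x r).
    by move=> y; rewrite in_itv/= => /andP[h _]; apply: df; exact: le_lt_trans h.
  rewrite in_itv/= => /andP[h1 h2] e; exists c; split=> //.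
  + exact: le_trans x0 (ltW h1).
  + by rewrite !ltr0_norm ?subr_lt0//; lra.
  + by rewrite ltW.
  + by rewrite -opprB e -mulrN opprB.
Qed.

Lemma is_derive_norm_powR s y : 0 < y -> is_derive y 1 (fun x : R => `|x| `^ s) (s * y `^ (s - 1)).
Proof.
move=> y0; have h := is_derive1_powR s y0.
apply: (@near_eq_is_derive R R R _ _ _ _ _ _ h).
have : \forall z \near y, 0 < z by exact: lt_nbhsr.
by apply: filterS => z z0; rewrite gtr0_norm.
Qed.

Lemma powR_MVT s r x : 0 < s -> 0 <= r -> 0 <= x -> exists c : R,
  [/\ 0 <= c, `|c - r| <= `|x - r|, c <= Num.max r x & x `^ s - r `^ s = s * c `^ (s - 1) * (x - r)].
Proof.
move=> s0 r0 x0.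
have [c [c0 h1 h2]] := @MVT_between (fun x => `|x| `^ s) (fun y => s * y `^ (s - 1)) r x r0 x0 (fun y yp => @is_derive_norm_powR s y yp) (powR_norm_continuous s0).
by rewrite (ger0_norm r0) (ger0_norm x0) => h3; exists c.
Qed.

(** On [0, 1] one has t <= t^s. Applied to y / x and (x - y) / x, which add up to 1, this is
    subadditivity of the power. *)
Lemma powR_holder s x y : 0 < s <= 1 -> 0 <= y -> y <= x -> x `^ s - y `^ s <= (x - y) `^ s.
Proof.
move=> /andP[s0 s1] y0 yx; have [x0|x0] := eqVneq x 0.
  by rewrite x0 (_ : y = 0) ?subrr ?powR_ge0//; apply: le_anti; rewrite -{1}x0 yx y0.
have xp : 0 < x by rewrite lt_neqAle eq_sym x0 (le_trans y0).
have ge t : 0 <= t <= 1 -> t <= t `^ s.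
  move=> /andP[t0 t1]; have [->|tn] := eqVneq t 0; first exact: powR_ge0.
  by apply: ger1_powR => //; rewrite lt_neqAle eq_sym tn t0.
have := ge (y / x); have := ge ((x - y) / x).
rewrite !powRM ?invr_ge0 ?subr_ge0// ?(ltW xp)//.
have xs : 0 < x `^ s by exact: powR_gt0.
have xi : x^-1 `^ s = (x `^ s)^-1.
  by apply: (mulfI (lt0r_neq0 xs)); rewrite -powRM ?invr_ge0 ?(ltW xp)// !divff ?powR1 ?gt_eqF.
rewrite xi.
have e : y / x + (x - y) / x = 1 by field.
set a := y / x in e *; set b := (x - y) / x in e *.
have a0 : 0 <= a by rewrite divr_ge0// ltW.
have b0 : 0 <= b by rewrite divr_ge0// ?(ltW xp)// subr_ge0.
move=> h2 h1.
have {}h1 : a * x `^ s <= y `^ s by rewrite -ler_pdivlMr//; apply: h1; apply/andP; split=> //; lra.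
have {}h2 : b * x `^ s <= (x - y) `^ s by rewrite -ler_pdivlMr//; apply: h2; apply/andP; split=> //; lra.
have : (a + b) * x `^ s <= y `^ s + (x - y) `^ s by rewrite mulrDl lerD.
by rewrite e mul1r; lra.
Qed.

(** Three regimes: constant for s = 0, Hölder for s <= 1, Lipschitz by the mean value theorem for s
    > 1. The case s = 0 occurs as the exponent q - 2 for q = 2. *)
Lemma powR_unif s (B e : R) : 0 <= s -> 0 <= B -> 0 < e -> exists2 d : R, 0 < d &
  forall x y, 0 <= x <= B -> 0 <= y <= B -> `|x - y| <= d -> `|x `^ s - y `^ s| <= e.
Proof.
move=> s0 B0 e0; have [->|sn] := eqVneq s 0.
  by exists 1 => // x y _ _ _; rewrite !powRr0 subrr normr0 ltW.
have sp : 0 < s by rewrite lt_neqAle eq_sym sn.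
have [s1|s1] := lerP s 1.
  have [d d0 hd] := powR_small sp e0; exists d => // x y.
  wlog yx : x y / y <= x.
    move=> wl hx hy h; have /orP[yx|xy] := le_total y x; first exact: wl.
    by rewrite distrC; apply: wl => //; rewrite distrC.
  move=> /andP[x0 xB] /andP[y0 yB]; rewrite !ger0_norm ?subr_ge0//; last first.
    by apply: ge0_ler_powR => //; rewrite ?nnegrE.
  move=> h; apply: le_trans (powR_holder _ y0 yx) _; first by rewrite sp.
  by apply: hd => //; rewrite subr_ge0.
have K0 : 0 <= s * B `^ (s - 1) by rewrite mulr_ge0 ?powR_ge0.
exists (e / (s * B `^ (s - 1) + 1)); first by rewrite divr_gt0// ltr_wpDl.
move=> x y /andP[x0 xB] /andP[y0 yB]; rewrite ler_pdivlMr ?ltr_wpDl// => h.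
have [c [c0 _ cm ->]] := powR_MVT sp y0 x0.
rewrite !normrM (ger0_norm s0) (ger0_norm (powR_ge0 _ _)).
have cB : c `^ (s - 1) <= B `^ (s - 1).
  apply: ge0_ler_powR => //; rewrite ?nnegrE//; first by rewrite subr_ge0 ltW.
  by apply: le_trans cm _; rewrite ge_max yB xB.
have := ler_wpM2r (normr_ge0 (x - y)) (ler_wpM2l s0 cB).
by have := normr_ge0 (x - y); lra.
Qed.

(** Two mean value steps write the remainder as q (q - 1) (b^(q-2) - r^(q-2)) (c - r) (x - r) with b
    and c between r and x; uniform continuity of the power q - 2 makes it small. A third derivative
    would blow up at 0. *)
Lemma powR_taylor q (B e : R) : 2 <= q -> 0 <= B -> 0 < e -> exists2 d : R, 0 < d &
  forall r x, 0 <= r <= B -> 0 <= x <= B -> `|x - r| <= d ->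
    `|x `^ q - r `^ q - q * r `^ (q - 1) * (x - r)
      - 2^-1 * (q * (q - 1)) * r `^ (q - 2) * (x - r) ^+ 2| <= e * (x - r) ^+ 2.
Proof.
move=> q2 B0 e0; have q0 : 0 < q by lra.
have Q0 : 0 < q * (q - 1) by rewrite mulr_gt0//; lra.
have [||d d0 hd] := @powR_unif (q - 2) B (e / (q * (q - 1))) _ B0; [lra|exact: divr_gt0|].
exists d => // r x /andP[r0 rB] /andP[x0 xB] h.
(* Up to a constant, the power minus its second-order Taylor polynomial at r. *)
pose f y := `|y| `^ q + (- (q * r `^ (q - 1)) * y + - (2^-1 * (q * (q - 1)) * r `^ (q - 2)) * (y - r) ^+ 2).
pose f' y := q * y `^ (q - 1) + (- (q * r `^ (q - 1)) + - (q * (q - 1) * r `^ (q - 2)) * (y - r)).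
have pol y : is_derive y 1 (fun y => - (q * r `^ (q - 1)) * y + - (2^-1 * (q * (q - 1)) * r `^ (q - 2)) * (y - r) ^+ 2)
    (- (q * r `^ (q - 1)) + - (q * (q - 1) * r `^ (q - 2)) * (y - r)).
  apply: (@is_derive_quad _ _ _ _ `|2^-1 * (q * (q - 1)) * r `^ (q - 2)|) => k _.
  rewrite -(ger0_norm (sqr_ge0 k)) -normrM -normrN le_eqVlt; apply/orP; left; apply/eqP.
  by congr (`|_|); field.
have df y : 0 < y -> is_derive y 1 f (f' y).
  by move=> y0; have h1 := is_derive_norm_powR q y0; have h2 := pol y; exact: is_deriveD.
have cf : continuous f.
  move=> y; apply: cvgD; first exact: powR_norm_continuous.
  by have [/derivable1_diffP/differentiable_continuous h1 _] := pol y; exact: h1.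
have [c [c0 c1 c2 c3]] := MVT_between r0 x0 df cf.
have -> : x `^ q - r `^ q - q * r `^ (q - 1) * (x - r)
      - 2^-1 * (q * (q - 1)) * r `^ (q - 2) * (x - r) ^+ 2 = f x - f r.
  by rewrite /f (ger0_norm r0) (ger0_norm x0); ring.
rewrite c3 normrM /f'.
have q1 : 0 < q - 1 by lra.
have [b [b0 b1 b2 b3]] := powR_MVT q1 r0 c0.
have -> : q * c `^ (q - 1) + (- (q * r `^ (q - 1)) + - (q * (q - 1) * r `^ (q - 2)) * (c - r)) =
  q * (q - 1) * (b `^ (q - 2) - r `^ (q - 2)) * (c - r).
  have -> : c `^ (q - 1) = r `^ (q - 1) + (q - 1) * b `^ (q - 1 - 1) * (c - r) by rewrite -b3; ring.
  by rewrite (_ : q - 1 - 1 = q - 2); ring.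
have cB : c <= B by apply: le_trans c2 _; rewrite ge_max rB xB.
have bB : b <= B by apply: le_trans b2 _; rewrite ge_max rB cB.
have := hd b r; rewrite b0 bB r0 rB => /(_ isT isT (le_trans b1 (le_trans c1 h))).
rewrite ler_pdivlMr// => k.
rewrite !normrM (gtr0_norm q0) (gtr0_norm q1) -(real_normK (num_real (x - r))).
have := ler_pM (mulr_ge0 (normr_ge0 _) (ltW Q0)) (normr_ge0 (c - r)) k c1.
move=> /(ler_wpM2r (normr_ge0 (x - r))); lra.
Qed.

End PowerTaylor.

(** * Expansion of powers of the modulus and of products *)

Section DensityTaylor.
Context {R : realType}.

Definition cabs (u v : R) := Num.sqrt (u ^+ 2 + v ^+ 2).

Lemma cabs_ge0 u v : 0 <= cabs u v. Proof. exact: sqrtr_ge0. Qed.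

Lemma cabs_sqr u v : cabs u v ^+ 2 = u ^+ 2 + v ^+ 2.
Proof. by rewrite sqr_sqrtr// addr_ge0 ?sqr_ge0. Qed.

Lemma le_of_sqr (a b : R) : 0 <= b -> a ^+ 2 <= b ^+ 2 -> `|a| <= b.
Proof. by move=> b0; rewrite -(real_normK (num_real a)) ler_pXn2r ?nnegrE. Qed.

(* With d = |z| - r one has r d = r u + (u^2 + v^2 - d^2) / 2, which turns the
   one-dimensional Taylor expansion in d into the expansion in (u, v). *)
Lemma cabs_taylor (q A e : R) : 2 <= q -> 0 <= A -> 0 < e -> exists2 d : R, 0 < d &
  forall r u v, 0 <= r <= A -> cabs u v <= d ->
  `|cabs (r + u) v `^ q - (r `^ q + q * r `^ (q - 1) * u
     + 2^-1 * (q * (q - 1) * r `^ (q - 2) * u ^+ 2 + q * r `^ (q - 2) * v ^+ 2))|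
  <= e * cabs u v ^+ 2.
Proof.
move=> q2 A0 e0; have q0 : 0 < q by lra.
have e20 : 0 < e / 2 by lra.
have A10 : 0 <= A + 1 by lra.
have [d1 d10 T] := powR_taylor q2 A10 e20.
have C0 : 0 <= q * (q - 2) by rewrite mulr_ge0//; lra.
(* The error r^(q-2) (D^2 - u^2) is treated in two regimes: for r <= eta the power is small, for r >
   eta the hypothesis makes D - u of order s^2. For q = 2 its coefficient vanishes. *)
have [d2 d20 S] : exists2 d : R, 0 < d & forall r s D u, 0 <= r <= A -> 0 <= s <= d ->
    D ^+ 2 <= s ^+ 2 -> u ^+ 2 <= s ^+ 2 -> `|2 * r * (D - u)| <= s ^+ 2 ->
    q * (q - 2) * (r `^ (q - 2) * `|D ^+ 2 - u ^+ 2|) <= e * s ^+ 2.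
  have [q2e|qn2] := eqVneq (q - 2) 0.
    by exists 1 => // r s D u _ _ _ _ _; rewrite q2e mulr0 mul0r mulr_ge0 ?sqr_ge0// ltW.
  have qp : 0 < q - 2 by rewrite lt_neqAle eq_sym qn2; lra.
  have Cp : 0 < q * (q - 2) by exact: mulr_gt0.
  have [eta eta0 heta] := powR_small qp (divr_gt0 e0 Cp).
  have K0 : 0 < q * (q - 2) * A `^ (q - 2) + 1 by rewrite ltr_wpDl// mulr_ge0 ?powR_ge0.
  exists (e * eta / (q * (q - 2) * A `^ (q - 2) + 1)); first by rewrite divr_gt0// mulr_gt0.
  move=> r s D u /andP[r0 rA] /andP[s0]; rewrite ler_pdivlMr// => sd D2 u2 rDu.
  have [re|er] := lerP r eta.
    have := heta r r0 re; rewrite ler_pdivlMr// => h.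
    have b : `|D ^+ 2 - u ^+ 2| <= s ^+ 2.
      by rewrite ler_norml; have := sqr_ge0 D; have := sqr_ge0 u => *; apply/andP; split; lra.
    have := ler_pM (mulr_ge0 (powR_ge0 r (q - 2)) (ltW Cp)) (normr_ge0 _) h b; lra.
  have uD : `|D + u| <= 2 * s.
    have h1 := le_of_sqr s0 D2; have h2 := le_of_sqr s0 u2.
    by apply: le_trans (ler_normD _ _) _; lra.
  have rA2 : r `^ (q - 2) <= A `^ (q - 2).
    by apply: ge0_ler_powR; rewrite ?nnegrE// ltW.
  have k1 : eta * `|D ^+ 2 - u ^+ 2| <= s ^+ 2 * s.
    have -> : D ^+ 2 - u ^+ 2 = (D - u) * (D + u) by ring.
    rewrite normrM; move: rDu; rewrite !normrM (ger0_norm r0) ger0_norm// => rDu.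
    have h1 : 2 * eta * `|D - u| <= s ^+ 2.
      by apply: le_trans rDu; rewrite ler_wpM2r// ler_wpM2l// ltW.
    have h0 : 0 <= 2 * eta * `|D - u| by rewrite !mulr_ge0// ltW.
    have := ler_pM h0 (normr_ge0 _) h1 uD; lra.
  rewrite -(ler_pM2r eta0).
  have k2 := ler_wpM2l C0 (ler_pM (powR_ge0 r (q - 2)) (mulr_ge0 (ltW eta0) (normr_ge0 _)) rA2 k1).
  have k3 := ler_wpM2r (sqr_ge0 s) sd.
  have k4 : 0 <= s * s ^+ 2 by rewrite mulr_ge0 ?sqr_ge0.
  by lra.
exists (Num.min d1 (Num.min d2 1)); first by rewrite !lt_min d10 d20 ltr01.
move=> r u v /andP[r0 rA]; rewrite !le_min => /and3P[sd1 sd2 s1].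
set s := cabs u v in sd1 sd2 s1 *; set rho := cabs (r + u) v.
have s0 : 0 <= s by exact: cabs_ge0.
have rho0 : 0 <= rho by exact: cabs_ge0.
have s2 : s ^+ 2 = u ^+ 2 + v ^+ 2 by exact: cabs_sqr.
have rho2 : rho ^+ 2 = (r + u) ^+ 2 + v ^+ 2 by exact: cabs_sqr.
have rr : r + u <= rho.
  apply: le_trans (ler_norm _) _; apply: le_of_sqr => //; rewrite rho2 lerDl; exact: sqr_ge0.
have D2 : (rho - r) ^+ 2 <= s ^+ 2 by have := ler_wpM2l r0 rr; rewrite s2; lra.
have u2 : u ^+ 2 <= s ^+ 2 by rewrite s2 lerDl sqr_ge0.
have Ds := le_of_sqr s0 D2.
have t := T r rho; rewrite r0 rho0 (le_trans rA)/= in t; last by lra.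
have {}t := t isT _ (le_trans Ds sd1).
have {}t : `|rho `^ q - r `^ q - q * r `^ (q - 1) * (rho - r) - 2^-1 * (q * (q - 1)) * r `^ (q - 2) * (rho - r) ^+ 2| <= e / 2 * (rho - r) ^+ 2.
  by apply: t; move: Ds; rewrite ler_norml => /andP[_ h]; lra.
have rq : r `^ (q - 1) = r * r `^ (q - 2).
  by rewrite -(mulr_powRB1 (p := q - 1) r0); [rewrite (_ : q - 1 - 1 = q - 2)//; ring|lra].
have rD : 2 * r * (rho - r - u) = s ^+ 2 - (rho - r) ^+ 2 by rewrite s2; lra.
have := S r s (rho - r) u; rewrite r0 rA s0 sd2 => /(_ isT isT D2 u2).
rewrite rD => /(_ _) h; have {}h : q * (q - 2) * (r `^ (q - 2) * `|(rho - r) ^+ 2 - u ^+ 2|) <= e * s ^+ 2.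
  by apply: h; rewrite ler_norml; have := sqr_ge0 (rho - r) => *; apply/andP; split; have := sqr_ge0 s; lra.
have -> : rho `^ q - (r `^ q + q * r `^ (q - 1) * u
     + 2^-1 * (q * (q - 1) * r `^ (q - 2) * u ^+ 2 + q * r `^ (q - 2) * v ^+ 2)) =
  (rho `^ q - r `^ q - q * r `^ (q - 1) * (rho - r) - 2^-1 * (q * (q - 1)) * r `^ (q - 2) * (rho - r) ^+ 2)
  + 2^-1 * (q * (q - 2)) * (r `^ (q - 2) * ((rho - r) ^+ 2 - u ^+ 2)).
  have e1 : r * (rho - r) = r * u + 2^-1 * (s ^+ 2 - (rho - r) ^+ 2) by rewrite -rD; field.
  have -> : q * r `^ (q - 1) * (rho - r) = q * r `^ (q - 2) * (r * (rho - r)) by rewrite rq; ring.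
  by rewrite e1 rq s2; field.
apply: le_trans (ler_normD _ _) _; rewrite [X in _ + X]normrM [`|2^-1 * _|]ger0_norm; last by lra.
rewrite [`|r `^ _ * _|]normrM [`|r `^ _|]ger0_norm ?powR_ge0//.
have := ler_wpM2l (ltW e20) D2; lra.
Qed.

Lemma norm_le_mul (a b x y : R) : `|a| <= x -> `|b| <= y -> `|a * b| <= x * y.
Proof. by move=> ax bY; rewrite normrM ler_pM. Qed.

(** The letters c, l, m, e stand for the constant, linear, quadratic and remainder parts of a
    factor. The two coefficients 5 are 4 + 1, from the products with a remainder, and 2 + 3, from
    the products of order at least three. *)
Lemma product_taylor (c0 l0 m0 e0 c1 l1 m1 e1 K e s : R) :
  1 <= K -> 0 <= e <= 1 -> 0 <= s <= 1 ->
  `|c0| <= K -> `|l0| <= K * s -> `|m0| <= K * s ^+ 2 -> `|e0| <= e * s ^+ 2 ->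
  `|c1| <= K -> `|l1| <= K * s -> `|m1| <= K * s ^+ 2 -> `|e1| <= e * s ^+ 2 ->
  `|(c0 + l0 + m0 + e0) * (c1 + l1 + m1 + e1)
    - (c0 * c1 + (l0 * c1 + c0 * l1) + (m0 * c1 + c0 * m1 + l0 * l1))|
  <= (5 * K * e + 5 * K ^+ 2 * s) * s ^+ 2.
Proof.
move=> K1 /andP[e_0 e_1] /andP[s0 s1] hc0 hl0 hm0 he0 hc1 hl1 hm1 he1.
have K0 : 0 <= K by lra.
have ss : s ^+ 2 <= s by rewrite expr2 ler_piMl.
have s20 := sqr_ge0 s.
have es1 : e * s ^+ 2 <= s by apply: le_trans (ler_wpM2r s20 e_1) _; rewrite mul1r.
have Ks1 : K * s <= K by rewrite ler_piMr.
have Ks2 : K * s ^+ 2 <= K * s by exact: ler_wpM2l.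
have hg : `|c1 + l1 + m1 + e1| <= 4 * K.
  apply: le_trans (ler_normD _ _) _.
  have := le_trans (ler_normD (c1 + l1) m1) (lerD (ler_normD c1 l1) (lexx _)); lra.
have hn : `|m1 + e1| <= 2 * K * s ^+ 2.
  apply: le_trans (ler_normD _ _) _.
  have := ler_wpM2r s20 e_1; have := ler_wpM2r s20 K1; lra.
have hk : `|l1 + m1 + e1| <= 3 * K * s.
  apply: le_trans (ler_normD _ _) _.
  have := ler_normD l1 m1; have := ler_wpM2r s0 K1; lra.
have -> : (c0 + l0 + m0 + e0) * (c1 + l1 + m1 + e1)
    - (c0 * c1 + (l0 * c1 + c0 * l1) + (m0 * c1 + c0 * m1 + l0 * l1)) =
  e0 * (c1 + l1 + m1 + e1) + c0 * e1 + l0 * (m1 + e1) + m0 * (l1 + m1 + e1) by ring.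
have t1 := norm_le_mul he0 hg; have t2 := norm_le_mul hc0 he1.
have t3 := norm_le_mul hl0 hn; have t4 := norm_le_mul hm0 hk.
apply: le_trans (ler_normD _ _) _.
have := le_trans (ler_normD (e0 * (c1 + l1 + m1 + e1) + c0 * e1) (l0 * (m1 + e1))) (lerD (ler_normD _ _) (lexx _)).
lra.
Qed.

End DensityTaylor.

(** * Expansion of the nonlinear energy density at a real state *)

Section Density.
Context {R : realType}.
Local Notation I := (bool * bool)%type.
Variables p beta : R.
Implicit Types (a : bool -> R) (z w : I -> R).

(* The index (j, b) stands for the real (b = false) or imaginary (b = true)
   part of the j-th component. *)
Definition amp z (j : bool) := cabs (z (j, false)) (z (j, true)).

Definition dens z := (p + 1)^-1 *
  (amp z false `^ (2 * p + 2) + amp z true `^ (2 * p + 2)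
   + 2 * beta * (amp z false * amp z true) `^ (p + 1)).

Definition nlin (x y : R) := x `^ (2 * p + 1) + beta * x `^ p * y `^ (p + 1).

(** Potentials of the linearised system: [wre] and [wmix] act on real parts, [wim] on imaginary
    parts. *)
Definition wre (x y : R) :=
  (2 * p + 1) * x `^ (2 * p) + beta * p * x `^ (p - 1) * y `^ (p + 1).
Definition wim (x y : R) := x `^ (2 * p) + beta * x `^ (p - 1) * y `^ (p + 1).
Definition wmix (x y : R) := beta * (p + 1) * x `^ p * y `^ p.

(** Half the Hessian of [dens] at a real nonnegative state. Phase invariance decouples the imaginary
    parts from each other and from the real parts. *)
Definition wmat a (i j : I) : R :=
  if i.1 == j.1 then
    if i.2 == j.2 then
      (if i.2 then wim else wre) (a i.1) (a (~~ i.1))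
    else 0
  else if i.2 || j.2 then 0 else wmix (a false) (a true).

Definition shift a w : I -> R := fun i => (if i.2 then 0 else a i.1) + w i.

Lemma sum4 (f : I -> R) : \sum_i f i =
  f (false, false) + f (false, true) + f (true, false) + f (true, true).
Proof.
transitivity (\sum_(i : bool) \sum_(j : bool) f (i, j)).
  by rewrite pair_bigA; apply: eq_bigr => -[].
by rewrite !big_bool/=; ring.
Qed.

Lemma dens_taylor_aux (X Y P e b K e2 e3 s t : R) : X <= e * P / 4 * t ->
  2 * b * Y <= 2 * b * ((5 * K * e2 + 5 * K ^+ 2 * s) * t) -> b * K ^+ 2 * s * t <= b * K ^+ 2 * e3 * t ->
  40 * (b * K) * e2 * t <= e * P * t -> 40 * (b * K ^+ 2) * e3 * t <= e * P * t -> 0 <= e * P * t ->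
  X + 2 * b * Y <= P * (e * t).
Proof. lra. Qed.

(** Both exponents 2 p + 2 and p + 1 are at least 2, so [cabs_taylor] applies to each modulus, and
    [product_taylor] to the coupling term. The radius depends on the bound A only, not on the
    state. *)
Lemma dens_taylor (A e : R) : 1 <= p -> 0 < beta -> 0 <= A -> 0 < e -> exists2 d : R, 0 < d &
  forall a w, (forall j, 0 <= a j <= A) -> \sum_i w i ^+ 2 <= d ->
  `|dens (shift a w) - dens (shift a (fun=> 0))
    - 2 * \sum_j nlin (a j) (a (~~ j)) * w (j, false)
    - \sum_i \sum_j wmat a i j * w i * w j| <= e * \sum_i w i ^+ 2.
Proof.
move=> p1 b0 A0 e0; have [pp P1 P0] : [/\ 0 < p + 1, 0 <= p - 1 & 0 <= p] by split; lra.
(* Bounds the coefficients of order 0, 1 and 2 in the expansion of the power p + 1. *)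
pose K := 1 + A `^ (p + 1) + (p + 1) * A `^ p + (p + 1) ^+ 2 * A `^ (p - 1).
have K1 : 1 <= K.
  by rewrite /K -!addrA lerDl !addr_ge0 ?mulr_ge0 ?powR_ge0 ?sqr_ge0// ltW.
have kA : 0 <= A `^ (p + 1) by exact: powR_ge0.
have kB : 0 <= (p + 1) * A `^ p by rewrite mulr_ge0 ?powR_ge0// ltW.
have kC : 0 <= (p + 1) ^+ 2 * A `^ (p - 1) by rewrite mulr_ge0 ?powR_ge0 ?sqr_ge0.
have [KA KB KC K0] : [/\ A `^ (p + 1) <= K, (p + 1) * A `^ p <= K,
    (p + 1) ^+ 2 * A `^ (p - 1) <= K & 0 < K] by rewrite /K; split; lra.
have bK : 0 < beta * K by exact: mulr_gt0.
have bK2 : 0 < beta * K ^+ 2 by rewrite mulr_gt0 ?exprn_gt0.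
(* The pure powers, the remainders in the coupling and its cubic terms each receive at most a
   quarter of e (p + 1) |w|^2. *)
pose e1 := e * (p + 1) / 4.
pose e2 := Num.min 1 (e * (p + 1) / (40 * (beta * K))).
pose e3 := Num.min 1 (e * (p + 1) / (40 * (beta * K ^+ 2))).
have ep : 0 < e * (p + 1) by exact: mulr_gt0.
have e10 : 0 < e1 by rewrite divr_gt0.
have e20 : 0 < e2 by rewrite lt_min ltr01 divr_gt0// mulr_gt0.
have e30 : 0 < e3 by rewrite lt_min ltr01 divr_gt0// mulr_gt0.
have e2K : 40 * (beta * K) * e2 <= e * (p + 1).
  by rewrite mulrC -ler_pdivlMr ?mulr_gt0// ge_min lexx orbT.
have e3K : 40 * (beta * K ^+ 2) * e3 <= e * (p + 1).
  by rewrite mulrC -ler_pdivlMr ?mulr_gt0// ge_min lexx orbT.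
have e21 : 0 <= e2 <= 1 by rewrite ltW// ge_min lexx.
have [|d1 d10 T1] := @cabs_taylor R (2 * p + 2) A e1 _ A0 e10; first by lra.
have [|d2 d20 T2] := @cabs_taylor R (p + 1) A e2 _ A0 e20; first by lra.
pose d := Num.min d1 (Num.min d2 e3).
have d0 : 0 < d by rewrite lt_min d10 lt_min d20 e30.
exists (d ^+ 2); first exact: exprn_gt0.
move=> a w ha; set S := \sum_i w i ^+ 2 => Sd.
pose s := Num.sqrt S.
have S0 : 0 <= S by apply: sumr_ge0 => i _; exact: sqr_ge0.
have s0 : 0 <= s by exact: sqrtr_ge0.
have s2 : s ^+ 2 = S by exact: sqr_sqrtr.
have sd : s <= d by rewrite -(@ler_pXn2r _ 2) ?nnegrE// ?s2// ltW.
have [sd1 sd2 sd3] : [/\ s <= d1, s <= d2 & s <= e3].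
  by move: sd; rewrite !le_min => /and3P[].
have s01 : 0 <= s <= 1 by rewrite s0 (le_trans sd3)// ge_min lexx.
have ws i : w i ^+ 2 <= s ^+ 2.
  by rewrite s2 /S (bigD1 i)//= lerDl; apply: sumr_ge0 => j _; exact: sqr_ge0.
pose c j := cabs (w (j, false)) (w (j, true)).
have cS : c false ^+ 2 + c true ^+ 2 = S by rewrite !cabs_sqr /S sum4 addrA.
have cs j : c j ^+ 2 <= s ^+ 2.
  by rewrite s2 -cS; case: j; rewrite ?lerDl ?lerDr sqr_ge0.
have cle j : c j <= s.
  by rewrite -(@ler_pXn2r _ 2) ?nnegrE ?cabs_ge0.
have wle i : `|w i| <= s by exact: le_of_sqr.
have ampE j : amp (shift a w) j = cabs (a j + w (j, false)) (w (j, true)).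
  by rewrite /amp /shift/= add0r.
have amp0 j : amp (shift a (fun=> 0)) j = a j.
  rewrite /amp /shift/= !addr0 /cabs expr0n addr0 sqrtr_sqr ger0_norm//.
  by case/andP: (ha j).
pose gg j := amp (shift a w) j.
have t1 j := T1 (a j) (w (j, false)) (w (j, true)) (ha j) (le_trans (cle j) sd1).
have t2 j := T2 (a j) (w (j, false)) (w (j, true)) (ha j) (le_trans (cle j) sd2).
pose l j := (p + 1) * a j `^ p * w (j, false).
pose m j := 2^-1 * ((p + 1) * p * a j `^ (p - 1) * w (j, false) ^+ 2
   + (p + 1) * a j `^ (p - 1) * w (j, true) ^+ 2).
pose M j := 2^-1 * ((2 * p + 2) * (2 * p + 1) * a j `^ (2 * p) * w (j, false) ^+ 2
   + (2 * p + 2) * a j `^ (2 * p) * w (j, true) ^+ 2).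
pose L j := (2 * p + 2) * a j `^ (2 * p + 1) * w (j, false).
pose r1 j := amp (shift a w) j `^ (2 * p + 2) - (a j `^ (2 * p + 2) + L j + M j).
pose r2 j := amp (shift a w) j `^ (p + 1) - (a j `^ (p + 1) + l j + m j).
have h1 j : `|r1 j| <= e1 * c j ^+ 2.
  have E1 : 2 * p + 2 - 1 = 2 * p + 1 by ring.
  have E2 : 2 * p + 2 - 2 = 2 * p by ring.
  by have := t1 j; rewrite E1 E2 -ampE.
have h2 j : `|r2 j| <= e2 * s ^+ 2.
  apply: le_trans (ler_wpM2l (ltW e20) (cs j)).
  have E1 : p + 1 - 1 = p by ring.
  have E2 : p + 1 - 2 = p - 1 by ring.
  by have := t2 j; rewrite E1 E2 -ampE.
have aA j x : 0 <= x -> 0 <= a j `^ x <= A `^ x.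
  move=> x0; have /andP[k1 k2] := ha j; rewrite powR_ge0/=.
  by apply: ge0_ler_powR; rewrite ?nnegrE.
have hc j : `|a j `^ (p + 1)| <= K.
  have /andP[k1 k2] := aA j _ (ltW pp); rewrite ger0_norm//; exact: le_trans k2 KA.
have hl j : `|l j| <= K * s.
  apply: norm_le_mul (wle _); have /andP[k1 k2] := aA j _ P0.
  rewrite ger0_norm; last by rewrite mulr_ge0// ltW.
  exact: le_trans (ler_wpM2l (ltW pp) k2) KB.
have hm j : `|m j| <= K * s ^+ 2.
  have /andP[k1 k2] := aA j _ P1.
  have w1 := ws (j, false); have w2 := ws (j, true).
  have x1 := sqr_ge0 (w (j, false)); have x2 := sqr_ge0 (w (j, true)).
  have q1 : 0 <= (p + 1) * p * a j `^ (p - 1) by rewrite !mulr_ge0// ltW.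
  have q2 : 0 <= (p + 1) * a j `^ (p - 1) by rewrite !mulr_ge0// ltW.
  have m0 : 0 <= m j by rewrite mulr_ge0 ?invr_ge0// addr_ge0// mulr_ge0.
  rewrite ger0_norm// /m.
  have q3 := ler_wpM2l q1 w1; have q4 := ler_wpM2l q2 w2.
  have q5 : (p + 1) ^+ 2 * a j `^ (p - 1) <= K.
    exact: le_trans (ler_wpM2l (sqr_ge0 (p + 1)) k2) KC.
  have q6 := ler_wpM2r (sqr_ge0 s) q5.
  have q7 : 0 <= (p + 1) * p * a j `^ (p - 1) * s ^+ 2 by rewrite mulr_ge0 ?sqr_ge0.
  have q8 : 0 <= (p + 1) * a j `^ (p - 1) * s ^+ 2 by rewrite mulr_ge0 ?sqr_ge0.
  by lra.
have prod := product_taylor K1 e21 s01 (hc false) (hl false) (hm false) (h2 false)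
  (hc true) (hl true) (hm true) (h2 true).
rewrite /r2 !subrKC in prod.
have c20 j : 0 <= c j ^+ 2 by exact: sqr_ge0.
rewrite -s2 /dens !amp0 !powRM ?cabs_ge0//; [|by case/andP: (ha false)|by case/andP: (ha true)].
set X := (X in `|X| <= _).
have -> : X = (p + 1)^-1 * (r1 false + r1 true + 2 * beta *
   (amp (shift a w) false `^ (p + 1) * amp (shift a w) true `^ (p + 1) -
   (a false `^ (p + 1) * a true `^ (p + 1) +
           (l false * a true `^ (p + 1) + a false `^ (p + 1) * l true) +
           (m false * a true `^ (p + 1) + a false `^ (p + 1) * m true + l false * l true)))).
  rewrite /X !sum4 !big_bool /wmat/= /nlin /wre /wim /wmix /r1 /L /M /l /m.
  by field; rewrite gt_eqF.
rewrite normrM gtr0_norm ?invr_gt0// ler_pdivrMl//.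
apply: le_trans (ler_normD _ _) _.
have b2 : 0 <= 2 * beta by rewrite mulr_ge0// ltW.
rewrite [`|2 * beta * _|]normrM (ger0_norm b2).
have z1 := ler_wpM2l b2 prod.
have z2 := le_trans (ler_normD _ _) (lerD (h1 false) (h1 true)).
have z3 : e1 * c false ^+ 2 + e1 * c true ^+ 2 = e1 * s ^+ 2 by rewrite -mulrDr cS s2.
have s20 := sqr_ge0 s.
have z4 := ler_wpM2r s20 e2K; have z5 := ler_wpM2r s20 e3K.
have z6 : beta * K ^+ 2 * s * s ^+ 2 <= beta * K ^+ 2 * e3 * s ^+ 2.
  by rewrite ler_wpM2r// ler_wpM2l// ltW.
have z7 := mulr_ge0 (ltW ep) s20.
rewrite z3 /e1 in z2.
exact: dens_taylor_aux z2 z1 z6 z4 z5 z7.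
Qed.

End Density.

(** * Exponentially decaying functions *)

Section Decay.
Context {R : realType}.
Implicit Types f g : R -> R.

Definition edecay f := exists C c : R, 0 < c /\ forall x, `|f x| <= C * expR (- c * `|x|).

Lemma expR_abs_continuous (c : R) : continuous (fun x : R => expR (- c * `|x|)).
Proof.
move=> x; have h : (fun y : R => - c * `|y|) @ x --> - c * `|x|.
  by apply: cvgM; [exact: cvg_cst|exact: (@norm_continuous R R x)].
exact: (@continuous_comp _ _ _ (fun y : R => - c * `|y|) (@expR R) x h (@continuous_expR R _)).
Qed.

(** By evenness the half-line suffices, where the function is a multiple of the exponential
    density. *)
Lemma itg_exp (c : R) : 0 < c -> itg (fun x : R => expR (- c * `|x|)).
Proof.
move=> c0; have cf := @expR_abs_continuous c.
have f0 (x : R) : 0 <= expR (- c * `|x|) by exact: expR_ge0.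
apply/integrableP; split; first by apply/measurable_EFinP; exact: mble_cont cf.
have -> : (\int[lebesgue_measure]_x `|(EFin \o (fun x : R => expR (- c * `|x|))) x| =
    \int[lebesgue_measure]_x (expR (- c * `|x|))%:E)%E.
  by apply: eq_integral => x _ /=; rewrite ger0_norm.
rewrite (ge0_symfun_integralT f0 cf); last by move=> x /=; rewrite normrN.
have ip1 := itgZ c^-1 (integrable_exponential_pdf c0).
have mpos : measurable ([set x | 0 <= x]%R : set (measurableTypeR R)).
  by rewrite -set_itvcy; exact: measurable_itv.
have : (\int[lebesgue_measure]_(x in [set x | 0 <= x]%R) (expR (- c * `|x|))%:E < +oo)%E.
  have /integrableP[_] := ip1; apply: le_lt_trans.
  rewrite integral_mkcond; apply: ge0_le_integral => //.
  - by move=> x _; rewrite patchE; case: ifP.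
  - apply: (iffLR (measurable_restrictT _ mpos)); apply: measurable_funTS.
    by apply/measurable_EFinP; exact: mble_cont cf.
  - by apply: measurableT_comp => //; apply/measurable_EFinP; exact: itg_mble ip1.
  - move=> x _; rewrite patchE; case: ifPn => [|_]; last exact: abse_ge0.
    rewrite inE/= => x0; rewrite exponential_pdfE// lee_fin (ger0_norm x0).
    by rewrite ger0_norm ?mulr_ge0 ?invr_ge0 ?expR_ge0 ?(ltW c0)// mulrA mulVf ?mul1r ?gt_eqF.
by move=> h; rewrite lte_mul_pinfty.
Qed.

Lemma edecay_bdd f : edecay f -> exists2 B, 0 <= B & forall x, `|f x| <= B.
Proof.
move=> [C [c [c0 h]]]; have C0 : 0 <= C.
  by have := le_trans (normr_ge0 _) (h 0); rewrite normr0 mulr0 expR0 mulr1.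
exists C => // x; apply: le_trans (h x) _; rewrite ler_piMr// -expR0 ler_expR.
by rewrite mulNr oppr_le0 mulr_ge0// ltW.
Qed.

Lemma edecay_le f g (K : R) : edecay g -> (forall x, `|f x| <= K * `|g x|) -> edecay f.
Proof.
move=> [C [c [c0 h]]] fg; exists (`|K| * C), c; split=> // x.
apply: le_trans (fg x) _; rewrite -mulrA.
by apply: le_trans (ler_wpM2r (normr_ge0 _) (ler_norm K)) _; rewrite ler_wpM2l.
Qed.

Lemma edecay_itg f : mble f -> edecay f -> itg f.
Proof.
move=> mf [C [c [c0 h]]]; apply: itg_le mf (itgZ C (itg_exp c0)) _ => x.
exact: le_trans (h x) (ler_norm _).
Qed.

Lemma edecay_L2 f : mble f -> edecay f -> L2 f.
Proof.
move=> mf df; split=> //; apply: edecay_itg; first exact: mbleX.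
have [B B0 hB] := edecay_bdd df; apply: (edecay_le (K := B) df) => x.
by rewrite normrX expr2 ler_wpM2r.
Qed.

Lemma edecayD f g : edecay f -> edecay g -> edecay (fun x => f x + g x).
Proof.
move=> [C [c [c0 hf]]] [C' [c' [c'0 hg]]].
exists (`|C| + `|C'|), (Num.min c c'); split=> [|x]; first by rewrite lt_min c0.
apply: le_trans (ler_normD _ _) _; rewrite mulrDl.
have le t : Num.min c c' <= t -> expR (- t * `|x|) <= expR (- Num.min c c' * `|x|).
  by move=> h; rewrite ler_expR ler_wpM2r// lerN2.
apply: lerD.
- apply: le_trans (hf x) _; apply: le_trans (ler_wpM2r (expR_ge0 _) (ler_norm C)) _.
  by rewrite ler_wpM2l// le// ge_min lexx.
- apply: le_trans (hg x) _; apply: le_trans (ler_wpM2r (expR_ge0 _) (ler_norm C')) _.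
  by rewrite ler_wpM2l// le// ge_min lexx orbT.
Qed.

Lemma edecay_window f : edecay f -> exists C c : R, [/\ 0 <= C, 0 < c &
  forall x y, `|x - y| <= 1 -> `|f y| <= C * expR (- c * `|x|)].
Proof.
move=> [C [c [c0 h]]]; exists (`|C| * expR c), c; split=> // x y xy.
apply: le_trans (h y) _; apply: le_trans (ler_wpM2r (expR_ge0 _) (ler_norm C)) _.
rewrite -mulrA ler_wpM2l// -expRD ler_expR.
have : `|x| <= 1 + `|y| by rewrite -lerBlDr; exact: le_trans (lerB_dist _ _) xy.
by move=> /(ler_wpM2l (ltW c0)); lra.
Qed.

Lemma edecay_small f (e : R) : edecay f -> 0 < e -> exists2 A : R, 0 < A &
  forall x, A < `|x| -> `|f x| <= e.
Proof.
move=> [C [c [c0 h]]] e0; have Ce : 0 <= `|C| / e by rewrite divr_ge0// ltW.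
exists ((`|C| / e + 1) / c); first by rewrite divr_gt0// ltr_wpDl.
move=> x; rewrite ltr_pdivrMr// => hx.
apply: le_trans (h x) _; apply: le_trans (ler_wpM2r (expR_ge0 _) (ler_norm C)) _.
rewrite mulNr expRN ler_pdivrMr ?expR_gt0// mulrC -ler_pdivrMr//.
apply: le_trans (expR_ge1Dx _); rewrite mulrC; lra.
Qed.

Lemma C1d_MVT f f' (a b : R) : C1d f f' -> exists c : R,
  [/\ Num.min a b <= c, c <= Num.max a b & f b - f a = f' c * (b - a)].
Proof.
move=> Cf; have cf : continuous f by exact: C1_continuous (C1d_C1 Cf).
have key (x y : R) : x <= y -> exists c, [/\ x <= c, c <= y & f y - f x = f' c * (y - x)].
  move=> xy; have [|c] := @MVT_segment _ f f' x y xy (fun z _ => Cf.1 z).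
    exact: continuous_subspaceT.
  by rewrite in_itv/= => /andP[h1 h2] e; exists c.
have [ab|ba] := lerP a b; first by have [c [h1 h2 e]] := key _ _ ab; exists c.
have [c [h1 h2 e]] := key _ _ (ltW ba); exists c; split=> //.
by rewrite -opprB e -mulrN opprB.
Qed.

Lemma C1d_MVT_dist f f' (a b : R) : C1d f f' -> exists2 c : R,
  `|a - c| <= `|b - a| & f b - f a = f' c * (b - a).
Proof.
move=> /(C1d_MVT a b)[c [h1 h2 e]]; exists c => //; move: h1 h2.
have [ab|ba] := lerP a b; rewrite ?ge_min ?le_max => h1 h2.
  by rewrite (ler0_norm (x := a - c)) ?(ger0_norm (x := b - a)) ?subr_ge0 ?subr_le0//; lra.
by rewrite (ger0_norm (x := a - c)) ?(ltr0_norm (x := b - a)) ?subr_ge0 ?subr_lt0//; lra.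
Qed.

(** Two mean value steps give f'(x) = f(x + 1) - f(x) - f''(z) (y - x) with y and z within distance
    1 of x, and every term on the right decays. *)
Lemma edecay_derive f : C1 f -> C1 (derive1 f) -> edecay f ->
  edecay (derive1 (derive1 f)) -> edecay (derive1 f).
Proof.
move=> /C1_C1d Cf /C1_C1d Cf' df d2.
have [C [c [C0 c0 h]]] := edecay_window df; have [C' [c' [C'0 c'0 h']]] := edecay_window d2.
have bd x : `|derive1 f x| <= 2 * C * expR (- c * `|x|) + C' * expR (- c' * `|x|).
  have [y yx ey] := C1d_MVT_dist x (x + 1) Cf.
  have [z zx ez] := C1d_MVT_dist x y Cf'.
  rewrite addrAC subrr add0r normr1 in yx; rewrite addrAC subrr add0r mulr1 in ey.
  rewrite distrC in zx; have zx1 := le_trans zx; rewrite distrC in zx.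
  have xz : `|x - z| <= 1 by apply: le_trans zx _; rewrite distrC.
  have -> : derive1 f x = f (x + 1) - f x - derive1 (derive1 f) z * (y - x).
    by rewrite ey -ez; ring.
  have k1 := h x x; rewrite subrr normr0 in k1; have {}k1 := k1 ler01.
  have k2 : `|f (x + 1)| <= C * expR (- c * `|x|).
    by apply: h; rewrite opprD addrA subrr add0r normrN normr1.
  have k3 := h' x z xz.
  have k4 : `|derive1 (derive1 f) z * (y - x)| <= C' * expR (- c' * `|x|).
    apply: le_trans k3; rewrite normrM ler_piMr//.
    by rewrite distrC.
  apply: le_trans (ler_normB _ _) _.
  have := le_trans (ler_normB (f (x + 1)) (f x)) (lerD k2 k1); lra.
have e1 : edecay (fun x : R => 2 * C * expR (- c * `|x|)).
  exists (2 * C), c; split=> // x; rewrite ger0_norm// !mulr_ge0 ?expR_ge0//.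
have e2 : edecay (fun x : R => C' * expR (- c' * `|x|)).
  exists C', c'; split=> // x; rewrite ger0_norm// !mulr_ge0 ?expR_ge0//.
apply: (edecay_le (K := 1) (edecayD e1 e2)) => x; rewrite mul1r.
exact: le_trans (bd x) (ler_norm _).
Qed.

Lemma C1_H1 f : C1 f -> L2 f -> L2 (derive1 f) -> H1 f /\ aeq (wderiv f) (derive1 f).
Proof. by move=> Cf h1 h2; apply: H1I => //; exact: C1_weak_deriv. Qed.

Lemma dct_L2 (g : nat -> R -> R) (b : R -> R) : (forall n, mble (g n)) -> L2 b ->
  (forall x, g n x @[n --> \oo] --> (0 : R)) -> (forall n x, `|g n x| <= b x) ->
  (forall n, L2 (g n)) /\ (ip (g n) (g n) @[n --> \oo] --> (0 : R)).
Proof.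
move=> mg Lb cv bd; split.
  by move=> n; apply: L2_le (mg n) Lb _ => x; exact: le_trans (bd n x) (ler_norm _).
have [|||||_] := @DCT R (fun n x => g n x ^+ 2) (fun=> 0) (fun x => b x ^+ 2).
- by move=> n; exact: mbleX.
- exact: mbleC.
- exact: Lb.2.
- apply: ae_all => x; rewrite -[0 : R](mulr0 0).
  by under eq_fun do rewrite expr2; apply: cvgM.
- apply: ae_all => x n; rewrite normrX lerXn2r ?nnegrE// (le_trans _ (bd n x))//.
by rewrite Int0; under eq_fun do rewrite -ip_sqr.
Qed.

(** By the mean value theorem [g n x] is th (f'(x) - f'(y)) with y within |th a_n| <= 1 of x: it
    tends to 0 pointwise and is dominated by an exponential. *)
Lemma translate_quotient f (th : R) (a : nat -> R) : C1 f -> edecay (derive1 f) ->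
  (forall n, 0 < a n) -> (forall n, `|th * a n| <= 1) -> a n @[n --> \oo] --> (0 : R) ->
  let g n x := (a n)^-1 * (f (x - th * a n) - f x) + th * derive1 f x in
  (forall n, L2 (g n)) /\ (ip (g n) (g n) @[n --> \oo] --> (0 : R)).
Proof.
move=> Cf df a0 a1 ca g; have cf := C1_continuous Cf; have Cfd := C1_C1d Cf.
have [C [c [C0 c0 h]]] := edecay_window df.
have gE n x : exists2 y : R, `|x - y| <= `|th * a n| & g n x = th * (derive1 f x - derive1 f y).
  have [y yx ey] := C1d_MVT_dist x (x - th * a n) Cfd.
  rewrite addrAC subrr add0r normrN in yx; exists y => //.
  by rewrite /g ey; field; rewrite gt_eqF.
apply: (@dct_L2 _ (fun x => `|th| * (2 * C * expR (- c * `|x|)))).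
- move=> n; apply: mbleD; last by apply: mbleM (mbleC _) _; exact: mble_cont Cf.2.
  apply: mbleM (mbleC _) _; apply: mbleB; last exact: mble_cont.
  have := mble_affine (- (th * a n)) 1 (mble_cont cf).
  by congr mble; apply/funext => x; rewrite mul1r.
- apply: edecay_L2; first by do 2! apply: mbleM (mbleC _) _; exact: mble_cont (@expR_abs_continuous c).
  exists (`|th| * (2 * C)), c; split=> // x.
  by rewrite mulrA ger0_norm// !mulr_ge0 ?expR_ge0.
- move=> x; apply/cvgrPdist_le => e e0.
  have e1 : 0 < e / (`|th| + 1) by rewrite divr_gt0// ltr_wpDl.
  have cx : derive1 f @ x --> derive1 f x := Cf.2 x.
  have /cvgrPdist_le/(_ _ e1)/nbhs_ballP[d /= d0 hd] := cx.
  have ct : `|th * a n| @[n --> \oo] --> (0 : R).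
    rewrite -(normr0 R) -(mulr0 th); apply: cvg_norm; apply: cvgM => //; exact: cvg_cst.
  have : \forall n \near \oo, `|th * a n| < d by apply: (cvgr_lt _ ct).
  apply: filterS => n hn.
  have [y xy ->] := gE n x; rewrite sub0r normrN normrM.
  have := hd y (le_lt_trans xy hn); rewrite ler_pdivlMr ?ltr_wpDl// => k.
  by have := normr_ge0 (derive1 f x - derive1 f y); lra.
- move=> n x; have [y xy ->] := gE n x; rewrite normrM ler_wpM2l//.
  apply: le_trans (ler_normB _ _) _.
  have k1 := h x x; rewrite subrr normr0 in k1; have {}k1 := k1 ler01.
  by have := h x y (le_trans xy (a1 n)); lra.
Qed.

End Decay.

(** * Integration by parts, uniqueness for the profile equation and the Wronskian argument *)

Section Profile.
Context {R : realType}.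
Implicit Types f g h u v eta : R -> R.
Local Notation mu := (@mu R).
Local Notation D := (@wderiv R).

(** The bump max(1 - y^2, 0)^2 at y = x / (n + 1): it tends to 1, and its derivative is of order 1 /
    (n + 1). *)
Definition cutoff (n : nat) (x : R) := hump (-1) 1 (n.+1%:R^-1 * x).

Lemma hump_bd (x : R) : 0 <= hump (-1 : R) 1 x <= 1.
Proof.
have [hx|hx] := boolP (-1 < x < 1); last by rewrite hump_out ?lexx ?ler01//; lra.
have /andP[h1 h2] := hx; have := hump_gt0 hx => h0; rewrite (ltW h0)/=.
have y0 : 0 < 1 - x ^+ 2 by nra.
rewrite /hump (_ : - (-1 * 1) + (-1 + 1) * x + -1 * x ^+ 2 = 1 - x ^+ 2); last by ring.
rewrite /posq gtr0_norm//; have := sqr_ge0 x; nra.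
Qed.

Lemma hump0 : hump (-1 : R) 1 0 = 1.
Proof. by rewrite /hump /posq expr0n/= !mulr0 !addr0 mulN1r opprK expr1n mul1r normr1; field. Qed.

Lemma cutoff_derive n : C1 (cutoff n) /\
  derive1 (cutoff n) = fun x => n.+1%:R^-1 * derive1 (hump (-1) 1) (n.+1%:R^-1 * x).
Proof.
have h : C1d (cutoff n) (fun x => derive1 (hump (-1) 1) (n.+1%:R^-1 * x) * n.+1%:R^-1).
  apply: (C1_comp (C1_C1d (hump_C1 (-1) 1))).
  split; last by move=> x; exact: cvg_cst.
  move=> x; apply: (@is_derive_quad _ _ _ _ 0) => k _.
  rewrite mul0r (_ : _ - _ = 0) ?normr0//; ring.
by split; [exact: C1d_C1 h|rewrite (C1dE h); apply/funext => x; rewrite mulrC].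
Qed.

Lemma cutoff_test n : test_function (cutoff n).
Proof.
apply/testP; split; first by case: (cutoff_derive n).
exists n.+1%:R => // x hx; apply: hump_out; first by lra.
apply/negP => /andP[h1 h2]; move: hx; rewrite ltNge => /negP; apply.
have n0 : 0 < n.+1%:R :> R by [].
move: h1 h2; rewrite [_ * x]mulrC ltr_pdivrMr// ltr_pdivlMr// mul1r mulN1r => h1 h2.
by rewrite ler_norml !ltW.
Qed.

Lemma cutoff_cvg (x : R) : cutoff n x @[n --> \oo] --> (1 : R).
Proof.
have cv : n.+1%:R^-1 * x @[n --> \oo] --> 0 * x.
  by apply: cvgM; [exact: cvg_harmonic|exact: cvg_cst].
rewrite mul0r in cv; rewrite -[X in _ --> X]hump0.
have ch : hump (-1) 1 @ (0 : R) --> hump (-1) 1 0 by exact: C1_continuous (hump_C1 (-1 : R) 1) _.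
exact: (cvg_comp _ _ cv ch).
Qed.

Lemma cutoff_derive_bd : exists2 B : R, 0 <= B & forall n x, `|derive1 (cutoff n) x| <= n.+1%:R^-1 * B.
Proof.
have [Ch [A A0 hA]] : C1 (hump (-1 : R) 1) /\ exists2 A : R, 0 < A & forall x, A < `|x| -> hump (-1 : R) 1 x = 0.
  split; first exact: hump_C1.
  exists 1 => // x hx; apply: hump_out; first by lra.
  apply/negP => /andP[h1 h2]; move: hx; rewrite ltNge => /negP; apply.
  by rewrite ler_norml !ltW.
have [B B0 hB] := cont_compact_bdd A0 Ch.2 (test_derive_out hA).
exists B => // n x; rewrite (cutoff_derive n).2 normrM ger0_norm ?invr_ge0//.
by rewrite ler_wpM2l ?invr_ge0.
Qed.

(** As f need not have compact support, the weak derivative of v is tested against f times a cutoff,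
    and both sides pass to the limit by dominated convergence. *)
Lemma ibp_H1 v f : H1 v -> C1 f -> L2 f -> L2 (derive1 f) -> ip (D v) f = - ip v (derive1 f).
Proof.
move=> [Lv LDv [_ _ w]] Cf Lf Lf'.
have [B B0 hB] := cutoff_derive_bd.
have mc n : mble (cutoff n) by apply: mble_cont; exact: C1_continuous (cutoff_derive n).1.
have mc' n : mble (derive1 (cutoff n)) by apply: mble_cont; exact: (cutoff_derive n).1.2.
have cb n x : `|cutoff n x| <= 1.
  by have /andP[h1 h2] := hump_bd (n.+1%:R^-1 * x); rewrite ger0_norm.
have i1 := L2_mul LDv Lf; have i2 := L2_mul Lv Lf'; have i3 := L2_mul Lv Lf.
have [|||||_ c1] := @DCT R (fun n x => D v x * (f x * cutoff n x)) (fun x => D v x * f x) (fun x => `|D v x * f x|).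
- by move=> n; apply: mbleM LDv.1 _; apply: mbleM Lf.1 _.
- exact: itg_mble i1.
- exact: itg_abs.
- apply: ae_all => x; apply: cvgM; first exact: cvg_cst.
  by rewrite -[X in _ --> X]mulr1; apply: cvgM; [exact: cvg_cst|exact: cutoff_cvg].
- by apply: ae_all => x n; rewrite mulrA normrM ler_piMr.
have [|||||_ c2] := @DCT R (fun n x => v x * (derive1 f x * cutoff n x + f x * derive1 (cutoff n) x))
    (fun x => v x * derive1 f x) (fun x => `|v x * derive1 f x| + B * `|v x * f x|).
- move=> n; apply: mbleM Lv.1 _; apply: mbleD; [exact: mbleM Lf'.1 _|exact: mbleM Lf.1 _].
- exact: itg_mble i2.
- exact: itgD (itg_abs i2) (itgZ _ (itg_abs i3)).
- apply: ae_all => x; apply: cvgM; first exact: cvg_cst.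
  rewrite -[X in _ --> X]addr0; apply: cvgD.
    by rewrite -[X in _ --> X]mulr1; apply: cvgM; [exact: cvg_cst|exact: cutoff_cvg].
  rewrite -[X in _ --> X](mulr0 (f x)); apply: cvgM; first exact: cvg_cst.
  apply/norm_cvg0P; apply: (@squeeze_cvgr _ _ _ _ (fun=> 0) (fun n => n.+1%:R^-1 * B)).
  + by apply: nearW => n; rewrite normr_ge0 hB.
  + exact: cvg_cst.
  + by rewrite -[X in _ --> X](mul0r B); apply: cvgM; [exact: cvg_harmonic|exact: cvg_cst].
- apply: ae_all => x n; rewrite mulrDr; apply: le_trans (ler_normD _ _) _; apply: lerD.
    by rewrite mulrA normrM ler_piMr.
  rewrite mulrA normrM mulrC ler_wpM2r//; apply: le_trans (hB n x) _.
  by rewrite ler_piMl// invf_le1// ler1n.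
have e n : \int[mu]_x (D v x * (f x * cutoff n x)) =
    - \int[mu]_x (v x * (derive1 f x * cutoff n x + f x * derive1 (cutoff n) x)).
  have [Cc _] := cutoff_derive n; have := w _ (testM Cf (cutoff_test n)).
  by rewrite (C1M Cf Cc).2 => ->; rewrite opprK.
rewrite !ipE -(cvg_lim (@Rhausdorff R) c1); apply: cvg_lim => //.
by under eq_fun do rewrite e; exact: cvgN.
Qed.

Lemma weak_deriv_mul f v g : C1 f -> weak_deriv v g ->
  weak_deriv (fun x => f x * v x) (fun x => derive1 f x * v x + f x * g x).
Proof.
move=> Cf [lv lg w]; have cf := C1_continuous Cf.
have mulE f1 v1 : (fun x : R => f1 x * v1 x) = (fun x => v1 x * f1 x).
  by apply/funext => x; rewrite mulrC.
have l1 : loc (fun x => derive1 f x * v x) by rewrite mulE; apply: locM => //; exact: Cf.2.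
have l2 : loc (fun x => f x * g x) by rewrite mulE; exact: locM.
have l3 : loc (fun x => f x * v x) by rewrite mulE; exact: locM.
split=> //; first exact: locD.
move=> eta te; have [Ce _] := iffLR (testP _) te.
have [_ eD] := C1M Cf Ce; have := w _ (testM Cf te); rewrite eD => h.
have k1 := loc_test l1 te; have k2 := loc_test l2 te; have k3 := loc_testd l3 te.
have -> : \int[mu]_x ((derive1 f x * v x + f x * g x) * eta x) =
    \int[mu]_x (derive1 f x * v x * eta x) + \int[mu]_x (f x * g x * eta x).
  by rewrite -(IntD k1 k2); apply: eq_Rintegral => x _; rewrite mulrDl.
have e1 : \int[mu]_x (v x * (derive1 f x * eta x + f x * derive1 eta x)) =
    \int[mu]_x (derive1 f x * v x * eta x) + \int[mu]_x (f x * v x * derive1 eta x).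
  by rewrite -(IntD k1 k3); apply: eq_Rintegral => x _; ring.
have e2 : \int[mu]_x (g x * (f x * eta x)) = \int[mu]_x (f x * g x * eta x).
  by apply: eq_Rintegral => x _; ring.
by rewrite e1 e2 in h; move: h; lra.
Qed.

Lemma itg_cst0 (c : R) : itg (fun=> c) -> c = 0.
Proof.
move=> ic; apply/eqP; rewrite -normr_eq0 eq_le normr_ge0 andbT leNgt; apply/negP => c0.
have I0 (n : nat) : n%:R * `|c| <= \int[mu]_x `|c|.
  have e : \int[mu]_x ((\1_(`[0, n%:R[%classic) x : R) ^+ 2) = n%:R.
    by rewrite (Int_indic_co (x := 0)) ?subr0.
  have l := L2_indic_co (0 : R) n%:R.
  rewrite mulrC -{1}e -(IntZ _ l.2); apply: Int_le; [exact: itgZ l.2|exact: itg_abs ic|].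
  by move=> x; rewrite indicE; case: (_ \in _); rewrite ?expr1n ?expr0n ?mulr1 ?mulr0.
set J := \int[mu]_x `|c| in I0.
have := I0 (Num.truncn (J / `|c|)).+1; rewrite leNgt => /negP; apply.
have := truncnS_gt (J / `|c|); rewrite ltr_pdivrMr//.
Qed.

(** Both sides are continuous, so the equation in the sense of distributions holds at every
    point. *)
Lemma weak_ode u h : C1 u -> C1 (derive1 u) -> continuous h -> weak_elliptic u h ->
  forall x, derive1 (derive1 u) x = 2 * (u x - h x).
Proof.
move=> Cu Cu' ch we; have cu := C1_continuous Cu.
have wu := C1_weak_deriv Cu; have wu' := C1_weak_deriv Cu'.
have wD : weak_deriv u (D u) by exact: (xgetI (fun=> 0) (x := derive1 u) wu).
have du := weak_deriv_unique wD wu.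
have lDu : loc (D u) by case: wD.
have c2 := Cu'.2; pose k x := 2^-1 * derive1 (derive1 u) x + (-1) * (u x + (-1) * h x).
have ck : continuous k.
  move=> x; apply: cvgD; first by apply: cvgM; [exact: cvg_cst|exact: c2].
  apply: cvgM; first exact: cvg_cst.
  by apply: cvgD; [exact: cu|apply: cvgM; [exact: cvg_cst|exact: ch]].
have : aeq k (fun=> 0).
  apply: fundamental_lemma => [|eta te]; first exact: cont_loc.
  have [_ _ w2] := wu'; have := w2 _ te; have := we _ te.
  have -> : \int[mu]_x (D u x * derive1 eta x) = \int[mu]_x (derive1 u x * derive1 eta x).
    apply: Int_ae; first by apply: ae_mono du => x ->.
      exact: itg_mble (loc_testd lDu te).
    by apply: itg_mble; apply: loc_testd te; exact/cont_loc/C1_continuous.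
  have j1 := loc_test (cont_loc c2) te; have j2 := loc_test (cont_loc cu) te.
  have j3 := loc_test (cont_loc ch) te.
  have -> : \int[mu]_x (k x * eta x) = 2^-1 * \int[mu]_x (derive1 (derive1 u) x * eta x)
      + (-1) * (\int[mu]_x (u x * eta x) + (-1) * \int[mu]_x (h x * eta x)).
    rewrite -(IntZ (-1) j3) -(IntD j2 (itgZ (-1) j3)) -(IntZ (-1) (itgD j2 (itgZ (-1) j3))).
    rewrite -(IntZ _ j1) -(IntD (itgZ _ j1) (itgZ (-1) (itgD j2 (itgZ (-1) j3)))).
    by apply: eq_Rintegral => x _; rewrite /k; ring.
  by lra.
move=> /(aeq_continuous ck (@cont_cst R 0)) kx x; have := kx x; rewrite /k; lra.
Qed.

(** Gronwall: g = u^2 + u'^2 satisfies |g'| <= (1 + L) g, so g times an exponential weight is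
    monotone on each side of x0. *)
Lemma ode_zero u (L : R) : C1 u -> C1 (derive1 u) -> 0 <= L ->
  (forall x, `|derive1 (derive1 u) x| <= L * `|u x|) ->
  forall x0, u x0 = 0 -> derive1 u x0 = 0 -> forall x, u x = 0.
Proof.
move=> Cu Cu' L0 hL x0 u0 u'0 x.
have [C2 e2] := C1M Cu Cu; have [C3 e3] := C1M Cu' Cu'.
have [Cg eg] := C1D C2 C3; pose g x := u x * u x + derive1 u x * derive1 u x.
have g0 y : 0 <= g y by rewrite addr_ge0// -expr2 sqr_ge0.
pose g' x := 2 * (u x * derive1 u x) + 2 * (derive1 u x * derive1 (derive1 u) x).
have dg : C1d g g'.
  have := C1_C1d Cg; rewrite eg e2 e3; congr C1d; apply/funext => y; rewrite /g'; ring.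
have bg y : `|g' y| <= (1 + L) * g y.
  have s1 : 2 * (`|u y| * `|derive1 u y|) <= g y.
    have := sqr_ge0 (`|u y| - `|derive1 u y|).
    by rewrite sqrrB !real_normK ?num_real// -mulr_natl /g; lra.
  apply: le_trans (ler_normD _ _) _; rewrite !normrM !(ger0_norm (ler0n _ _)).
  have := ler_wpM2l (normr_ge0 (derive1 u y)) (hL y).
  by have := ler_wpM2l L0 s1; lra.
have ex (c : R) : C1d (fun y : R => expR (c * y)) (fun y => expR (c * y) * c).
  apply: (C1_comp (F := expR) (F' := expR) (G := fun y => c * y) (G' := fun=> c)).
    by split; [move=> y; exact: is_derive_expR|exact: continuous_expR].
  split; last by move=> y; exact: cvg_cst.
  move=> y; apply: (@is_derive_quad _ _ _ _ 0) => k _.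
  rewrite mul0r (_ : _ - _ = 0) ?normr0//; ring.
have dG (c : R) : C1d (fun y => g y * expR (c * y)) (fun y => (g' y + c * g y) * expR (c * y)).
  have [h1 h2] := C1M (C1d_C1 dg) (C1d_C1 (ex c)).
  have := C1_C1d h1; rewrite h2 (C1dE dg) (C1dE (ex c)); congr C1d.
  by apply/funext => y; ring.
have gx0 : g x0 = 0 by rewrite /g u0 u'0 !mulr0 addr0.
suff gx : g x = 0.
  have h : u x ^+ 2 <= 0 by have := sqr_ge0 (derive1 u x); move: gx; rewrite /g; lra.
  by apply/eqP; rewrite -sqrf_eq0 eq_le h sqr_ge0.
have [xx|xx] := lerP x0 x.
- have [c [c1 c2 e]] := C1d_MVT x0 x (dG (- (1 + L))).
  have : g x * expR (- (1 + L) * x) <= 0.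
    move: e; rewrite gx0 mul0r subr0 => ->; rewrite mulr_le0_ge0 ?subr_ge0//.
    rewrite mulr_le0_ge0 ?expR_ge0//.
    by have := bg c; rewrite ler_norml => /andP[_ h]; lra.
  by rewrite pmulr_lle0 ?expR_gt0// => h; apply: le_anti; rewrite h g0.
- have [c [c1 c2 e]] := C1d_MVT x0 x (dG (1 + L)).
  have : g x * expR ((1 + L) * x) <= 0.
    move: e; rewrite gx0 mul0r subr0 => ->; rewrite mulr_ge0_le0 ?subr_le0 ?(ltW xx)//.
    rewrite mulr_ge0 ?expR_ge0//.
    by have := bg c; rewrite ler_norml => /andP[h _]; lra.
  by rewrite pmulr_lle0 ?expR_gt0// => h; apply: le_anti; rewrite h g0.
Qed.

(** A zero of a nonnegative function is a minimum, so the derivative vanishes there too and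
    uniqueness applies. *)
Lemma ode_positive u (L : R) : C1 u -> C1 (derive1 u) -> 0 <= L -> (forall x, 0 <= u x) ->
  (forall x, `|derive1 (derive1 u) x| <= L * `|u x|) ->
  (forall x, 0 < u x) \/ (forall x, u x = 0).
Proof.
move=> Cu Cu' L0 u0 hL; have [h|/existsNP[x hx]] := pselect (forall x, 0 < u x); first by left.
right; have ux : u x = 0 by apply: le_anti; rewrite u0 andbT leNgt; apply/negP.
apply: (ode_zero Cu Cu' L0 hL ux); rewrite derive1E.
have [] := @derive1_at_min R u (x - 1) (x + 1) x; rewrite ?derive1E//.
- by rewrite lerD2l; lra.
- by move=> t _; exact: Cu.1.
- by rewrite in_itv/=; apply/andP; split; lra.
- by move=> t _; rewrite ux.
Qed.

(* The Wronskian u v' - u' v is constant and integrable, hence zero, so v / u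
   is constant. *)
Lemma kernel_multiple u h (q : R -> R) v : C1 u -> C1 (derive1 u) -> (forall x, 0 < u x) ->
  L2 u -> L2 (derive1 u) -> continuous q ->
  (forall x, derive1 (derive1 u) x = 2 * (u x - h x)) -> (forall x, q x * u x = h x) ->
  H1 v -> weak_elliptic v (fun x => q x * v x) -> exists c, aeq v (fun x => c * u x).
Proof.
move=> Cu Cu' up Lu Lu' cq ode quh [Lv LDv wv] we.
have cu := C1_continuous Cu; have cu' := C1_continuous Cu'.
have lv := L2_loc Lv; have lDv := L2_loc LDv.
pose wr x := D v x * u x - derive1 u x * v x.
have iwr : itg wr.
  by apply: itgB; [exact: L2_mul|exact: L2_mul].
have lqv : loc (fun x => q x * v x).
  by have := locM lv cq; congr loc; apply/funext => x; rewrite mulrC.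
have wwr : weak_deriv wr (fun=> 0).
  split; [exact: itg_loc|exact/cont_loc/cont_cst|move=> eta te].
  have [Ce _] := iffLR (testP _) te; have [_ e1] := C1M Cu Ce; have [_ e2] := C1M Cu' Ce.
  (* The equation of v is tested against u times [eta], and the weak derivative of v against u'
     times [eta]; in the difference the potential terms cancel. *)
  have te1 := testM Cu te; have te2 := testM Cu' te.
  have a1 := we _ te1; have [_ _ w2] := wv; have a2 := w2 _ te2.
  have k1 := loc_test (locM lDv cu') te; have k2 := loc_testd (locM lDv cu) te.
  have k3 := loc_testd (locM lv cu') te; have k4 := loc_test (locM lv cu) te.
  have k5 := loc_test (locM lqv cu) te.
  pose I1 := \int[mu]_x (D v x * derive1 u x * eta x).
  pose I2 := \int[mu]_x (D v x * u x * derive1 eta x).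
  pose I3 := \int[mu]_x (v x * derive1 u x * derive1 eta x).
  pose I4 := \int[mu]_x (v x * u x * eta x).
  pose I5 := \int[mu]_x (q x * v x * u x * eta x).
  have -> : \int[mu]_x (wr x * derive1 eta x) = I2 - I3.
    by rewrite -(IntB k2 k3); apply: eq_Rintegral => x _; rewrite /wr; ring.
  have b1 : \int[mu]_x (D v x * derive1 (fun x => u x * eta x) x) = I1 + I2.
    by rewrite -(IntD k1 k2) e1; apply: eq_Rintegral => x _; ring.
  have b2 : \int[mu]_x (v x * (u x * eta x)) = I4.
    by apply: eq_Rintegral => x _; ring.
  have b3 : \int[mu]_x (q x * v x * (u x * eta x)) = I5.
    by apply: eq_Rintegral => x _; ring.
  have b4 : \int[mu]_x (v x * derive1 (fun x => derive1 u x * eta x) x) = 2 * (I4 - I5) + I3.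
    rewrite -(IntB k4 k5) -(IntZ 2 (itgB k4 k5)) -(IntD (itgZ 2 (itgB k4 k5)) k3) e2.
    by apply: eq_Rintegral => x _; rewrite ode -quh; ring.
  have b5 : \int[mu]_x (D v x * (derive1 u x * eta x)) = I1.
    by apply: eq_Rintegral => x _; ring.
  have -> : \int[mu]_x (0 * eta x) = 0.
    by rewrite -[RHS]Int0; apply: eq_Rintegral => x _; rewrite mul0r.
  have {}a1 := etrans (esym (congr2 (fun s t => 2^-1 * s + t) b1 b2)) (etrans a1 b3).
  have {}a2 := etrans (esym b4) (etrans a2 (congr1 -%R b5)).
  rewrite /= in a1.
  clear b1 b2 b3 b4 b5 k1 k2 k3 k4 k5; clearbody I1 I2 I3 I4 I5; lra.
have [c hc] := weak_deriv0_cst wwr.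
have c0 : c = 0 by apply: itg_cst0; apply: itg_ae hc _ iwr; exact: mbleC.
have un0 x : u x != 0 by rewrite gt_eqF.
have [CV eV] := C1V Cu un0.
have wq := weak_deriv_mul CV wv.
have [d hd] : exists d, aeq (fun x => (u x)^-1 * v x) (fun=> d).
  apply: weak_deriv0_cst; apply: weak_deriv_ae wq.
  - exact: ae_all.
  - apply: ae_mono hc => x; rewrite c0 /wr eV => k.
    have -> : - derive1 u x / u x ^+ 2 * v x + (u x)^-1 * D v x =
       (D v x * u x - derive1 u x * v x) / u x ^+ 2 by field.
    by rewrite k mul0r.
  - by apply: mbleM _ Lv.1; apply: mble_cont; exact: C1_continuous CV.
  - exact: mbleC.
exists d; apply: ae_mono hd => x <-.
by field.
Qed.

End Profile.

(** * Complex pairs as four real functions *)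

Section Components.
Context {R : realType}.
Local Notation I := (bool * bool)%type.
Local Notation mu := (@mu R).
Local Notation D := (@wderiv R).
Implicit Types (V : @pairC R) (U : I -> R -> R).

Definition comp V (j : bool) : R -> R[i] := if j then V.2 else V.1.
(** The linearised operator at a real state is real-linear but not complex-linear, hence the passage
    to real components. *)
Definition parts V : I -> R -> R :=
  fun i x => if i.2 then imC (comp V i.1 x) else reC (comp V i.1 x).
Definition of_parts U : @pairC R :=
  (fun x => U (false, false) x +i* U (false, true) x,
   fun x => U (true, false) x +i* U (true, true) x).

Lemma of_partsK U : parts (of_parts U) = U.
Proof. by apply/funext => -[[] []]. Qed.

Lemma H1xH1P V : H1xH1 V <-> HV (parts V).
Proof.
split=> [[[a b] [c d]] i|h].
  by apply: (iffLR (H1P _)); case: i => -[] []; [exact: d|exact: c|exact: b|exact: a].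
split; split.
- exact: (iffRL (H1P _) (h (false, false))).
- exact: (iffRL (H1P _) (h (false, true))).
- exact: (iffRL (H1P _) (h (true, false))).
- exact: (iffRL (H1P _) (h (true, true))).
Qed.

Lemma normcE (z : R[i]) : Normc.normc z = cabs (reC z) (imC z).
Proof. by case: z. Qed.

Lemma l2norm_sqr (f : R -> R[i]) : L2 (fun x => reC (f x)) -> L2 (fun x => imC (f x)) ->
  l2norm f ^+ 2 = ip (fun x => reC (f x)) (fun x => reC (f x)) + ip (fun x => imC (f x)) (fun x => imC (f x)).
Proof.
move=> h1 h2; rewrite sqr_sqrtr; last by apply: Int_ge0 => x; exact: sqr_ge0.
rewrite !ip_sqr -(IntD h1.2 h2.2); apply: eq_Rintegral => x _.
by rewrite normcE cabs_sqr.
Qed.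

Lemma L2norm_sqr V : (forall i, L2 (parts V i)) -> L2norm V ^+ 2 = vip (parts V) (parts V).
Proof.
move=> h; rewrite sqr_sqrtr ?addr_ge0 ?sqr_ge0//.
rewrite (l2norm_sqr (h (false, false)) (h (false, true))).
by rewrite (l2norm_sqr (h (true, false)) (h (true, true))) /vip sum4 !addrA.
Qed.

Lemma parts_dx V : parts (pair_dx V) = fun i => D (parts V i).
Proof. by apply/funext => -[[] []]. Qed.

Lemma L2norm_dx_sqr V : H1xH1 V -> L2norm (pair_dx V) ^+ 2 = vdip (parts V) (parts V).
Proof.
move=> /H1xH1P h; have h2 i : L2 (parts (pair_dx V) i) by rewrite parts_dx; exact: H1_DL2.
by rewrite (L2norm_sqr h2) parts_dx.
Qed.

Lemma H1norm_sqr V : H1xH1 V -> H1norm V ^+ 2 = vh1 (parts V) (parts V).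
Proof.
move=> hV; have h := iffLR (H1xH1P V) hV.
have h2 i : L2 (parts V i) by exact: H1_L2.
rewrite /H1norm sqr_sqrtr; last by rewrite addr_ge0 ?sqr_ge0.
by rewrite (L2norm_dx_sqr hV) (L2norm_sqr h2) vh1E addrC.
Qed.

Lemma H1norm_ge0 V : 0 <= H1norm V.
Proof. exact: sqrtr_ge0. Qed.

Lemma parts_sub V V' : parts (pair_sub V V') = vlin 1 (parts V) (-1) (parts V').
Proof.
apply/funext => i; apply/funext => x; rewrite /vlin /lin mul1r mulN1r /parts /comp.
by case: i => -[] [] /=; case: (_ x) => a b; case: (_ x).
Qed.

Lemma normcM (z z' : R[i]) : Normc.normc (z * z') = Normc.normc z * Normc.normc z'.
Proof. exact: Normc.normcM. Qed.

Variables p beta : R.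

Definition vdens U (x : R) := dens p beta (fun i => U i x).
Definition en U := 2^-1 * vdip U U - \int[mu]_x vdens U x.

Lemma dens_ge0 z : 0 <= p -> 0 <= beta -> 0 <= dens p beta z.
Proof.
by move=> p0 b0; rewrite /dens !(mulr_ge0, addr_ge0) ?invr_ge0 ?addr_ge0 ?powR_ge0.
Qed.

Lemma vdens_mble U : (forall i, mble (U i)) -> mble (vdens U).
Proof.
move=> h; have ma j : mble (fun x => amp (fun i => U i x) j).
  by apply: mble_sqrt; apply: mbleD; apply: mbleX.
apply: mbleM (mbleC _) _; apply: mbleD.
  by apply: mbleD; apply: mble_powR.
by apply: mbleM (mbleC _) _; apply: mble_powR; exact: mbleM.
Qed.

Lemma amp_le (z : I -> R) B j : 0 <= B -> (forall i, `|z i| <= B) -> amp z j <= 2 * B.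
Proof.
move=> B0 zB; rewrite -[leRHS]ger0_norm ?mulr_ge0// -sqrtr_sqr ler_wsqrtr//.
have sq i : z i ^+ 2 <= B ^+ 2 by rewrite -real_normK ?num_real// lerXn2r ?nnegrE.
have := sq (j, false); have := sq (j, true); have := sqr_ge0 B; lra.
Qed.

(** All terms have degree at least two; the surplus powers, and one square in the coupling term, are
    bounded by powers of 2 B. *)
Lemma dens_le B : 1 <= p -> 0 < beta -> 0 <= B -> exists2 K : R, 0 <= K &
  forall z : I -> R, (forall i, `|z i| <= B) -> dens p beta z <= K * \sum_i z i ^+ 2.
Proof.
move=> p1 b0 B0; have pp : 0 < p + 1 by lra.
pose N := (2 * B) `^ (2 * p) + 2 * beta * ((2 * B) `^ (p - 1)) ^+ 2 * (2 * B) ^+ 2.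
have N0 : 0 <= N by rewrite addr_ge0 ?mulr_ge0 ?powR_ge0 ?sqr_ge0// ltW.
exists N => // z zB.
pose a j := amp z j; have a0 j : 0 <= a j by exact: cabs_ge0.
have aB j : a j <= 2 * B by exact: amp_le.
have S : a false ^+ 2 + a true ^+ 2 = \sum_i z i ^+ 2.
  by rewrite !cabs_sqr sum4 addrA.
have e1 j : a j `^ (2 * p + 2) <= (2 * B) `^ (2 * p) * a j ^+ 2.
  rewrite powRD; last by apply/implyP => /eqP h; lra.
  rewrite (powR_mulrn 2 (a0 j)) ler_wpM2r ?sqr_ge0//.
  by apply: ge0_ler_powR; rewrite ?nnegrE//; lra.
have e2 j : a j `^ (p + 1) <= (2 * B) `^ (p - 1) * a j ^+ 2.
  rewrite (_ : p + 1 = p - 1 + 2); last by ring.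
  rewrite powRD; last by apply/implyP => /eqP h; lra.
  rewrite (powR_mulrn 2 (a0 j)) ler_wpM2r ?sqr_ge0//.
  by apply: ge0_ler_powR; rewrite ?nnegrE//; lra.
have e3 : (a false * a true) `^ (p + 1) <= ((2 * B) `^ (p - 1)) ^+ 2 * (2 * B) ^+ 2 * a true ^+ 2.
  rewrite powRM//; apply: le_trans (ler_pM (powR_ge0 _ _) (powR_ge0 _ _) (e2 false) (e2 true)) _.
  have sq : a false ^+ 2 <= (2 * B) ^+ 2 by rewrite lerXn2r ?nnegrE ?mulr_ge0.
  have := ler_wpM2r (sqr_ge0 (a true)) (ler_wpM2l (sqr_ge0 ((2 * B) `^ (p - 1))) sq).
  by rewrite /= !expr2; lra.
rewrite /dens ler_pdivrMl// -S.
have b2 : 0 <= 2 * beta by rewrite mulr_ge0// ltW.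
have := ler_wpM2l b2 e3; have := e1 false; have := e1 true.
rewrite -/(a false) -/(a true) => k1 k2 k3.
have n0 : 0 <= 2 * beta * ((2 * B) `^ (p - 1)) ^+ 2 * (2 * B) ^+ 2.
  exact: mulr_ge0 (mulr_ge0 b2 (sqr_ge0 _)) (sqr_ge0 _).
have k4 := mulr_ge0 n0 (sqr_ge0 (a false)).
have q0 : 0 <= N * (a false ^+ 2 + a true ^+ 2) by rewrite mulr_ge0// addr_ge0 ?sqr_ge0.
have : (p + 1) * (N * (a false ^+ 2 + a true ^+ 2)) >= N * (a false ^+ 2 + a true ^+ 2).
  by rewrite ler_peMl//; lra.
apply: le_trans; rewrite /N; lra.
Qed.

Lemma HV_rep U : HV U -> exists2 F : I -> R -> R, HV F /\ (forall i, aeq (U i) (F i)) &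
  forall i x, F i x ^+ 2 <= 2 * vh1 U U.
Proof.
move=> hU; have rep i : exists F : R -> R, [/\ continuous F, aeq (U i) F &
    forall x, F x ^+ 2 <= 2 * vh1 U U].
  have [F [c e _ b]] := H1_rep (hU i); exists F; split=> // x.
  apply: le_trans (b x) _; rewrite ler_wpM2l// /vh1 (bigD1 i)//= lerDl.
  by apply: sumr_ge0 => j _; exact: h1_ge0.
pose F i := sval (cid (rep i)).
have FP i : [/\ continuous (F i), aeq (U i) (F i) & forall x, F i x ^+ 2 <= 2 * vh1 U U].
  exact: svalP (cid (rep i)).
exists F; last by move=> i x; case: (FP i).
split=> i; last by case: (FP i).
by have [c e _] := FP i; case: (H1_ae e (mble_cont c) (hU i)).
Qed.

(** The continuous representatives are bounded, so the density is dominated by a multiple of the sum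
    of squares. *)
Lemma vdens_itg U : 1 <= p -> 0 < beta -> HV U -> itg (vdens U).
Proof.
move=> p1 b0 hU; have [F [hF UF] bF] := HV_rep hU.
have v0 : 0 <= 2 * vh1 U U by rewrite mulr_ge0 ?vh1_ge0.
have mUi i := (H1_L2 (hU i)).1; have mFi i := (H1_L2 (hF i)).1.
have e : aeq (vdens F) (vdens U).
  have := ae_and (ae_and (UF (false, false)) (UF (false, true))) (ae_and (UF (true, false)) (UF (true, true))).
  apply: ae_mono => x [[h1 h2] [h3 h4]]; rewrite /vdens; congr dens.
  by apply/funext => -[[] []]; rewrite ?h1 ?h2 ?h3 ?h4.
apply: itg_ae e (vdens_mble mUi) _.
have [K K0 hK] := dens_le p1 b0 (sqrtr_ge0 (2 * vh1 U U)).
apply: itg_le (vdens_mble mFi) (itgZ K (itg_sum (index_enum I) (fun i => (H1_L2 (hF i)).2))) _.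
move=> x; rewrite ger0_norm; last by apply: dens_ge0; [lra|exact: ltW].
apply: le_trans (ler_norm _); apply: hK => i.
by rewrite -sqrtr_sqr ler_wsqrtr.
Qed.

Lemma energyE V : 1 <= p -> 0 < beta -> H1xH1 V -> energy p beta V = en (parts V).
Proof.
move=> p1 b0 hV; rewrite /energy L2norm_dx_sqr// /en; congr (_ - _).
have pn0 : p + 1 != 0 by rewrite gt_eqF//; lra.
have iv := vdens_itg p1 b0 (iffLR (H1xH1P V) hV).
transitivity ((p + 1)^-1 * ((p + 1) * \int[mu]_x vdens (parts V) x)); last by rewrite mulKf.
congr (_ * _); rewrite -(IntZ (p + 1) iv); apply: eq_Rintegral => x _.
by rewrite /vdens /dens mulVKf// normcM !normcE.
Qed.

End Components.

(** * Scalings, translations and phase rotations *)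

Section Symmetries.
Context {R : realType}.
Local Notation I := (bool * bool)%type.
Local Notation mu := (@mu R).
Local Notation D := (@wderiv R).
Implicit Types (f g eta : R -> R) (U : I -> R -> R).

Lemma C1d_affine (b a : R) : C1d (fun x : R => b * x + a) (fun=> b).
Proof.
split; last by move=> x; exact: cvg_cst.
move=> x; apply: (@is_derive_quad _ _ _ _ 0) => k _.
rewrite mul0r (_ : _ - _ = 0) ?normr0//; ring.
Qed.

Lemma test_affine eta (a b : R) : 0 < b -> test_function eta ->
  test_function (fun y => eta (b^-1 * y + a)).
Proof.
move=> b0 /testP[Ce [A A0 hA]]; apply/testP.
have h := C1_comp (C1_C1d Ce) (C1d_affine b^-1 a).
split; first exact: C1d_C1 h.
exists (b * (A + `|a|)) => [|y hy]; first by rewrite mulr_gt0// ltr_wpDr.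
apply: hA; have h1 : b * (A + `|a|) < b * `|b^-1 * y| .
  by rewrite normrM (gtr0_norm (x := b^-1)) ?invr_gt0// mulrA divff ?mul1r// gt_eqF.
rewrite ltr_pM2l// in h1; have := lerB_normD (b^-1 * y) a; lra.
Qed.

Lemma loc_affine f (a b : R) : 0 < b -> loc f -> loc (fun x => f (b * x + a)).
Proof.
move=> b0 lf; have mf : mble f by case: lf.
apply: locP; first exact: mble_affine.
move=> A; pose B := b * `|A| + `|a|.
have i := itg_affine a b0 (loc_itg_itv B lf).
apply: itg_le i _.
  by apply: mbleM; [exact: mble_affine|apply: mble_indic; exact: measurable_itv].
move=> x; rewrite !normrM ler_wpM2l// !indicE.
have [hx|//] := boolP (x \in _); rewrite ?normr0//.
move: hx; rewrite inE/= in_itv/= -ler_norml => hx.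
rewrite [_ \in _]mem_set//= in_itv/= -ler_norml.
apply: le_trans (ler_normD _ _) _; rewrite lerD2r normrM (gtr0_norm b0) ler_pM2l//.
exact: le_trans hx (ler_norm _).
Qed.

Lemma weak_deriv_affine f g (a b : R) : 0 < b -> weak_deriv f g ->
  weak_deriv (fun x => f (b * x + a)) (fun x => b * g (b * x + a)).
Proof.
move=> b0 [lf lg w]; have bn : b != 0 by rewrite gt_eqF.
split; [exact: loc_affine|exact: locZ (loc_affine _ b0 lg)|move=> eta te].
pose zeta y := eta (b^-1 * y + - (b^-1 * a)).
have tz : test_function zeta by exact: test_affine.
have [Ce _] := iffLR (testP _) te.
have ze x : zeta (b * x + a) = eta x.
  by rewrite /zeta; congr eta; field.
have dz : derive1 zeta = fun y => derive1 eta (b^-1 * y + - (b^-1 * a)) * b^-1.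
  exact: C1dE (C1_comp (C1_C1d Ce) (C1d_affine b^-1 _)).
have dze x : b * derive1 zeta (b * x + a) = derive1 eta x.
  by rewrite dz mulrCA divff// mulr1; congr (derive1 eta); field.
have k1 := loc_testd lf tz; have k2 := loc_test lg tz.
have e1 : \int[mu]_x (f (b * x + a) * derive1 eta x) = \int[mu]_x (f x * derive1 zeta x).
  have := Int_affine a b0 k1; have k3 := itg_affine a b0 k1 => e.
  rewrite -[RHS](mulVKf bn) -e -(IntZ b k3); apply: eq_Rintegral => x _.
  by rewrite -dze mulrCA.
have e2 : \int[mu]_x (b * g (b * x + a) * eta x) = \int[mu]_x (g x * zeta x).
  have := Int_affine a b0 k2; have k3 := itg_affine a b0 k2 => e.
  rewrite -[RHS](mulVKf bn) -e -(IntZ b k3); apply: eq_Rintegral => x _.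
  by rewrite ze mulrA.
by rewrite e1 e2; exact: w.
Qed.

Lemma ip_affine f g (a b : R) : 0 < b -> L2 f -> L2 g ->
  ip (fun x => f (b * x + a)) (fun x => g (b * x + a)) = b^-1 * ip f g.
Proof. by move=> b0 hf hg; rewrite !ipE; exact: (Int_affine a b0 (L2_mul hf hg)). Qed.

Lemma H1_affine f (a b : R) : 0 < b -> H1 f -> H1 (fun x => f (b * x + a)) /\
  aeq (D (fun x => f (b * x + a))) (fun x => b * D f (b * x + a)).
Proof.
move=> b0 [Lf LD w]; apply: H1I; [exact: L2_affine|exact: (L2Z b (L2_affine a b0 LD))|].
exact: weak_deriv_affine.
Qed.

Lemma ipZZ f (c : R) : L2 f -> ip (fun x => c * f x) (fun x => c * f x) = c ^+ 2 * ip f f.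
Proof.
move=> hf; rewrite !ip_sqr -(IntZ _ hf.2); apply: eq_Rintegral => x _.
by rewrite exprMn.
Qed.

Lemma dip_affine f (a b : R) : 0 < b -> H1 f ->
  dip (fun x => f (b * x + a)) (fun x => f (b * x + a)) = b * dip f f.
Proof.
move=> b0 hf; have [h1 h2] := H1_affine a b0 hf; have LD := H1_DL2 hf.
have l1 := L2_affine a b0 LD.
rewrite /dip (ip_ae h2 h2 (H1_DL2 h1) (L2Z b l1) (H1_DL2 h1) (L2Z b l1)).
by rewrite (ipZZ b l1) (ip_affine a b0 LD LD) mulrA expr2 mulfK ?gt_eqF.
Qed.

(** Covers the translations, with c = b = 1, and the mass-energy scaling, with b = c^p. *)
Definition vaff c b a U : I -> R -> R := fun i x => c * U i (b * x + a).

Lemma vaff_HV c b a U : 0 < b -> HV U -> HV (vaff c b a U).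
Proof. by move=> b0 h i; have [h1 _] := H1_affine a b0 (h i); case: (H1_Z c h1). Qed.

Lemma vaff_vip c b a U : 0 < b -> HV U ->
  vip (vaff c b a U) (vaff c b a U) = c ^+ 2 / b * vip U U.
Proof.
move=> b0 h; rewrite /vip mulr_sumr; apply: eq_bigr => i _.
have l := H1_L2 (h i); rewrite (ipZZ c (L2_affine a b0 l)).
by rewrite (ip_affine a b0 l l) mulrA.
Qed.

Lemma vaff_vdip c b a U : 0 < b -> HV U ->
  vdip (vaff c b a U) (vaff c b a U) = c ^+ 2 * b * vdip U U.
Proof.
move=> b0 h; rewrite /vdip mulr_sumr; apply: eq_bigr => i _.
have [h1 h2] := H1_affine a b0 (h i); have [h3 h4] := H1_Z c h1.
rewrite -mulrA -(dip_affine a b0 (h i)) -(ipZZ c (H1_DL2 h1)).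
by apply: ip_ae => //; do ?[exact: H1_DL2|apply: L2Z].
Qed.

Definition turn (th : bool -> R) U : I -> R -> R := fun i =>
  if i.2 then lin (sin (th i.1)) (U (i.1, false)) (cos (th i.1)) (U (i.1, true))
  else lin (cos (th i.1)) (U (i.1, false)) (- sin (th i.1)) (U (i.1, true)).

Lemma turn_HV th U : HV U -> HV (turn th U).
Proof. by move=> h [j []]; rewrite /turn/=; [case: (H1_lin (sin (th j)) (cos (th j)) (h (j, false)) (h (j, true)))|case: (H1_lin (cos (th j)) (- sin (th j)) (h (j, false)) (h (j, true)))]. Qed.

Lemma ip_lin_sqr a f b g : L2 f -> L2 g ->
  ip (lin a f b g) (lin a f b g) = a ^+ 2 * ip f f + 2 * a * b * ip f g + b ^+ 2 * ip g g.
Proof.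
move=> hf hg; have hl := L2_lin a b hf hg.
rewrite (ip_linl a b hf hg hl) (ipC f) (ipC g (lin _ _ _ _)).
by rewrite (ip_linl a b hf hg hf) (ip_linl a b hf hg hg) (ipC g f); ring.
Qed.

Lemma turn_vip th U : (forall i, L2 (U i)) -> vip (turn th U) (turn th U) = vip U U.
Proof.
move=> h; rewrite /vip !sum4 /turn/=.
have key j : ip (lin (cos (th j)) (U (j, false)) (- sin (th j)) (U (j, true)))
    (lin (cos (th j)) (U (j, false)) (- sin (th j)) (U (j, true))) +
  ip (lin (sin (th j)) (U (j, false)) (cos (th j)) (U (j, true)))
    (lin (sin (th j)) (U (j, false)) (cos (th j)) (U (j, true))) =
  ip (U (j, false)) (U (j, false)) + ip (U (j, true)) (U (j, true)).
  rewrite !(ip_lin_sqr _ _ (h (j, false)) (h (j, true))).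
  have := cos2Dsin2 (th j); set c := cos _; set s := sin _ => e.
  set x := ip _ _; set y := ip _ _; set z := ip _ _.
  transitivity ((c ^+ 2 + s ^+ 2) * (x + z)); first by ring.
  by rewrite e mul1r.
by rewrite -addrA key key !addrA.
Qed.

Lemma turn_vdip th U : HV U -> vdip (turn th U) (turn th U) = vdip U U.
Proof.
move=> h; have e := turn_vip th (U := fun i => D (U i)) (fun i => H1_DL2 (h i)).
rewrite -[RHS]/(vip (fun i => D (U i)) (fun i => D (U i))) -e; apply: eq_bigr => -[j b] _.
have h0 := h (j, false); have h1 := h (j, true).
have k1 := dip_lin_sqr (sin (th j)) (cos (th j)) h0 h1.
have k2 := dip_lin_sqr (cos (th j)) (- sin (th j)) h0 h1.
by case: b; [exact: k1|exact: k2].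
Qed.

(** The group of the orbit; the sign makes the first parameter the position of the centre, as in r(x
    - y). *)
Definition act (y : R) th U := turn th (vaff 1 1 (- y) U).

Lemma act_HV y th U : HV U -> HV (act y th U).
Proof. by move=> h; apply: turn_HV; exact: vaff_HV. Qed.

Lemma act_vip y th U : HV U -> vip (act y th U) (act y th U) = vip U U.
Proof.
move=> h; have h2 := vaff_HV 1 (- y) (ltr01 : 0 < 1 :> R) h.
rewrite turn_vip => [|i]; last exact: H1_L2.
by rewrite vaff_vip// expr1n divr1 mul1r.
Qed.

Lemma act_vdip y th U : HV U -> vdip (act y th U) (act y th U) = vdip U U.
Proof.
move=> h; have h2 := vaff_HV 1 (- y) (ltr01 : 0 < 1 :> R) h.
by rewrite turn_vdip// vaff_vdip// expr1n mulr1 mul1r.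
Qed.

Lemma act_vh1 y th U : HV U -> vh1 (act y th U) (act y th U) = vh1 U U.
Proof. by move=> h; rewrite !vh1E act_vip// act_vdip. Qed.

Lemma act_vlin y th a U b V : act y th (vlin a U b V) = vlin a (act y th U) b (act y th V).
Proof.
apply/funext => -[j []]; apply/funext => x; rewrite /act /turn /vaff /vlin /lin/=; ring.
Qed.

Lemma actD y th y' th' U :
  act y th (act y' th' U) = act (y + y') (fun j => th j + th' j) U.
Proof.
apply/funext => -[j []]; apply/funext => x; rewrite /act /turn /vaff /lin/= cosD sinD !mul1r opprD addrA; ring.
Qed.

Lemma act0 U : act 0 (fun=> 0) U = U.
Proof.
apply/funext => -[j []]; apply/funext => x; rewrite /act /turn /vaff /lin/= cos0 sin0 oppr0 !mul1r addr0; ring.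
Qed.

Variables p beta : R.
Hypotheses (p1 : 1 <= p) (b0 : 0 < beta).
Local Notation vdens := (vdens p beta).
Local Notation en := (en p beta).

Lemma amp_scale (c : R) (z : I -> R) j : 0 <= c -> amp (fun i => c * z i) j = c * amp z j.
Proof.
move=> c0; rewrite /amp /cabs !exprMn -mulrDr sqrtrM ?sqr_ge0//.
by rewrite sqrtr_sqr ger0_norm.
Qed.

Lemma vaff_en c b a U : 0 < c -> 0 < b -> HV U ->
  en (vaff c b a U) = c ^+ 2 * b * (2^-1 * vdip U U) - c `^ (2 * p + 2) / b * \int[mu]_x vdens U x.
Proof.
move=> c0 bp hU; rewrite /en vaff_vdip// mulrCA; congr (_ - _).
have i := vdens_itg p1 b0 hU; have i2 := itg_affine a bp i.
have -> : \int[mu]_x vdens (vaff c b a U) x = \int[mu]_x (c `^ (2 * p + 2) * vdens U (b * x + a)).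
  apply: eq_Rintegral => x _; rewrite /vdens /vaff /dens.
  rewrite !(amp_scale _ _ (ltW c0)).
  set z := (fun i => U i _).
  have := cabs_ge0 (z (false, false)) (z (false, true)); rewrite -/(amp z false).
  have := cabs_ge0 (z (true, false)) (z (true, true)); rewrite -/(amp z true).
  move: (amp z false) (amp z true) => s t t0 s0; have c0' := ltW c0.
  rewrite (powRM _ c0' s0) (powRM _ c0' t0) (powRM _ (mulr_ge0 c0' s0) (mulr_ge0 c0' t0)).
  rewrite (powRM _ c0' s0) (powRM _ c0' t0) (powRM _ s0 t0).
  have -> : c `^ (2 * p + 2) = c `^ (p + 1) * c `^ (p + 1).
    rewrite -powRD; first by congr (_ `^ _); ring.
    by apply/implyP => _; rewrite gt_eqF.
  by ring.
by rewrite (IntZ _ i2) (Int_affine a bp i) mulrA.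
Qed.

Lemma turn_vdens th U x : vdens (turn th U) x = vdens U x.
Proof.
have e j : amp (fun i => turn th U i x) j = amp (fun i => U i x) j.
  rewrite /amp /cabs /turn /lin/=; congr Num.sqrt.
  have := cos2Dsin2 (th j); set c := cos _; set s := sin _ => k.
  set u := U _ _; set v := U _ _.
  transitivity ((c ^+ 2 + s ^+ 2) * (u ^+ 2 + v ^+ 2)); first by ring.
  by rewrite k mul1r.
by rewrite /vdens /dens !e.
Qed.

Lemma turn_en th U : HV U -> en (turn th U) = en U.
Proof.
move=> h; rewrite /en (turn_vdip th h).
have -> : vdens (turn th U) = vdens U by apply/funext => x; exact: turn_vdens.
by [].
Qed.

Lemma act_en y th U : HV U -> en (act y th U) = en U.
Proof.
move=> h; have h2 := vaff_HV 1 (- y) (ltr01 : 0 < 1 :> R) h.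
rewrite /act (turn_en th h2) (vaff_en (- y) ltr01 ltr01 h).
by rewrite expr1n powR1 divr1 !mul1r.
Qed.

End Symmetries.

(** * Bounds on the profile and first variation of the action *)

Section Action.
Context {R : realType}.
Local Notation I := (bool * bool)%type.
Local Notation mu := (@mu R).
Local Notation D := (@wderiv R).
Implicit Types (U V w : I -> R -> R).
Variables (p beta : R) (u : bool -> R -> R).
Hypotheses (p1 : 1 <= p) (beta0 : 0 < beta).
Hypotheses (Cu : forall j, C1 (u j)) (Cu' : forall j, C1 (derive1 (u j))).
Hypotheses (u0 : forall j x, 0 <= u j x) (decay_u : forall j, edecay (u j)).
Hypothesis ode : forall j x,
  derive1 (derive1 (u j)) x = 2 * (u j x - nlin p beta (u j x) (u (~~ j) x)).
Local Notation en := (en p beta).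

Definition real_state : I -> R -> R := fun i x => if i.2 then 0 else u i.1 x.
Definition Wm (i j : I) (x : R) := wmat p beta (fun k => u k x) i j.
Local Notation Rv := real_state.

Lemma Int_le_ae (f g : R -> R) : {ae mu, forall x, f x <= g x} -> itg f -> itg g ->
  \int[mu]_x f x <= \int[mu]_x g x.
Proof.
move=> fg hf hg; pose m x := Num.max (f x) (g x).
have mm : mble m by apply: measurable_maxr; exact: itg_mble.
have e : aeq g m by apply: ae_mono fg => x h; rewrite /m max_r.
rewrite (Int_ae e (itg_mble hg) mm); apply: Int_le => //; first exact: itg_ae e mm hg.
by move=> x; rewrite /m le_max lexx.
Qed.

Lemma profile_bdd : exists2 A : R, 0 <= A & forall j x, u j x <= A.
Proof.
have [A A0 hA] := edecay_bdd (decay_u false); have [B B0 hB] := edecay_bdd (decay_u true).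
exists (A + B) => [|j x]; first exact: addr_ge0.
apply: le_trans (ler_norm _) _; case: j.
  by apply: le_trans (hB x) _; rewrite lerDr.
by apply: le_trans (hA x) _; rewrite lerDl.
Qed.

Lemma powR_split (A x a b : R) : 0 <= x <= A -> 0 < a -> 0 <= b ->
  0 <= x `^ (a + b) <= A `^ b * x `^ a.
Proof.
move=> /andP[x0 xA] a0 b0; rewrite powR_ge0/= powRD; last by apply/implyP => /eqP h; lra.
by rewrite mulrC ler_wpM2r ?powR_ge0//; apply: ge0_ler_powR; rewrite ?nnegrE// (le_trans x0).
Qed.

Lemma powR_le (A x b : R) : 0 <= x <= A -> 0 <= b -> 0 <= x `^ b <= A `^ b.
Proof.
move=> /andP[x0 xA] b0; rewrite powR_ge0/=.
by apply: ge0_ler_powR; rewrite ?nnegrE// (le_trans x0).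
Qed.

(** Since p >= 1, each term contains a full power of its own component. This gives the
    Lipschitz-type bound for the uniqueness argument and the decay of the second derivative. *)
Lemma nlin_le : exists2 K : R, 0 <= K & forall j x, `|nlin p beta (u j x) (u (~~ j) x)| <= K * `|u j x|.
Proof.
have [A A0 hA] := profile_bdd; have q1 := p1; have b0 := ltW beta0.
exists (A `^ (2 * p) + beta * A `^ (p - 1) * A `^ (p + 1)).
  by rewrite addr_ge0 ?mulr_ge0 ?powR_ge0.
move=> j x; have ux : 0 <= u j x <= A by rewrite u0 hA.
have uy : 0 <= u (~~ j) x <= A by rewrite u0 hA.
have u00 := u0 j x; rewrite (ger0_norm u00).
have q2 : 0 <= 2 * p by lra.
have q3 : 0 <= p - 1 by lra.
have q4 : 0 <= p + 1 by lra.
have /andP[a1 a2] := powR_split ux ltr01 q2; have /andP[c1 c2] := powR_split ux ltr01 q3.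
have /andP[d1 d2] := powR_le uy q4.
rewrite powRr1// in a2 c2; rewrite (addrC 1) subrK in c1 c2; rewrite (addrC 1) in a1 a2.
rewrite /nlin ger0_norm; last by rewrite addr_ge0 ?mulr_ge0.
rewrite [leRHS]mulrDl; apply: lerD a2 _; rewrite -mulrA.
apply: le_trans (ler_wpM2l b0 (ler_pM c1 d1 c2 d2)) _.
by rewrite le_eqVlt; apply/orP; left; apply/eqP; ring.
Qed.

(** A factor decays in every entry, so the potential vanishes at infinity. In the coupling term of
    the diagonal entries decay is taken from y^(p+1), as x^(p-1) is constant for p = 1. *)
Lemma wmat_le : exists2 K : R, 0 <= K & forall i j x, `|Wm i j x| <= K * (u false x + u true x).
Proof.
have [A A0 hA] := profile_bdd; have q1 := p1; have b0 := beta0.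
have q2 : 0 <= 2 * p - 1 by lra.
have q3 : 0 <= p - 1 by lra.
have q5 : 0 <= p by lra.
have [q6 q7] : 0 <= 2 * p + 1 /\ 0 <= beta * (p + 1) by split; [|apply: mulr_ge0]; lra.
pose K := (2 * p + 1) * A `^ (2 * p - 1) + beta * (p + 1) * A `^ (p - 1) * A `^ p.
have K1 : 0 <= (2 * p + 1) * A `^ (2 * p - 1) by rewrite mulr_ge0 ?powR_ge0//; lra.
have K2 : 0 <= beta * (p + 1) * A `^ (p - 1) * A `^ p.
  by rewrite !mulr_ge0 ?powR_ge0//; lra.
have K0 : 0 <= K by exact: addr_ge0.
exists K => // i j x.
have key k : [/\ 0 <= u k x ^+ 1, 0 <= u k x `^ (2 * p) <= A `^ (2 * p - 1) * u k x,
   0 <= u k x `^ (p - 1) <= A `^ (p - 1), 0 <= u k x `^ (p + 1) <= A `^ p * u k x &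
   0 <= u k x `^ p <= A `^ (p - 1) * u k x /\ 0 <= u k x `^ p <= A `^ p].
  have ux : 0 <= u k x <= A by rewrite u0 hA.
  have uk := u0 k x.
  have h1 := powR_split ux ltr01 q2; have h2 := powR_le ux q3.
  have h3 := powR_split ux ltr01 q5; have h4 := powR_split ux ltr01 q3; have h5 := powR_le ux q5.
  rewrite powRr1// in h1 h3 h4; rewrite (addrC 1) subrK in h1; rewrite (addrC 1) in h3.
  by rewrite (addrC 1) subrK in h4.
have S0 : 0 <= u false x + u true x by rewrite addr_ge0.
have us k : u k x <= u false x + u true x by case: k; rewrite ?lerDl ?lerDr.
have wle k : `|(if i.2 then wim p beta else wre p beta) (u k x) (u (~~ k) x)| <= K * (u false x + u true x).
  have [_ /andP[a1 a2] /andP[c1 c2] _ _] := key k; have [_ _ _ /andP[d1 d2] _] := key (~~ k).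
  have e1 := ler_pM c1 d1 c2 d2.
  have e2 := ler_wpM2l (mulr_ge0 (powR_ge0 A (p - 1)) (powR_ge0 A p)) (us (~~ k)).
  have e3 := ler_wpM2l (powR_ge0 A (2 * p - 1)) (us k).
  have m0 := mulr_ge0 c1 d1.
  have e4 : u k x `^ (p - 1) * u (~~ k) x `^ (p + 1) <= A `^ (p - 1) * A `^ p * (u false x + u true x) by lra.
  have e5 : u k x `^ (2 * p) <= A `^ (2 * p - 1) * (u false x + u true x) by lra.
  have f1 : wre p beta (u k x) (u (~~ k) x) <= K * (u false x + u true x).
    rewrite /wre /K -!mulrA [leRHS]mulrDl.
    have g1 := ler_wpM2l q6 e5; have g2 := ler_wpM2l q7 e4.
    have g3 : beta * p * (u k x `^ (p - 1) * u (~~ k) x `^ (p + 1)) <= beta * (p + 1) * (u k x `^ (p - 1) * u (~~ k) x `^ (p + 1)).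
      by rewrite ler_wpM2r// ler_wpM2l ?(ltW b0)//; lra.
    by clear e1 e2 e3 e4 e5; lra.
  have f2 : 0 <= wim p beta (u k x) (u (~~ k) x).
    by rewrite /wim addr_ge0// !mulr_ge0// ltW.
  have f3 : wim p beta (u k x) (u (~~ k) x) <= wre p beta (u k x) (u (~~ k) x).
    rewrite /wim /wre -!mulrA; apply: lerD; first by rewrite ler_peMl//; lra.
    by rewrite ler_wpM2l ?(ltW b0)// ler_peMl//.
  by case: (i.2); rewrite ger0_norm//; [exact: le_trans f3 f1|exact: le_trans f2 f3].
rewrite /Wm /wmat; case: ifP => _.
  by case: ifP => _; [exact: wle|rewrite normr0 mulr_ge0].
case: ifP => _; first by rewrite normr0 mulr_ge0.
have [_ _ _ _ [/andP[a1 a2] _]] := key false; have [_ _ _ _ [_ /andP[d1 d2]]] := key true.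
rewrite /wmix -mulrA ger0_norm; last exact: (mulr_ge0 q7 (mulr_ge0 a1 d1)).
have e1 := ler_wpM2l q7 (ler_pM a1 d1 a2 d2).
have e2 := ler_wpM2l (mulr_ge0 q7 (mulr_ge0 (powR_ge0 A (p - 1)) (powR_ge0 A p))) (us false).
have e3 := mulr_ge0 K1 S0.
rewrite /K [leRHS]mulrDl; lra.
Qed.

Lemma mble_profile j : mble (u j). Proof. exact: mble_cont (C1_continuous (Cu j)). Qed.

Lemma Wm_mble i j : mble (Wm i j).
Proof.
have pw k a : mble (fun x => u k x `^ a) by exact: mble_powR (mble_profile k).
have w1 k : mble (fun x => wre p beta (u k x) (u (~~ k) x)).
  apply: mbleD; first by apply: mbleM (mbleC _) _.
  by apply: mbleM; first by apply: mbleM (mbleC _) _.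
have w2 k : mble (fun x => wim p beta (u k x) (u (~~ k) x)).
  apply: mbleD => //.
  by apply: mbleM; first by apply: mbleM (mbleC _) _.
have w3 : mble (fun x => wmix p beta (u false x) (u true x)).
  by apply: mbleM; first by apply: mbleM (mbleC _) _.
by case: i j => -[] [] [[] []]; first
  [exact: mbleC|exact: w3|exact: (w1 false)|exact: (w1 true)|exact: (w2 false)|exact: (w2 true)].
Qed.

Lemma Wm_sym i j : Wm i j = Wm j i.
Proof. by apply/funext => x; case: i j => -[] [] [[] []]. Qed.

Lemma Wm_bdd : exists C0 : R, forall i j x, `|Wm i j x| <= C0.
Proof.
have [K K0 hK] := wmat_le; have [A A0 hA] := profile_bdd.
exists (K * (A + A)) => i j x; apply: le_trans (hK i j x) _.
by rewrite ler_wpM2l// lerD.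
Qed.

Lemma Wm_decay (e : R) : 0 < e -> exists2 A : R, 0 < A &
  forall i j x, A < `|x| -> `|Wm i j x| <= e.
Proof.
move=> e0; have [K K0 hK] := wmat_le.
have e1 : 0 < e / (K + 1) by rewrite divr_gt0// ltr_wpDl.
have [A A0 hA] := edecay_small (edecayD (decay_u false) (decay_u true)) e1.
exists A => // i j x /hA; rewrite ger0_norm ?addr_ge0// => h.
apply: le_trans (hK i j x) _; apply: le_trans (ler_wpM2l K0 h) _.
by rewrite mulrA ler_pdivrMr ?ltr_wpDl//; lra.
Qed.

Lemma decay_u2 j : edecay (derive1 (derive1 (u j))).
Proof.
have [K K0 hK] := nlin_le; apply: (edecay_le (K := 2 * (1 + K)) (decay_u j)) => x.
rewrite ode normrM ger0_norm// -mulrA ler_wpM2l//.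
by apply: le_trans (ler_normB _ _) _; rewrite mulrDl mul1r lerD2l.
Qed.

Lemma decay_u1 j : edecay (derive1 (u j)).
Proof. exact: edecay_derive (Cu j) (Cu' j) (decay_u j) (decay_u2 j). Qed.

Lemma L2_u j : L2 (u j). Proof. exact: edecay_L2 (mble_profile j) (decay_u j). Qed.
Lemma L2_u1 j : L2 (derive1 (u j)).
Proof. exact: edecay_L2 (mble_cont (Cu j).2) (decay_u1 j). Qed.
Lemma L2_u2 j : L2 (derive1 (derive1 (u j))).
Proof. exact: edecay_L2 (mble_cont (Cu' j).2) (decay_u2 j). Qed.

Lemma H1_u j : H1 (u j) /\ aeq (D (u j)) (derive1 (u j)).
Proof. exact: C1_H1 (Cu j) (L2_u j) (L2_u1 j). Qed.
Lemma H1_u1 j : H1 (derive1 (u j)) /\ aeq (D (derive1 (u j))) (derive1 (derive1 (u j))).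
Proof. exact: C1_H1 (Cu' j) (L2_u1 j) (L2_u2 j). Qed.

Lemma HV_Rv : HV Rv.
Proof. by case=> j []; [exact: H1_0|exact: (H1_u j).1]. Qed.

Lemma L2_nlin j : L2 (fun x => nlin p beta (u j x) (u (~~ j) x)).
Proof.
have [K K0 hK] := nlin_le; apply: (L2_le _ (L2Z K (L2_u j))).
  have pw k a : mble (fun x => u k x `^ a) by exact: mble_powR (mble_profile k).
  by apply: mbleD => //; apply: mbleM => //; apply: mbleM (mbleC _) _.
by move=> x; rewrite normrM (ger0_norm K0).
Qed.

Definition vaction U := en U + vip U U.
Definition hess w := 2^-1 * vdip w w + vip w w - pot Wm w w.

Lemma ip0l (f : R -> R) : ip (fun=> 0) f = 0.
Proof. by rewrite ipE -[RHS]Int0; apply: eq_Rintegral => x _; rewrite mul0r. Qed.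

(* First variation of the action: integrate by parts and use the equation. *)
Lemma euler_lagrange w : HV w ->
  vdip Rv w + 2 * vip Rv w =
  2 * \sum_j ip (fun x => nlin p beta (u j x) (u (~~ j) x)) (w (j, false)).
Proof.
move=> hw; have D0 : aeq (D (fun=> 0 : R)) (fun=> 0).
  have w0 : weak_deriv (fun=> 0 : R) (fun=> 0).
    by have := C1_weak_deriv (C1d_C1 (C1_cst (0 : R))); rewrite (C1dE (C1_cst 0)).
  by case: (H1I (@L2_0 R) (@L2_0 R) w0).
have z1 j : dip (fun=> 0) (w (j, true)) = 0.
  have LD := H1_DL2 (hw (j, true)); rewrite /dip -[RHS](ip0l (D (w (j, true)))).
  exact: (ip_ae D0 (ae_all (fun=> erefl)) (H1_DL2 (@H1_0 R)) (@L2_0 R) LD LD).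
have key j : dip (u j) (w (j, false)) + 2 * ip (u j) (w (j, false)) =
    2 * ip (fun x => nlin p beta (u j x) (u (~~ j) x)) (w (j, false)).
  have hj := hw (j, false); have Lj := H1_L2 hj.
  have -> : dip (u j) (w (j, false)) = - ip (derive1 (derive1 (u j))) (w (j, false)).
    rewrite [in RHS]ipC -(ibp_H1 hj (Cu' j) (L2_u1 j) (L2_u2 j)) /dip ipC.
    have LD := H1_DL2 hj.
    exact: (ip_ae (ae_all (fun=> erefl)) (H1_u j).2 LD LD (H1_DL2 (H1_u j).1) (L2_u1 j)).
  have -> : derive1 (derive1 (u j)) = lin 2 (u j) (-2) (fun x => nlin p beta (u j x) (u (~~ j) x)).
    by apply/funext => x; rewrite ode /lin; ring.
  by rewrite (ip_linl 2 (-2) (L2_u j) (L2_nlin j) Lj); ring.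
have zz j : ip (fun=> 0) (w (j, true)) = 0 by exact: ip0l.
rewrite /vdip /vip !sum4 big_bool/= /real_state/= !z1 !zz !addr0.
have := key false; have := key true => /= k1 k2.
move: k1 k2; set a := dip _ _; set b := ip _ _; set c := ip _ _.
set d := dip _ _; set e := ip _ _; set f := ip _ _; clear; lra.
Qed.

End Action.

(** * Expansion of the action and consequences of the scaling inequality *)

Section SecondVariation.
Context {R : realType}.
Local Notation I := (bool * bool)%type.
Local Notation mu := (@mu R).
Implicit Types (U V w : I -> R -> R).

Lemma near_one_sqr (t : R) : `|t| <= 1 / 2 ->
  [/\ 0 < 1 + t, `|(1 + t) ^+ 2 - 1| <= 3 * `|t| & ((1 + t) ^+ 2 - 1) ^+ 2 <= 9 * t ^+ 2].
Proof.
move=> t1; have n3 : `|2 + t| <= 3.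
  by move: t1; rewrite !ler_norml => /andP[a b]; apply/andP; split; lra.
have -> : (1 + t) ^+ 2 - 1 = t * (2 + t) by ring.
split; first by move: t1; rewrite ler_norml => /andP[a b]; lra.
  by rewrite normrM; have := ler_wpM2l (normr_ge0 t) n3; lra.
rewrite exprMn mulrC ler_wpM2r ?sqr_ge0// -(real_normK (num_real (2 + t))) expr2.
by have := ler_pM (normr_ge0 _) (normr_ge0 _) n3 n3; lra.
Qed.

Lemma energy_mass_aux (E EV a b c g m C t y h : R) : E * y <= EV ->
  - (c * (C * (9 * t ^+ 2))) <= E * (y - 1 - g * ((1 + t) ^+ 2 - 1)) ->
  EV + (1 + t) ^+ 2 * m - (E + m) - t ^+ 2 * h <= t ^+ 2 * m ->
  h * t ^+ 2 <= a * t ^+ 2 -> - (g * E) * t ^+ 2 <= b * t ^+ 2 ->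
  0 <= m * t ^+ 2 -> 0 <= t ^+ 2 ->
  0 <= 2 * (- m - g * E) * t + (1 + (a + m + b + c * C * 9 + m)) * t ^+ 2.
Proof. move=> *; lra. Qed.

Variables (p beta : R) (u : bool -> R -> R).
Hypotheses (p1 : 1 <= p) (p2 : p < 2) (beta0 : 0 < beta).
Hypotheses (Cu : forall j, C1 (u j)) (Cu' : forall j, C1 (derive1 (u j))).
Hypotheses (u0 : forall j x, 0 <= u j x) (decay_u : forall j, edecay (u j)).
Hypothesis ode : forall j x,
  derive1 (derive1 (u j)) x = 2 * (u j x - nlin p beta (u j x) (u (~~ j) x)).
Local Notation en := (en p beta).
Local Notation Rv := (real_state u).
Local Notation Wm := (Wm p beta u).
Local Notation action := (vaction p beta).
Local Notation hess := (hess p beta u).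

Let hR : HV Rv := HV_Rv p1 beta0 Cu Cu' u0 decay_u ode.

Lemma vip_sqr a U b V : HV U -> HV V ->
  vip (vlin a U b V) (vlin a U b V) =
  a ^+ 2 * vip U U + 2 * a * b * vip U V + b ^+ 2 * vip V V.
Proof.
move=> hU hV; have hL := HV_lin a b hU hV.
rewrite (vip_linl a b hU hV hL) (vipC U) (vipC V (vlin a U b V)).
by rewrite (vip_linl a b hU hV hU) (vip_linl a b hU hV hV) (vipC V U); ring.
Qed.

Lemma vdip_sqr a U b V : HV U -> HV V ->
  vdip (vlin a U b V) (vlin a U b V) =
  a ^+ 2 * vdip U U + 2 * a * b * vdip U V + b ^+ 2 * vdip V V.
Proof.
move=> hU hV; have hL := HV_lin a b hU hV.
rewrite (vdip_linl a b hU hV hL) (vdipC U) (vdipC V (vlin a U b V)).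
by rewrite (vdip_linl a b hU hV hU) (vdip_linl a b hU hV hV) (vdipC V U); ring.
Qed.

Lemma vip_int w : HV w -> \int[mu]_x (\sum_i w i x ^+ 2) = vip w w.
Proof.
move=> hw; have h := Int_sum (index_enum I) (fun i => (H1_L2 (hw i)).2).
by rewrite h; apply: eq_bigr => i _; rewrite ip_sqr.
Qed.

Lemma action_taylor_aux (n s s0 q dRw vRw dR vR dw vw ds vs : R) : dRw + 2 * vRw = 2 * n ->
  ds = 1 ^+ 2 * dR + 2 * 1 * 1 * dRw + 1 ^+ 2 * dw -> vs = 1 ^+ 2 * vR + 2 * 1 * 1 * vRw + 1 ^+ 2 * vw ->
  2^-1 * ds - s + vs - (2^-1 * dR - s0 + vR) - (2^-1 * dw + vw - q) = - (s - s0 - 2 * n - q).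
Proof. by move=> ? -> ->; lra. Qed.

(** A small H^1 norm makes w uniformly small, so [dens_taylor] integrates pointwise; the linear
    terms cancel by [euler_lagrange]. *)
Lemma action_taylor (e : R) : 0 < e -> exists2 d : R, 0 < d & forall w, HV w -> vh1 w w <= d ->
  `|action (vlin 1 Rv 1 w) - action Rv - hess w| <= e * vip w w.
Proof.
move=> e0; have [A A0 hA] := profile_bdd decay_u.
have [d d0 T] := dens_taylor p1 beta0 A0 e0.
(* Each of the four components satisfies w_i^2 <= 2 [vh1 w w] almost everywhere. *)
exists (d / 8); first by rewrite divr_gt0.
move=> w hw wd; have hS := HV_lin 1 1 hR hw.
have [C0 bW] := Wm_bdd p1 beta0 u0 decay_u.
have mW := Wm_mble p beta Cu.
pose N x := \sum_j nlin p beta (u j x) (u (~~ j) x) * w (j, false) x.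
pose P x := \sum_i \sum_j Wm i j x * w i x * w j x.
have Ln := L2_nlin p1 beta0 Cu u0 decay_u.
have i1 := vdens_itg p1 beta0 hS; have i2 := vdens_itg p1 beta0 hR.
have inj j : itg (fun x => nlin p beta (u j x) (u (~~ j) x) * w (j, false) x).
  exact: L2_mul (Ln j) (H1_L2 (hw _)).
have iP1 i j : itg (fun x => Wm i j x * w i x * w j x).
  exact: L2_mul (L2_W mW bW i j hw) (H1_L2 (hw j)).
have iN : itg N by exact: itg_sum.
have iP2 i : itg (fun x => \sum_j Wm i j x * w i x * w j x) by exact: itg_sum.
have iP : itg P by exact: itg_sum.
have eN : \int[mu]_x N x = \sum_j ip (fun x => nlin p beta (u j x) (u (~~ j) x)) (w (j, false)).
  rewrite /N (Int_sum _ inj); apply: eq_bigr => j _; by rewrite ipE.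
have eP : \int[mu]_x P x = pot Wm w w.
  rewrite /P (Int_sum _ iP2); apply: eq_bigr => i _.
  by rewrite (Int_sum _ (iP1 i)); apply: eq_bigr => j _; rewrite ipE.
pose S x := vdens p beta (vlin 1 Rv 1 w) x.
pose S0 x := vdens p beta Rv x.
pose F x := S x - S0 x - 2 * N x - P x.
have iF : itg F by exact: itgB (itgB (itgB i1 i2) (itgZ 2 iN)) iP.
have eF : \int[mu]_x F x = \int[mu]_x S x - \int[mu]_x S0 x - 2 * (\int[mu]_x N x) - \int[mu]_x P x.
  by rewrite (IntB (itgB (itgB i1 i2) (itgZ 2 iN)) iP) (IntB (itgB i1 i2) (itgZ 2 iN)) (IntB i1 i2) (IntZ 2 iN).
have iw : itg (fun x => \sum_i w i x ^+ 2) by exact: itg_sum (fun i => (H1_L2 (hw i)).2).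
have bF : `|\int[mu]_x F x| <= e * vip w w.
  apply: le_trans (Int_normr iF) _; rewrite -(vip_int hw) -(IntZ e iw).
  apply: Int_le_ae (itg_abs iF) (itgZ e iw).
  have wi i : {ae mu, forall x, w i x ^+ 2 <= 2 * vh1 w w}.
    apply: ae_mono (H1_sup (hw i)) => x h; apply: le_trans h _; rewrite ler_wpM2l//.
    by rewrite /vh1 (bigD1 i)//= lerDl; apply: sumr_ge0 => j _; exact: h1_ge0.
  have := ae_and (ae_and (wi (false, false)) (wi (false, true))) (ae_and (wi (true, false)) (wi (true, true))).
  apply: ae_mono => x [[h1_ h2] [h3 h4]].
  have E1 : (fun i => vlin 1 Rv 1 w i x) = shift (fun j => u j x) (fun i => w i x).
    by apply/funext => i; rewrite /vlin /lin /shift !mul1r.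
  have E2 : (fun i => Rv i x) = shift (fun j => u j x) (fun=> 0).
    by apply/funext => i; rewrite /shift addr0.
  have hu k : 0 <= u k x <= A by rewrite u0 hA.
  have hd : \sum_i w i x ^+ 2 <= d.
    rewrite sum4; move: wd h1_ h2 h3 h4; clear; move: (vh1 w w).
    by move: (w _ x ^+ 2) (w _ x ^+ 2) (w _ x ^+ 2) (w _ x ^+ 2) => *; lra.
  have := T (fun j => u j x) (fun i => w i x) hu hd.
  by rewrite -E1 -E2.
have EL := euler_lagrange p1 beta0 Cu Cu' u0 decay_u ode hw.
rewrite -eN in EL.
have -> : action (vlin 1 Rv 1 w) - action Rv - hess w = - \int[mu]_x F x.
  rewrite eF eP.
  exact: (@action_taylor_aux _ (\int[mu]_x S x) (\int[mu]_x S0 x) _ _ _ _ _ _ _ _ _ EL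
    (vdip_sqr 1 1 hR hw) (vip_sqr 1 1 hR hw)).
by rewrite normrN.
Qed.

Hypothesis minimal : forall U, HV U -> vip U U = vip Rv Rv -> en Rv <= en U.
Hypothesis M0_gt0 : 0 < vip Rv Rv.
Local Notation M0 := (vip Rv Rv).
Local Notation gam := ((2 + p) / (2 - p)).

(* c U(c^p x) has mass c^(2-p) M(U) and energy c^(2+p) E(U). *)
Lemma energy_scaling U : HV U -> 0 < vip U U -> en Rv * (vip U U / M0) `^ gam <= en U.
Proof.
move=> hU m0; have q2 : 0 < 2 - p by rewrite subr_gt0.
set m := vip U U in m0 *.
pose c := (M0 / m) `^ (2 - p)^-1; have mm : 0 < M0 / m by exact: divr_gt0.
have c0 : 0 < c by exact: powR_gt0.
have cn : c != 0 by rewrite gt_eqF.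
have b0 : 0 < c `^ p by exact: powR_gt0.
have h := vaff_HV c 0 b0 hU.
have pw2 : c ^+ 2 = c `^ 2 by rewrite (powR_mulrn 2 (ltW c0)).
have Dp (a b : R) : c `^ (a + b) = c `^ a * c `^ b by rewrite powRD// cn implybT.
have e1 : c ^+ 2 / c `^ p * m = M0.
  have -> : c ^+ 2 / c `^ p = M0 / m.
    apply: (mulIf (lt0r_neq0 b0)); rewrite divfK ?gt_eqF// pw2.
    have -> : M0 / m = c `^ (2 - p).
      by rewrite /c -powRrM mulVf ?gt_eqF// powRr1// ltW.
    by rewrite -Dp subrK.
  by rewrite divfK ?gt_eqF.
have := minimal h; rewrite (vaff_vip c 0 b0 hU) => /(_ e1).
rewrite (vaff_en p1 beta0 0 c0 b0 hU).
have -> : c `^ (2 * p + 2) / c `^ p = c `^ (2 + p).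
  apply: (mulIf (lt0r_neq0 b0)); rewrite divfK ?gt_eqF// -Dp; congr (_ `^ _); ring.
have -> : c ^+ 2 * c `^ p = c `^ (2 + p) by rewrite pw2 -Dp.
rewrite -mulrBr -/(en U) => k.
have eg : (m / M0) `^ gam * c `^ (2 + p) = 1.
  have -> : c `^ (2 + p) = (M0 / m) `^ gam by rewrite /c -powRrM; congr (_ `^ _); rewrite mulrC.
  rewrite -powRM ?divr_ge0 ?(ltW m0) ?(ltW M0_gt0)//.
  have -> : m / M0 * (M0 / m) = 1 by field; rewrite !gt_eqF.
  by rewrite powR1.
have g0 : 0 <= (m / M0) `^ gam by exact: powR_ge0.
have := ler_wpM2r g0 k; rewrite mulrAC [c `^ _ * _]mulrC eg mul1r; exact.
Qed.

(** The exponent is at least 2 because p >= 1, so [powR_taylor] applies at 1; its quadratic term is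
    absorbed in the constant. *)
Lemma power_linear : exists C d : R, [/\ 0 < d, 0 <= C & forall x, `|x - 1| <= d ->
  `|x `^ gam - 1 - gam * (x - 1)| <= C * (x - 1) ^+ 2].
Proof.
have q2 : 0 < 2 - p by rewrite subr_gt0.
have g2 : 2 <= gam by rewrite ler_pdivlMr//; have := p1; lra.
have [d d0 T] := powR_taylor g2 (ler0n R 2) (ltr01 : 0 < 1 :> R).
pose C := 1 + `|2^-1 * (gam * (gam - 1))|.
exists C, (Num.min d 1); split; [by rewrite lt_min d0 ltr01|by rewrite addr_ge0|].
move=> x; rewrite le_min => /andP[xd x1].
have x02 : 0 <= x <= 2 by move: x1; rewrite ler_norml => /andP[a b]; apply/andP; split; lra.
have := T 1 x; rewrite ler01 ler1n/= => /(_ isT x02 xd).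
rewrite !powR1 !mulr1 mul1r => h.
have s0 := sqr_ge0 (x - 1).
rewrite /C [leRHS]mulrDl mul1r.
set a := x `^ gam - 1 - gam * (x - 1) in h *; set b := 2^-1 * _ in h *.
have -> : a = (a - b * (x - 1) ^+ 2) + b * (x - 1) ^+ 2 by rewrite subrK.
apply: le_trans (ler_normD _ _) _; apply: lerD h _.
by rewrite normrM (ger0_norm s0).
Qed.

Lemma small_quadratic (a b d : R) : 0 < d -> (forall t, `|t| <= d -> 0 <= a * t + b * t ^+ 2) -> a = 0.
Proof.
move=> d0 H; apply/eqP; apply: contraT => an.
have b1 : 0 < `|b| + 1 by rewrite ltr_wpDl.
pose s := Num.min d (`|a| / (2 * (`|b| + 1))).
have ap : 0 < `|a| by rewrite normr_gt0.
have s0 : 0 < s by rewrite lt_min d0 divr_gt0// mulr_gt0.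
have sa : s * (2 * (`|b| + 1)) <= `|a|.
  by rewrite -ler_pdivlMr ?mulr_gt0// ge_min lexx orbT.
have st : `|- Num.sg a * s| <= d.
  by rewrite normrM normrN normr_sg an mul1r gtr0_norm// ge_min lexx.
have := H _ st; rewrite exprMn sqrrN sqr_sg an mul1r.
have -> : a * (- Num.sg a * s) = - (`|a| * s) by rewrite normrEsg; ring.
have := ler_wpM2r (sqr_ge0 s) (ler_norm b); have := ler_wpM2r (ltW s0) sa.
have := mulr_gt0 s0 s0; have := mulr_ge0 (normr_ge0 b) (sqr_ge0 s).
by move: (`|b|) => B; rewrite !expr2; lra.
Qed.

(** Along (1 + t) R the scaling inequality is an equality at t = 0, so first-order terms agree. The
    left side has slope 2 gam E(R); since the action is stationary at R, the right side has slope -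
    2 M(R). *)
Lemma energy_mass : gam * en Rv = - M0.
Proof.
have [C [d1 [d10 C0 P]]] := power_linear.
have [d2 d20 T] := action_taylor ltr01.
pose v := vh1 Rv Rv; have v0 : 0 <= v by exact: vh1_ge0.
pose h := hess Rv.
pose B := 1 + (`|h| + M0 + `|gam * en Rv| + `|en Rv| * C * 9 + M0).
have M0p := M0_gt0; have en0 := normr_ge0 (en Rv).
pose d := Num.min (1 / 2) (Num.min (d1 / 3) (d2 / (v + 1))).
have d0 : 0 < d by rewrite !lt_min !divr_gt0// ltr_wpDl.
suff H : 2 * (- M0 - gam * en Rv) = 0 by lra.
apply: (@small_quadratic _ B d d0) => t td.
have [t1 t2 t3] : [/\ `|t| <= 1 / 2, `|t| <= d1 / 3 & `|t| <= d2 / (v + 1)].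
  by move: td; rewrite !le_min => /and3P[].
have tt : t ^+ 2 <= `|t|.
  by rewrite -real_normK ?num_real// expr2 ler_piMl//; lra.
pose w := vlin t Rv 0 Rv; have hw : HV w by exact: HV_lin.
have wE : vlin 1 Rv 1 w = vlin (1 + t) Rv 0 Rv.
  by apply/funext => i; apply/funext => x; rewrite /w /vlin /lin; ring.
have vw : vip w w = t ^+ 2 * M0 by rewrite /w vip_sqr//; ring.
have hwd : vh1 w w <= d2.
  rewrite /w vh1_sqr// !(mulr0, mul0r, addr0, expr0n)/= -/v.
  apply: le_trans (ler_wpM2r v0 tt) _; rewrite ler_pdivlMr ?ltr_wpDl// in t3.
  by apply: le_trans t3; rewrite ler_wpM2l// lerDl.
have hh : hess w = t ^+ 2 * h.
  have [C1_ bW] := Wm_bdd p1 beta0 u0 decay_u; have mW := Wm_mble p beta Cu.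
  rewrite /hess /w vip_sqr// vdip_sqr// (pot_linl mW bW)//.
  rewrite (potC (Wm_sym p beta u)) (pot_linl mW bW)// /h /hess; ring.
pose V := vlin (1 + t) Rv 0 Rv; have hV : HV V by exact: HV_lin.
have mV : vip V V = (1 + t) ^+ 2 * M0 by rewrite /V vip_sqr//; ring.
have [t1' x3 x2] := near_one_sqr t1.
have V0 : 0 < vip V V by rewrite mV mulr_gt0// exprn_gt0.
have := energy_scaling hV V0; rewrite mV mulfK ?gt_eqF//.
have := T w hw hwd; rewrite wE -/V /vaction mV hh vw mul1r.
have xd : `|(1 + t) ^+ 2 - 1| <= d1.
  by apply: le_trans x3 _; rewrite mulrC -ler_pdivlMr.
have := P _ xd; move: (_ `^ gam) => y k1 k2 k3.
have k4 := le_trans k1 (ler_wpM2l C0 x2).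
have k5 : `|en Rv * (y - 1 - gam * ((1 + t) ^+ 2 - 1))| <= `|en Rv| * (C * (9 * t ^+ 2)).
  by rewrite normrM ler_wpM2l.
move: k5 k2; rewrite !ler_norml => /andP[k5 k6] /andP[k7 k8].
have s0 := sqr_ge0 t.
have k9 := ler_wpM2r s0 (ler_norm h); have k10 := ler_wpM2r s0 (ler_norm (gam * en Rv)).
have k11 := ler_wpM2r s0 (ler_norm (- (gam * en Rv))); rewrite normrN in k11.
exact: energy_mass_aux k3 k5 k8 k9 k11 (mulr_ge0 (ltW M0_gt0) s0) s0.
Qed.

End SecondVariation.

(** The first-order terms cancel through g E = - M0. After division by t^2 the two errors are at
    most - X / 4 each, which leaves X / 2 >= 0. *)
Lemma hess_aux {R : realType} (X K0 rho n t e h E EV C M0 x y g : R) : 0 < t -> t <= 1 -> 0 <= n -> 0 <= K0 ->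
  0 < M0 -> K0 * M0 ^+ 2 = `|E| * C -> x * M0 = M0 + 2 * t * rho + t ^+ 2 * n ->
  E * y <= EV -> `|y - 1 - g * (x - 1)| <= C * (x - 1) ^+ 2 -> g * E = - M0 ->
  EV + x * M0 - (E + M0) - t ^+ 2 * h <= e * (t ^+ 2 * n) ->
  X = h + 4 * K0 * rho ^+ 2 -> e * n <= - X / 4 -> t * (K0 * (4 * `|rho| * n + n ^+ 2)) <= - X / 4 ->
  0 <= X.
Proof.
move=> t0 t1 n0 K00 M00 KE xM k1 k2 gE k3 XE en tn.
have z : x - 1 = (2 * t * rho + t ^+ 2 * n) / M0.
  apply: (mulIf (lt0r_neq0 M00)); rewrite divfK ?gt_eqF// mulrBl mul1r xM; ring.
have z2 : `|E| * (C * (x - 1) ^+ 2) = K0 * (t ^+ 2 * (2 * rho + t * n) ^+ 2).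
  transitivity (K0 * M0 ^+ 2 * (x - 1) ^+ 2); first by rewrite KE; ring.
  by rewrite z; field; rewrite gt_eqF.
have k4 : `|E * (y - 1 - g * (x - 1))| <= K0 * (t ^+ 2 * (2 * rho + t * n) ^+ 2).
  by rewrite normrM -z2 ler_wpM2l.
have e1 : E * (y - 1 - g * (x - 1)) = E * y - E + (x * M0 - M0).
  have -> : E * (y - 1 - g * (x - 1)) = E * y - E - g * E * (x - 1) by ring.
  by rewrite gE; ring.
rewrite e1 ler_norml in k4; have /andP[k5 _] := k4.
have k6 : 0 <= t ^+ 2 * (h + e * n + K0 * (2 * rho + t * n) ^+ 2) by lra.
have t20 : 0 < t ^+ 2 by exact: exprn_gt0.
rewrite pmulr_rge0// in k6.
have k7 : (2 * rho + t * n) ^+ 2 <= 4 * rho ^+ 2 + t * (4 * `|rho| * n + n ^+ 2).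
  have a1 : rho * n <= `|rho| * n by rewrite ler_wpM2r// ler_norm.
  have a2 := ler_wpM2l (ltW t0) a1.
  have a3 := ler_wpM2r (sqr_ge0 n) (ler_wpM2l (ltW t0) t1).
  by lra.
have := ler_wpM2l K00 k7; lra.
Qed.

(** * Nonnegativity of the second variation up to a rank-one term *)

Section Hessian.
Context {R : realType}.
Local Notation I := (bool * bool)%type.
Implicit Types (U V w : I -> R -> R).
Variables (p beta : R) (u : bool -> R -> R).
Hypotheses (p1 : 1 <= p) (p2 : p < 2) (beta0 : 0 < beta).
Hypotheses (Cu : forall j, C1 (u j)) (Cu' : forall j, C1 (derive1 (u j))).
Hypotheses (u0 : forall j x, 0 <= u j x) (decay_u : forall j, edecay (u j)).
Hypothesis ode : forall j x,
  derive1 (derive1 (u j)) x = 2 * (u j x - nlin p beta (u j x) (u (~~ j) x)).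
Local Notation en := (en p beta).
Local Notation Rv := (real_state u).
Local Notation hess := (hess p beta u).
Hypothesis minimal : forall U, HV U -> vip U U = vip Rv Rv -> en Rv <= en U.
Hypothesis M0_gt0 : 0 < vip Rv Rv.
Local Notation M0 := (vip Rv Rv).
Local Notation gam := ((2 + p) / (2 - p)).

Lemma hess_scale t w : HV w -> hess (vlin t w 0 w) = t ^+ 2 * hess w.
Proof.
move=> hw; have [C1_ bW] := Wm_bdd p1 beta0 u0 decay_u; have mW := Wm_mble p beta Cu.
have hS := HV_lin t 0 hw hw.
rewrite /hess (vip_sqr t 0 hw hw) (vdip_sqr t 0 hw hw) (pot_linl mW bW t 0 hw hw hS).
by rewrite (potC (Wm_sym p beta u)) (pot_linl mW bW t 0 hw hw hw); ring.
Qed.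

(** The scaling inequality is applied at R + t w, whose mass ratio x satisfies x - 1 = (2 t <w, R> +
    t^2 M(w)) / M(R). The linear part of x^gam completes the energy to the action, and the part in
    (x - 1)^2 becomes the multiple of <w, R>^2. *)
Lemma hess_nonneg : exists2 K : R, 0 <= K & forall w, HV w -> 0 <= hess w + K * vip w Rv ^+ 2.
Proof.
have hR := HV_Rv p1 beta0 Cu Cu' u0 decay_u ode.
have [C [d1 [d10 C0 P]]] := power_linear p1 p2.
have gE := energy_mass p1 p2 beta0 Cu Cu' u0 decay_u ode minimal M0_gt0.
have M0n : M0 != 0 by rewrite gt_eqF.
(* To leading order |E(R)| C (x - 1)^2 is 4 K0 t^2 <w, R>^2, whence the constant 4 K0. *)
pose K0 := `|en Rv| * C / M0 ^+ 2.
have K00 : 0 <= K0 by rewrite divr_ge0 ?sqr_ge0// mulr_ge0.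
have KE : K0 * M0 ^+ 2 = `|en Rv| * C by rewrite divfK// expf_neq0.
exists (4 * K0) => [|w hw]; first by rewrite mulr_ge0.
set rho := vip w Rv; set X := _ + _.
rewrite leNgt; apply/negP => X0.
pose n := vip w w; have n0 : 0 <= n by exact: vip_ge0.
pose v := vh1 w w; have v0 : 0 <= v by exact: vh1_ge0.
have NX : 0 < - X by rewrite oppr_gt0.
have e0 : 0 < - X / 4 / (n + 1) by rewrite !divr_gt0// ltr_wpDl.
have [d2 d20 T] := action_taylor p1 beta0 Cu Cu' u0 decay_u ode e0.
pose B := K0 * (4 * `|rho| * n + n ^+ 2).
have B0 : 0 <= B by rewrite mulr_ge0// addr_ge0 ?sqr_ge0// !mulr_ge0.
pose d3 := Num.min d1 (1 / 2); have d30 : 0 < d3 by rewrite lt_min d10 divr_gt0.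
have q0 : 0 < 2 * `|rho| + n + 1 by rewrite ltr_wpDl// addr_ge0// mulr_ge0.
(* Small enough for the expansion of the action, for the expansion of the power at the mass ratio,
   and for the terms of higher order in t. *)
pose t := Num.min 1 (Num.min (d2 / (v + 1)) (Num.min (d3 * M0 / (2 * `|rho| + n + 1)) (- X / 4 / (B + 1)))).
have t0 : 0 < t.
  rewrite !lt_min ltr01 !divr_gt0 ?mulr_gt0// ?ltr_wpDl//.
have t1 : t <= 1 by rewrite ge_min lexx.
have t2 : t * (v + 1) <= d2 by rewrite -ler_pdivlMr ?ltr_wpDl// !ge_min lexx ?orbT.
have t3 : t * (2 * `|rho| + n + 1) <= d3 * M0.
  by rewrite -ler_pdivlMr// !ge_min lexx ?orbT.
have t4 : t * (B + 1) <= - X / 4 by rewrite -ler_pdivlMr ?ltr_wpDl// !ge_min lexx ?orbT.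
have tt : t ^+ 2 <= t by rewrite expr2 ler_piMl// ltW.
pose z := vlin t w 0 w; have hz : HV z by exact: HV_lin.
have zv : vh1 z z <= d2.
  have -> : vh1 z z = t ^+ 2 * v by rewrite /z vh1_sqr// /v; ring.
  apply: le_trans (ler_wpM2r v0 tt) _; apply: le_trans t2.
  by rewrite ler_pM2l// lerDl.
have zn : vip z z = t ^+ 2 * n by rewrite /z vip_sqr// /n; ring.
have zR : vip Rv z = t * rho by rewrite vipC /z vip_linl// /rho; ring.
pose V := vlin 1 Rv 1 z; have hV : HV V by exact: HV_lin.
have mV : vip V V = M0 + 2 * t * rho + t ^+ 2 * n by rewrite /V vip_sqr// zn zR; ring.
pose x := vip V V / M0; have xM : x * M0 = vip V V by rewrite divfK.
have xd : `|x - 1| <= d3.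
  have -> : x - 1 = (2 * t * rho + t ^+ 2 * n) / M0 by rewrite /x mV; field.
  rewrite normrM normfV (gtr0_norm M0_gt0) ler_pdivrMr//.
  apply: le_trans (ler_normD _ _) _; apply: le_trans t3.
  have -> : `|2 * t * rho| = t * (2 * `|rho|).
    by rewrite normrM ger0_norm ?mulr_ge0// ?(ltW t0)//; ring.
  rewrite (ger0_norm (mulr_ge0 (sqr_ge0 t) n0)).
  have -> : t * (2 * `|rho| + n + 1) = t * (2 * `|rho|) + (t * n + t) by ring.
  by rewrite lerD2l (le_trans (ler_wpM2r n0 tt))// lerDl ltW.
have [xd1 xd2] : `|x - 1| <= d1 /\ `|x - 1| <= 1 / 2 by move: xd; rewrite le_min => /andP[].
have V0 : 0 < vip V V.
  by rewrite -xM mulr_gt0//; move: xd2; rewrite ler_norml => /andP[a b]; lra.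
have k1 := energy_scaling p1 p2 beta0 minimal M0_gt0 hV V0.
have k2 := P _ xd1.
have /ler_normlP[_ k3] := T z hz zv.
rewrite /vaction (hess_scale t hw) zn -/V in k3.
have en4 : - X / 4 / (n + 1) * n <= - X / 4.
  rewrite mulrAC ler_pdivrMr ?ltr_wpDl// ler_wpM2l ?lerDl ?ler01//.
  by rewrite divr_ge0// ltW.
have t5 : t * B <= - X / 4 by apply: le_trans t4; rewrite ler_wpM2l ?(ltW t0)// lerDl.
have : 0 <= X.
  apply: (@hess_aux R X K0 rho n t _ (hess w) (en Rv) (en V) C M0 x (x `^ gam) gam) => //.
  - by rewrite xM mV.
  - by rewrite xM; exact: k3.
  - exact: en4.
by rewrite leNgt X0.
Qed.

End Hessian.

(** * The kernel of the penalised form *)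

Section Kernel.
Context {R : realType}.
Local Notation I := (bool * bool)%type.
Local Notation mu := (@mu R).
Local Notation D := (@wderiv R).
Implicit Types (U V w : I -> R -> R).
Variables (p beta : R) (u : bool -> R -> R).
Hypotheses (p1 : 1 <= p) (beta0 : 0 < beta).
Hypotheses (Cu : forall j, C1 (u j)) (Cu' : forall j, C1 (derive1 (u j))).
Hypotheses (u0 : forall j x, 0 <= u j x) (decay_u : forall j, edecay (u j)).
Hypothesis ode : forall j x,
  derive1 (derive1 (u j)) x = 2 * (u j x - nlin p beta (u j x) (u (~~ j) x)).
Local Notation Rv := (real_state u).
Local Notation Wm := (Wm p beta u).
Local Notation hess := (hess p beta u).
Variable K : R.
Hypotheses (K0 : 0 <= K) (hessK : forall w, HV w -> 0 <= hess w + K * vip w Rv ^+ 2).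
Local Notation B := (bil Wm Rv (K + 1)).
Hypothesis nondeg : forall v : bool -> R -> R, (forall j, H1 (v j)) ->
  (forall j, weak_elliptic (v j) (fun x => wre p beta (u j x) (u (~~ j) x) * v j x
     + wmix p beta (u j x) (u (~~ j) x) * v (~~ j) x)) ->
  exists theta, forall j, aeq (v j) (fun x => theta * derive1 (u j) x).

Lemma bilE w : B w w = hess w + (K + 1) * vip w Rv ^+ 2.
Proof. by rewrite expr2. Qed.

Lemma bil_nonneg w : HV w -> 0 <= B w w.
Proof.
move=> hw; rewrite bilE; have := hessK hw; have := sqr_ge0 (vip w Rv).
by rewrite mulrDl mul1r; lra.
Qed.

Lemma L2_Rv i : L2 (Rv i).
Proof. exact: H1_L2 (HV_Rv p1 beta0 Cu Cu' u0 decay_u ode i). Qed.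

(** The form with K is already nonnegative, so the extra unit forces orthogonality to R. The penalty
    then disappears from the kernel equation. *)
Lemma bil_zero U : HV U -> B U U = 0 -> vip U Rv = 0 /\ forall V, HV V -> B U V = 0.
Proof.
move=> hU B0; have [C0 bW] := Wm_bdd p1 beta0 u0 decay_u; have mW := Wm_mble p beta Cu.
split; last first.
  by move=> V hV; exact: (bil_null mW bW (Wm_sym p beta u) L2_Rv bil_nonneg hU hV B0).
move: B0; rewrite bilE => B0; have := hessK hU; have := sqr_ge0 (vip U Rv) => s0 h.
by apply/eqP; rewrite -sqrf_eq0 eq_le s0 andbT; lra.
Qed.

Lemma dip0r (f : R -> R) : H1 f -> dip f (fun=> 0) = 0.
Proof.
move=> hf; have h := dip_linl 0 0 hf hf hf; have := h; rewrite !mul0r addr0 => {2}<-.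
rewrite /dip ipC; congr ip; congr wderiv; apply/funext => x; rewrite /lin; ring.
Qed.

(** The form is polarised against the vector with the test function in slot [i0] and zero
    elsewhere. *)
Lemma weak_kernel U i0 : HV U -> B U U = 0 ->
  weak_elliptic (U i0) (fun x => \sum_i Wm i i0 x * U i x).
Proof.
move=> hU B0 eta te; have [m0 null] := bil_zero hU B0.
have [C0 bW] := Wm_bdd p1 beta0 u0 decay_u; have mW := Wm_mble p beta Cu.
have [he de] := test_H1 te; have [Le Le'] := test_L2 te.
pose V i := if i == i0 then eta else fun=> 0.
have hV : HV V by move=> i; rewrite /V; case: ifP => _; [exact: he|exact: H1_0].
have := null V hV; rewrite /bil [moment Rv U]m0 mul0r mulr0 addr0.
have V0 : V i0 = eta by rewrite /V eqxx.
have Vn i : i != i0 -> V i = fun=> 0 by move=> /negPf h; rewrite /V h.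
have -> : vdip U V = dip (U i0) eta.
  have z i : i != i0 -> dip (U i) (V i) = 0 by move=> /Vn ->; exact: dip0r (hU i).
  by rewrite /vdip (bigD1 i0 isT) /= V0 big1 ?addr0//; exact: z.
have -> : vip U V = ip (U i0) eta.
  rewrite /vip (bigD1 i0)//= V0 big1 ?addr0// => i ni; rewrite Vn// ipC; exact: ip0l.
have -> : pot Wm U V = \int[mu]_x ((\sum_i Wm i i0 x * U i x) * eta x).
  have i1 i : itg (fun x => Wm i i0 x * U i x * eta x) by exact: L2_mul (L2_W mW bW i i0 hU) Le.
  transitivity (\int[mu]_x (\sum_i Wm i i0 x * U i x * eta x)); last first.
    by apply: eq_Rintegral => x _; rewrite mulr_suml.
  rewrite (Int_sum _ i1); apply: eq_bigr => i _.
  rewrite (bigD1 i0)//= V0 big1 ?addr0 ?ipE// => j nj; rewrite Vn// ipC; exact: ip0l.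
have -> : dip (U i0) eta = \int[mu]_x (D (U i0) x * derive1 eta x).
  rewrite -ipE; have LD := H1_DL2 (hU i0).
  exact: (ip_ae (ae_all (fun=> erefl)) de LD LD (H1_DL2 he) Le').
by rewrite ipE => /eqP; rewrite subr_eq0 => /eqP.
Qed.

Lemma wmix_sym x y : wmix p beta x y = wmix p beta y x.
Proof. by rewrite /wmix mulrAC. Qed.

Lemma kernel_real U : HV U -> B U U = 0 ->
  exists theta, forall j, aeq (U (j, false)) (fun x => theta * derive1 (u j) x).
Proof.
move=> hU B0; apply: (nondeg (v := fun j => U (j, false))) => [j|j]; first exact: hU.
have := weak_kernel (j, false) hU B0; congr weak_elliptic.
apply/funext => x; rewrite sum4 /Wm /wmat; case: j => /=; rewrite !mul0r; last by ring.
by rewrite [in RHS]wmix_sym; ring.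
Qed.

Lemma weak_kernel_imag U j : HV U -> B U U = 0 ->
  weak_elliptic (U (j, true)) (fun x => wim p beta (u j x) (u (~~ j) x) * U (j, true) x).
Proof.
move=> hU B0; have := weak_kernel (j, true) hU B0; congr weak_elliptic.
by apply/funext => x; rewrite sum4 /Wm /wmat; case: j => /=; rewrite !mul0r; ring.
Qed.

(** The potentials differ by a factor p in the coupling term: for p = 1 it is 1, and for p > 1 the
    power 0^(p-1) vanishes. *)
Lemma wre_wim0 y : wre p beta 0 y = wim p beta 0 y.
Proof.
rewrite /wre /wim powR0 ?mulr0 ?add0r; last by rewrite gt_eqF//; have := p1; lra.
have [->|pn] := eqVneq p 1; first by rewrite mulr1.
by rewrite powR0 ?subr_eq0// !mulr0.
Qed.

Lemma wim_mul x y : 0 < x -> wim p beta x y * x = nlin p beta x y.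
Proof.
move=> x0; have xn : x != 0 by rewrite gt_eqF.
have D1 a : x `^ (a + 1) = x `^ a * x by rewrite powRD ?xn ?implybT// powRr1// ltW.
have E : x `^ p = x `^ (p - 1) * x by rewrite -D1 subrK.
by rewrite /wim /nlin D1 E; ring.
Qed.

(** A component is either positive or identically zero. In the first case u_j itself solves the
    equation of the imaginary part, so [kernel_multiple] applies. *)
Lemma kernel_imag U j : HV U -> B U U = 0 -> exists c, aeq (U (j, true)) (fun x => c * u j x).
Proof.
move=> hU B0; have wk := weak_kernel_imag j hU B0.
have [Kn Kn0 hn] := nlin_le p1 beta0 u0 decay_u.
have L0 : 0 <= 2 * (1 + Kn) by rewrite mulr_ge0// addr_ge0.
have hL x : `|derive1 (derive1 (u j)) x| <= 2 * (1 + Kn) * `|u j x|.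
  rewrite ode normrM ger0_norm// -mulrA ler_wpM2l//.
  by apply: le_trans (ler_normB _ _) _; rewrite mulrDl mul1r lerD2l.
have [up|uz] := ode_positive (Cu j) (Cu' j) L0 (u0 j) hL.
- have pc (k : bool) s : 0 < s -> continuous (fun x => u k x `^ s).
    move=> s0; have -> : (fun x => u k x `^ s) = (fun x => `|u k x| `^ s).
      by apply/funext => x; rewrite ger0_norm.
    move=> x; apply: (@continuous_comp _ _ _ (u k) (fun y : R => `|y| `^ s)).
      exact: C1_continuous (Cu k) x.
    exact: powR_norm_continuous s0 _.
  have cq : continuous (fun x => wim p beta (u j x) (u (~~ j) x)).
    have q1 := p1; have p20 : 0 < 2 * p by lra.
    have p10 : 0 < p + 1 by lra.
    move=> x; apply: cvgD; first exact: pc.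
    apply: cvgM; last exact: pc.
    apply: cvgM; first exact: cvg_cst.
    have [pe|pn] := eqVneq p 1.
      rewrite pe subrr powRr0 (_ : (fun x => _) = fun=> 1); first exact: cvg_cst.
      by apply/funext => y; rewrite powRr0.
    by apply: pc; rewrite subr_gt0 lt_neqAle eq_sym pn.
  apply: (kernel_multiple (Cu j) (Cu' j) up (L2_u Cu decay_u j)
    (L2_u1 p1 beta0 Cu Cu' u0 decay_u ode j) cq (ode j) _ (hU _) wk).
  by move=> x; exact: wim_mul.
(* When u_j vanishes, real and imaginary potentials coincide in slot j and the mixed one is zero, so
   this vector solves the linearised system. Non-degeneracy makes it a multiple of the zero
   derivative of u_j. *)
- pose v k := if k == j then U (j, true) else fun=> 0.
  have hv k : H1 (v k) by rewrite /v; case: ifP => _; [exact: hU|exact: H1_0].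
  have [|th hth] := nondeg hv; last first.
    exists 0; have := hth j; rewrite /v eqxx; apply: ae_mono => x ->.
    have -> : u j = fun=> 0 by apply/funext.
    by rewrite (C1dE (C1_cst 0)) !mulr0.
  move=> k; have [kj|kj] := eqVneq k j.
    rewrite /v kj eqxx (_ : (~~ j == j) = false); last by case: (j).
    move: wk; congr weak_elliptic; apply/funext => x.
    by rewrite mulr0 addr0 uz wre_wim0.
  have -> : ~~ k = j by move: kj; case: (k); case: (j).
  rewrite /v (negPf kj) eqxx => eta te.
  have -> : \int[mu]_x (D (fun=> 0) x * derive1 eta x) = \int[mu]_x (0 : R).
    have [he de] := test_H1 te; have [Le Le'] := test_L2 te; have LD := H1_DL2 (@H1_0 R).
    have e1 : ip (D (fun=> 0)) (D eta) = 0 by rewrite ipC; exact: dip0r he.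
    have e2 := ip_ae (ae_all (fun=> erefl)) (aeq_sym de) LD LD Le' (H1_DL2 he).
    by rewrite -ipE e2 e1 Int0.
  have -> : \int[mu]_x (0 * eta x) = \int[mu]_x (0 : R) by apply: eq_Rintegral => x _; rewrite mul0r.
  rewrite Int0 mulr0 addr0 -[LHS]Int0; apply: eq_Rintegral => x _.
  by rewrite uz /wmix powR0 ?mulr0 ?mul0r ?addr0 ?mul0r// gt_eqF//; have := p1; lra.
Qed.

End Kernel.

(** * Differentiability in H^1 of curves on the orbit *)

Section Orbit.
Context {R : realType}.
Local Notation I := (bool * bool)%type.
Local Notation D := (@wderiv R).
Implicit Types (f g : R -> R) (U V : I -> R -> R).

Lemma C1d_cos : C1d (@cos R) (fun x => - sin x).
Proof.
split; first by move=> x; exact: is_derive_cos.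
by move=> x; apply: cvgN; exact: continuous_sin.
Qed.

Lemma C1d_sin : C1d (@sin R) (@cos R).
Proof. by split; [move=> x; exact: is_derive_sin|exact: continuous_cos]. Qed.

Lemma abs_sin_le (x : R) : `|sin x| <= `|x|.
Proof.
have [y] := C1d_MVT_dist 0 x C1d_sin; rewrite sin0 !subr0 => _ ->.
by rewrite normrM ler_piMl// ler_norml cos_geN1 cos_le1.
Qed.

Lemma abs_cos_sub1 (x : R) : `|cos x - 1| <= x ^+ 2.
Proof.
have [y] := C1d_MVT_dist 0 x C1d_cos; rewrite cos0 sub0r normrN !subr0 => yx ->.
rewrite normrM normrN -(real_normK (num_real x)) expr2 ler_wpM2r//.
exact: le_trans (abs_sin_le y) yx.
Qed.

Lemma abs_sin_sub (x : R) : `|sin x - x| <= `|x| * x ^+ 2.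
Proof.
have [y] := C1d_MVT_dist 0 x C1d_sin; rewrite sin0 sub0r normrN !subr0 => yx ->.
rewrite -{2}[x]mul1r -mulrBl normrM mulrC ler_wpM2l//.
apply: le_trans (abs_cos_sub1 y) _.
by rewrite -(real_normK (num_real y)) -(real_normK (num_real x)) lerXn2r ?nnegrE.
Qed.

Lemma h1_sqr a f b g : H1 f -> H1 g -> h1 (lin a f b g) (lin a f b g) =
  a ^+ 2 * h1 f f + 2 * a * b * h1 f g + b ^+ 2 * h1 g g.
Proof.
move=> hf hg; have [hl _] := H1_lin a b hf hg.
rewrite (h1_linl a b hf hg hl) (h1C f) (h1C g (lin _ _ _ _)).
by rewrite (h1_linl a b hf hg hf) (h1_linl a b hf hg hg) (h1C g f); ring.
Qed.

Lemma h1_lin_le a f b g : H1 f -> H1 g ->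
  h1 (lin a f b g) (lin a f b g) <= 2 * (a ^+ 2 * h1 f f) + 2 * (b ^+ 2 * h1 g g).
Proof.
move=> hf hg; have := h1_ge0 (lin a f (- b) g); rewrite !h1_sqr//.
by rewrite sqrrN; lra.
Qed.

Lemma vh1_lin_le a U b V : HV U -> HV V ->
  vh1 (vlin a U b V) (vlin a U b V) <= 2 * (a ^+ 2 * vh1 U U) + 2 * (b ^+ 2 * vh1 V V).
Proof.
move=> hU hV; have := vh1_ge0 (vlin a U (- b) V); rewrite !vh1_sqr//.
by rewrite sqrrN; lra.
Qed.

Lemma vh1_sub_null U V : HV U -> HV V -> (forall i, aeq (U i) (V i)) ->
  vh1 (vlin 1 U (-1) V) (vlin 1 U (-1) V) = 0.
Proof.
move=> hU hV UV; apply: big1 => i _; have hi := hU i; have hj := hV i.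
have e : aeq (vlin 1 U (-1) V i) (fun=> 0).
  by apply: ae_mono (UV i) => x h; rewrite /vlin /lin h; ring.
have [h _] := H1_lin 1 (-1) hi hj; have [h0 e0] := H1_ae e (mbleC 0) h.
have e1 : h1 (fun=> 0) (fun=> 0) = 0 :> R.
  have := h1_sqr 0 0 h0 h0; rewrite (_ : lin 0 _ 0 _ = fun=> 0); last first.
    by apply/funext => x; rewrite /lin; ring.
  by move=> ->; ring.
rewrite -e1 /h1 /dip; congr (_ + _).
  exact: (ip_ae e e (H1_L2 h) (H1_L2 h0) (H1_L2 h) (H1_L2 h0)).
have e2 := aeq_sym e0.
exact: (ip_ae e2 e2 (H1_DL2 h) (H1_DL2 h0) (H1_DL2 h) (H1_DL2 h0)).
Qed.

Variable u : bool -> R -> R.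
Hypotheses (Cu : forall j, C1 (u j)) (Cu' : forall j, C1 (derive1 (u j))).
Hypotheses (decay_u1 : forall j, edecay (derive1 (u j)))
  (decay_u2 : forall j, edecay (derive1 (derive1 (u j)))).
Hypotheses (H1u : forall j, H1 (u j) /\ aeq (D (u j)) (derive1 (u j)))
  (H1u1 : forall j, H1 (derive1 (u j)) /\ aeq (D (derive1 (u j))) (derive1 (derive1 (u j)))).
Local Notation Rv := (real_state u).

Lemma translate_quotient_H1 j (th : R) (a : nat -> R) :
  (forall n, 0 < a n) -> (forall n, `|th * a n| <= 1) -> a n @[n --> \oo] --> (0 : R) ->
  let g n x := (a n)^-1 * (u j (x - th * a n) - u j x) + th * derive1 (u j) x in
  (forall n, H1 (g n)) /\ (h1 (g n) (g n) @[n --> \oo] --> (0 : R)).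
Proof.
move=> a0 a1 ca g.
have [L1 c1] := translate_quotient (Cu j) (decay_u1 j) a0 a1 ca.
have [L2_ c2] := translate_quotient (Cu' j) (decay_u2 j) a0 a1 ca.
have [hu du] := H1u j; have [hu1 du1] := H1u1 j.
pose g' n x := (a n)^-1 * (derive1 (u j) (x - th * a n) - derive1 (u j) x) + th * derive1 (derive1 (u j)) x.
have w n : weak_deriv (g n) (g' n).
  have wu := C1_weak_deriv (Cu j); have wu1 := C1_weak_deriv (Cu' j).
  have wt := weak_deriv_affine (- (th * a n)) ltr01 wu.
  have := weak_derivD (weak_derivZ (a n)^-1 (weak_derivD wt (weak_derivZ (-1) wu))) (weak_derivZ th wu1).
  by congr weak_deriv; apply/funext => x; rewrite /g /g' !mul1r mulN1r.
have H n := H1I (L1 n) (L2_ n) (w n).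
split; first by move=> n; case: (H n).
have -> : (fun n => h1 (g n) (g n)) = (fun n => ip (g n) (g n) + ip (g' n) (g' n)).
  apply/funext => n; have [h e] := H n; rewrite /h1; congr (_ + _).
  exact: (ip_ae e e (H1_DL2 h) (L2_ n) (H1_DL2 h) (L2_ n)).
by rewrite -[0 : R]addr0; exact: cvgD c1 c2.
Qed.

(** Translation moves the real parts with velocity - th u', rotation moves the imaginary parts with
    velocity c u. *)
Definition tangent (th : R) (c : bool -> R) : I -> R -> R := fun i =>
  if i.2 then (fun x => c i.1 * u i.1 x) else (fun x => - th * derive1 (u i.1) x).

Lemma HV_tangent th c : HV (tangent th c).
Proof.
by case=> j []; [have [h _] := H1_Z (c j) (H1u j).1|have [h _] := H1_Z (- th) (H1u1 j).1].
Qed.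

(* The tangent vectors are the velocities of the curves a |-> act (th a) (c a) R. *)
Lemma orbit_quotient (th : R) (c : bool -> R) (a : nat -> R) :
  (forall n, 0 < a n <= 1) -> (forall n, `|th * a n| <= 1) -> a n @[n --> \oo] --> (0 : R) ->
  let Z n := vlin 1 (vlin (a n)^-1 (act (th * a n) (fun j => c j * a n) Rv) (- (a n)^-1) Rv)
     (-1) (tangent th c) in
  vh1 (Z n) (Z n) @[n --> \oo] --> (0 : R).
Proof.
move=> a01 a1 ca Z.
have a0 n : 0 < a n by case/andP: (a01 n).
pose g j n x := (a n)^-1 * (u j (x - th * a n) - u j x) + th * derive1 (u j) x.
have hg j n : H1 (g j n) by have [h _] := translate_quotient_H1 j a0 a1 ca; exact: h.
have cg j : h1 (g j n) (g j n) @[n --> \oo] --> (0 : R).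
  by have [_ h] := translate_quotient_H1 j a0 a1 ca; exact: h.
pose A j := h1 (u j) (u j); pose A1 j := h1 (derive1 (u j)) (derive1 (u j)).
have A0 j : 0 <= A j by exact: h1_ge0.
have A10 j : 0 <= A1 j by exact: h1_ge0.
pose K j := (c j ^+ 2) ^+ 2 * A j + (c j ^+ 2 * th) ^+ 2 * A1 j
  + (`|c j| * c j ^+ 2) ^+ 2 * A j + (c j * th) ^+ 2 * A1 j.
have hu j := (H1u j).1; have hu1 j := (H1u1 j).1.
(* Each component of [Z n] combines the translation quotient, with a bounded coefficient, and u and
   u' with coefficients of order a_n; [K] collects the squares of the latter. *)
have gen j n l m k : h1 (lin 1 (lin l (g j n) m (u j)) k (derive1 (u j)))
    (lin 1 (lin l (g j n) m (u j)) k (derive1 (u j))) <=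
    4 * (l ^+ 2 * h1 (g j n) (g j n)) + 4 * (m ^+ 2 * A j) + 4 * (k ^+ 2 * A1 j).
  have [h2 _] := H1_lin l m (hg j n) (hu j).
  apply: le_trans (h1_lin_le 1 k h2 (hu1 j)) _.
  have := h1_lin_le l m (hg j n) (hu j); have := mulr_ge0 (sqr_ge0 k) (A10 j).
  by rewrite -/(A1 j) -/(A j) expr1n mul1r; lra.
have sq (x y : R) : `|x| <= y -> x ^+ 2 <= y ^+ 2.
  move=> h; rewrite -(real_normK (num_real x)) lerXn2r ?nnegrE//.
  exact: le_trans h.
have key j n b : h1 (Z n (j, b)) (Z n (j, b)) <= 4 * (1 + c j ^+ 2) * h1 (g j n) (g j n) + 4 * a n * K j.
  have /andP[an0 an1] := a01 n; have ann : a n != 0 by rewrite gt_eqF.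
  have aa : a n ^+ 2 <= a n by rewrite expr2 ler_piMl// ltW.
  have h0 := h1_ge0 (g j n); have c20 := sqr_ge0 (c j).
  have sK x y : 0 <= y -> `|x| <= a n * y -> x ^+ 2 <= a n * y ^+ 2.
    by move=> y0 /sq h; apply: le_trans h _; rewrite exprMn ler_wpM2r ?sqr_ge0.
  have cs := abs_cos_sub1 (c j * a n); have ss := abs_sin_sub (c j * a n); have s1 := abs_sin_le (c j * a n).
  case: b.
    have -> : Z n (j, true) = lin 1 (lin (sin (c j * a n)) (g j n) ((a n)^-1 * sin (c j * a n) - c j) (u j))
        (- (sin (c j * a n) * th)) (derive1 (u j)).
      apply/funext => x; rewrite /Z /vlin /lin /act /turn /vaff /tangent /real_state /lin /g/= !mul1r !mulr0 !addr0; ring.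
    apply: le_trans (gen _ _ _ _ _) _.
    have m1 : ((a n)^-1 * sin (c j * a n) - c j) ^+ 2 <= a n * (`|c j| * c j ^+ 2) ^+ 2.
      apply: sK; first by rewrite mulr_ge0.
      have -> : (a n)^-1 * sin (c j * a n) - c j = (a n)^-1 * (sin (c j * a n) - c j * a n) by field.
      rewrite normrM gtr0_norm ?invr_gt0// ler_pdivrMl//; apply: le_trans ss _.
      rewrite normrM (gtr0_norm an0) exprMn.
      have -> : `|c j| * a n * (c j ^+ 2 * a n ^+ 2) = a n * (a n * (`|c j| * c j ^+ 2)) * a n by ring.
      rewrite ler_piMr//.
      exact: mulr_ge0 (ltW an0) (mulr_ge0 (ltW an0) (mulr_ge0 (normr_ge0 _) c20)).
    have m2 : (- (sin (c j * a n) * th)) ^+ 2 <= a n * (c j * th) ^+ 2.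
      rewrite -(real_normK (num_real (c j * th))); apply: sK => //.
      by rewrite normrN !normrM in s1 *; have := ler_wpM2r (normr_ge0 th) s1; rewrite (gtr0_norm an0); lra.
    have m3 : sin (c j * a n) ^+ 2 <= 1 + c j ^+ 2.
      have := cos2Dsin2 (c j * a n); have := sqr_ge0 (cos (c j * a n)); lra.
    have k1 := ler_wpM2r h0 m3; have k2 := ler_wpM2r (A0 j) m1; have k3 := ler_wpM2r (A10 j) m2.
    have z1 : 0 <= a n * ((c j ^+ 2) ^+ 2 * A j) by exact: (mulr_ge0 (ltW an0) (mulr_ge0 (sqr_ge0 _) (A0 j))).
    have z2 : 0 <= a n * ((c j ^+ 2 * th) ^+ 2 * A1 j) by exact: (mulr_ge0 (ltW an0) (mulr_ge0 (sqr_ge0 _) (A10 j))).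
    rewrite /K; move: k1 k2 k3 z1 z2.
    move: (h1 (g j n) (g j n)) (A j) (A1 j) (sin _ ^+ 2) => *; lra.
  have -> : Z n (j, false) = lin 1 (lin (cos (c j * a n)) (g j n) ((a n)^-1 * (cos (c j * a n) - 1)) (u j))
      (- ((cos (c j * a n) - 1) * th)) (derive1 (u j)).
    apply/funext => x; rewrite /Z /vlin /lin /act /turn /vaff /tangent /real_state /lin /g/= !mul1r !mulr0 !addr0; ring.
  apply: le_trans (gen _ _ _ _ _) _.
  have m1 : ((a n)^-1 * (cos (c j * a n) - 1)) ^+ 2 <= a n * (c j ^+ 2) ^+ 2.
    apply: sK => //; rewrite normrM gtr0_norm ?invr_gt0// ler_pdivrMl//; apply: le_trans cs _.
    by rewrite le_eqVlt; apply/orP; left; apply/eqP; ring.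
  have m2 : (- ((cos (c j * a n) - 1) * th)) ^+ 2 <= a n * (c j ^+ 2 * th) ^+ 2.
    rewrite -(real_normK (num_real (c j ^+ 2 * th))); apply: sK => //.
    rewrite normrN normrM [`|c j ^+ 2 * th|]normrM (ger0_norm c20) mulrA ler_wpM2r//; apply: le_trans cs _.
    by rewrite exprMn mulrC ler_wpM2r.
  have m3 : cos (c j * a n) ^+ 2 <= 1 + c j ^+ 2.
    have := cos2Dsin2 (c j * a n); have := sqr_ge0 (sin (c j * a n)); lra.
  have k1 := ler_wpM2r h0 m3; have k2 := ler_wpM2r (A0 j) m1; have k3 := ler_wpM2r (A10 j) m2.
  have z1 : 0 <= a n * ((`|c j| * c j ^+ 2) ^+ 2 * A j) by exact: (mulr_ge0 (ltW an0) (mulr_ge0 (sqr_ge0 _) (A0 j))).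
  have z2 : 0 <= a n * ((c j * th) ^+ 2 * A1 j) by exact: (mulr_ge0 (ltW an0) (mulr_ge0 (sqr_ge0 _) (A10 j))).
  rewrite /K; move: k1 k2 k3 z1 z2.
  move: (h1 (g j n) (g j n)) (A j) (A1 j) (cos _ ^+ 2) => *; lra.
have lim j : 4 * (1 + c j ^+ 2) * h1 (g j n) (g j n) + 4 * a n * K j @[n --> \oo] --> (0 : R).
  have e : 4 * (1 + c j ^+ 2) * 0 + 4 * 0 * K j = 0 :> R by ring.
  rewrite -[X in _ --> X]e; apply: cvgD; first by apply: cvgM (cg j); exact: cvg_cst.
  by apply: cvgM; [apply: cvgM ca; exact: cvg_cst|exact: cvg_cst].
have [F cF hF] : exists2 F : bool -> nat -> R, (forall j, F j n @[n --> \oo] --> (0 : R)) &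
    forall j n b, h1 (Z n (j, b)) (Z n (j, b)) <= F j n.
  by exists (fun j n => 4 * (1 + c j ^+ 2) * h1 (g j n) (g j n) + 4 * a n * K j).
have cS : (F false \+ F false \+ F true \+ F true) n @[n --> \oo] --> (0 : R).
  have e : 0 + 0 + 0 + 0 = 0 :> R by rewrite !addr0.
  rewrite -[X in _ --> X]e; exact: (cvgD (cvgD (cvgD (cF false) (cF false)) (cF true)) (cF true)).
apply: (@squeeze_cvgr _ _ _ _ (fun=> 0) (F false \+ F false \+ F true \+ F true)) => //; last exact: cvg_cst.
apply: nearW => n; rewrite vh1_ge0/=.
have := hF false n false; have := hF false n true; have := hF true n false; have := hF true n true.
rewrite /vh1 sum4; move: (h1 _ _) (h1 _ _) (h1 _ _) (h1 _ _) => A1' A2' A3' A4'; lra.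
Qed.

End Orbit.

(** * The Lyapunov function and its coercivity transversally to the orbit *)

Section Coercivity.
Context {R : realType}.
Local Notation I := (bool * bool)%type.
Implicit Types (U V w : I -> R -> R).
Variables (p beta : R) (u : bool -> R -> R).
Hypotheses (p1 : 1 <= p) (p2 : p < 2) (beta0 : 0 < beta).
Hypotheses (Cu : forall j, C1 (u j)) (Cu' : forall j, C1 (derive1 (u j))).
Hypotheses (u0 : forall j x, 0 <= u j x) (decay_u : forall j, edecay (u j)).
Hypothesis ode : forall j x,
  derive1 (derive1 (u j)) x = 2 * (u j x - nlin p beta (u j x) (u (~~ j) x)).
Local Notation Rv := (real_state u).
Local Notation Wm := (Wm p beta u).
Local Notation action := (vaction p beta).
Local Notation hess := (hess p beta u).
Variable K : R.
Hypotheses (K0 : 0 <= K) (hessK : forall w, HV w -> 0 <= hess w + K * vip w Rv ^+ 2).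
Local Notation B := (bil Wm Rv (K + 1)).
Hypothesis nondeg : forall v : bool -> R -> R, (forall j, H1 (v j)) ->
  (forall j, weak_elliptic (v j) (fun x => wre p beta (u j x) (u (~~ j) x) * v j x
     + wmix p beta (u j x) (u (~~ j) x) * v (~~ j) x)) ->
  exists theta, forall j, aeq (v j) (fun x => theta * derive1 (u j) x).

Let hR : HV Rv := HV_Rv p1 beta0 Cu Cu' u0 decay_u ode.

(** Uniform form of [orbit_quotient]: if no radius works, a sequence of bad parameters tends to 0
    and contradicts it. *)
Lemma orbit_tangent (th : R) (c : bool -> R) (e : R) : 0 < e -> exists2 d : R, 0 < d &
  forall t, 0 < t <= d ->
    vh1 (vlin 1 (act (th * t) (fun j => c j * t) Rv) (-1) (vlin 1 Rv t (tangent u th c)))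
        (vlin 1 (act (th * t) (fun j => c j * t) Rv) (-1) (vlin 1 Rv t (tangent u th c))) <= e * t ^+ 2.
Proof.
move=> e0; apply: contrapT => H.
(* This factor ensures both a_n <= 1 and |th a_n| <= 1. *)
have q0 : 0 < (1 + `|th|)^-1 by rewrite invr_gt0 ltr_wpDr.
have /choice[a aP] n : exists t : R, 0 < t <= (1 + `|th|)^-1 * harmonic n /\
    e * t ^+ 2 < vh1 (vlin 1 (act (th * t) (fun j => c j * t) Rv) (-1) (vlin 1 Rv t (tangent u th c)))
        (vlin 1 (act (th * t) (fun j => c j * t) Rv) (-1) (vlin 1 Rv t (tangent u th c))).
  apply: contrapT => nH; apply: H; exists ((1 + `|th|)^-1 * harmonic n).
    by rewrite mulr_gt0// harmonic_gt0.
  by move=> t ht; rewrite leNgt; apply/negP => k; apply: nH; exists t.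
have har1 n : harmonic n <= 1 :> R by rewrite /harmonic invf_le1// ler1n.
have aq n : a n <= (1 + `|th|)^-1.
  by have [/andP[_ h] _] := aP n; apply: le_trans h _; rewrite ler_piMr// ltW.
have a0 n : 0 < a n by have [/andP[]] := aP n.
have a01 n : 0 < a n <= 1.
  by rewrite a0/=; apply: le_trans (aq n) _; rewrite invf_le1 ?lerDl// ltr_wpDr.
have tha n : `|th * a n| <= 1.
  rewrite normrM (gtr0_norm (a0 n)); have := aq n; rewrite -[leRHS]mul1r ler_pdivlMr ?ltr_wpDr//.
  by apply: le_trans; rewrite mulrC ler_pM2l// lerDr.
have ca : a n @[n --> \oo] --> (0 : R).
  apply: (@squeeze_cvgr _ _ _ _ (fun=> 0) (fun n => (1 + `|th|)^-1 * harmonic n)).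
  - by apply: nearW => n; rewrite ltW//=; have [/andP[]] := aP n.
  - exact: cvg_cst.
  - rewrite -[X in _ --> X](mulr0 (1 + `|th|)^-1); apply: cvgM; first exact: cvg_cst.
    exact: cvg_harmonic.
have hact n : HV (act (th * a n) (fun j => c j * a n) Rv) by exact: act_HV.
have hT : HV (tangent u th c).
  exact: HV_tangent (H1_u p1 beta0 Cu Cu' u0 decay_u ode) (H1_u1 p1 beta0 Cu Cu' u0 decay_u ode) th c.
pose Z n := vlin 1 (vlin (a n)^-1 (act (th * a n) (fun j => c j * a n) Rv) (- (a n)^-1) Rv)
  (-1) (tangent u th c).
have cZ : vh1 (Z n) (Z n) @[n --> \oo] --> (0 : R).
  have := @orbit_quotient R u Cu Cu' (decay_u1 p1 beta0 Cu Cu' u0 decay_u ode)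
    (decay_u2 p1 beta0 u0 decay_u ode) (H1_u p1 beta0 Cu Cu' u0 decay_u ode)
    (H1_u1 p1 beta0 Cu Cu' u0 decay_u ode) th c a a01 tha ca.
  exact.
have /(@filter_ex _ \oo)[n hn] : \forall n \near \oo, vh1 (Z n) (Z n) < e by exact: (cvgr_lt _ cZ).
have [_] := aP n; apply/negP; rewrite -leNgt.
have -> : vlin 1 (act (th * a n) (fun j => c j * a n) Rv) (-1) (vlin 1 Rv (a n) (tangent u th c)) =
    vlin (a n) (Z n) 0 (Z n).
  apply/funext => i; apply/funext => x; rewrite /Z /vlin /lin mul0r addr0; field.
  by rewrite gt_eqF.
have hZ : HV (Z n) := HV_lin 1 (-1) (HV_lin (a n)^-1 (- (a n)^-1) (hact n) hR) hT.
by rewrite vh1_sqr// !(mulr0, mul0r, addr0, expr0n)/= mulrC ler_wpM2r ?sqr_ge0// ltW.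
Qed.

(** The mass changes by 2 <w, R> to first order, so the factor 1 / 4 turns the penalty into (K + 1)
    <w, R>^2, the rank-one term of [B]. *)
Definition lyapunov U := action U + (K + 1) / 4 * (vip U U - vip Rv Rv) ^+ 2.

Lemma lyapunov_taylor (e : R) : 0 < e -> exists2 d : R, 0 < d & forall w, HV w -> vh1 w w <= d ->
  `|lyapunov (vlin 1 Rv 1 w) - lyapunov Rv - B w w| <= e * vh1 w w.
Proof.
move=> e0; have e2 : 0 < e / 2 by lra.
have [d1 d10 T] := action_taylor p1 beta0 Cu Cu' u0 decay_u ode e2.
have K1 : 0 < K + 1 by rewrite ltr_wpDl.
pose s := Num.min 1 (e / (4 * (K + 1))).
have s0 : 0 < s by rewrite lt_min ltr01 divr_gt0// mulr_gt0.
(* The crude bound [moment_le] carries the square of the number 4 of components. *)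
pose M := 16 * vip Rv Rv; have M0 : 0 <= M by rewrite mulr_ge0// vip_ge0.
pose d := Num.min d1 (Num.min s (s ^+ 2 / (M + 1))).
exists d; first by rewrite lt_min d10 lt_min s0/= divr_gt0 ?exprn_gt0// ltr_wpDl.
move=> w hw; rewrite le_min => /andP[w1]; rewrite le_min => /andP[w2 w3].
have := T w hw w1; rewrite /lyapunov subrr expr0n/= mulr0 addr0 (bilE _ _ _ K w).
have L := L2_Rv p1 beta0 Cu Cu' u0 decay_u ode.
have := moment_le L hw; rewrite /moment -/(vip w Rv) card_prod !card_bool.
rewrite vip_sqr// (vipC Rv w) !mulr1 !expr1n !mul1r.
have n0 := vip_ge0 w; have nv : vip w w <= vh1 w w by rewrite vh1E lerDl vdip_ge0.
set n := vip w w in n0 nv *; set rho := vip w Rv; set v := vh1 w w in w1 w2 w3 nv *.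
have -> : (2 * 2)%:R ^+ 2 * (vip Rv Rv * n) = M * n by rewrite /M; ring.
move=> r1; have rs : `|rho| <= s.
  apply: le_of_sqr; first exact: ltW.
  apply: le_trans r1 _; rewrite ler_pdivlMr ?ltr_wpDl// in w3; apply: le_trans w3.
  by have := ler_wpM2l M0 nv; lra.
have ns : n <= s by exact: le_trans nv w2.
have s1 : s * (4 * (K + 1)) <= e by rewrite -ler_pdivlMr ?mulr_gt0// ge_min lexx orbT.
(* With n the mass of w and rho = <w, R>, the penalty is (K + 1) (rho^2 + (rho + n / 4) n); the
   second summand is the error. *)
have h1 : `|(rho + n / 4) * n| <= 2 * s * n.
  rewrite normrM (ger0_norm n0) ler_wpM2r//; apply: le_trans (ler_normD _ _) _.
  by rewrite (@ger0_norm _ (n / 4)) ?divr_ge0//; lra.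
have h2 : `|(K + 1) * ((rho + n / 4) * n)| <= e / 2 * v.
  rewrite normrM (gtr0_norm K1).
  apply: le_trans (ler_wpM2l (ltW K1) h1) _.
  have := ler_wpM2l (ltW e2) nv; have := ler_wpM2r n0 s1; lra.
have e2n := ler_wpM2l (ltW e2) nv.
move: h2; rewrite !ler_norml => /andP[h3 h4] /andP[h5 h6].
have -> : forall A1 A2, A1 + (K + 1) / 4 * (vip Rv Rv + 2 * rho + n - vip Rv Rv) ^+ 2 - A2 -
  (hess w + (K + 1) * rho ^+ 2) = A1 - A2 - hess w + (K + 1) * ((rho + n / 4) * n).
  by move=> A1 A2; field.
by apply/andP; split; lra.
Qed.

(* A failing sequence, normalised in H^1, would converge to a unit vector of
   the kernel, that is to a tangent vector of the orbit; moving along the orbit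
   in that direction then brings the base point strictly closer. *)
Lemma lyapunov_coercive : exists2 c : R, 0 < c & forall w, HV w -> vh1 w w <= c ->
  (forall y th, vh1 w w <= 2 * vh1 (vlin 1 (vlin 1 Rv 1 w) (-1) (act y th Rv))
     (vlin 1 (vlin 1 Rv 1 w) (-1) (act y th Rv))) ->
  c * vh1 w w <= lyapunov (vlin 1 Rv 1 w) - lyapunov Rv.
Proof.
apply: contrapT => H.
have /choice[w wP] n : exists w, [/\ HV w, vh1 w w <= harmonic n,
    (forall y th, vh1 w w <= 2 * vh1 (vlin 1 (vlin 1 Rv 1 w) (-1) (act y th Rv))
     (vlin 1 (vlin 1 Rv 1 w) (-1) (act y th Rv))) &
    lyapunov (vlin 1 Rv 1 w) - lyapunov Rv < harmonic n * vh1 w w].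
  apply: contrapT => nH; apply: H; exists (harmonic n); first exact: harmonic_gt0.
  move=> w hw w1 w2; rewrite leNgt; apply/negP => k; apply: nH; by exists w.
have hw n : HV (w n) by case: (wP n).
have [C0 bW] := Wm_bdd p1 beta0 u0 decay_u; have mW := Wm_mble p beta Cu.
have sW := Wm_sym p beta u; have LR := L2_Rv p1 beta0 Cu Cu' u0 decay_u ode.
have K1 : 0 <= K + 1 by rewrite addr_ge0.
have Bge := bil_nonneg hessK.
(* A displacement of norm zero would give the Lyapunov increment the nonnegative value of [B],
   against the strict inequality. So normalisation is possible after shifting the index by [N0]. *)
have [N0 wpos] : exists N, forall n, (N <= n)%N -> 0 < vh1 (w n) (w n).
  have [d d0 T] := lyapunov_taylor ltr01.
  have hh : \forall n \near \oo, harmonic n < d by exact: (cvgr_lt _ (@cvg_harmonic R)).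
  have [N _ hN] := hh; exists N => n /hN hn.
  rewrite lt0r vh1_ge0 andbT; apply/eqP => z; have [_ wd _ wl] := wP n.
  have := T _ (hw n) (le_trans wd (ltW hn)).
  rewrite z !mulr0 in wl *; rewrite normr_le0 subr_eq0 => /eqP e.
  by have := Bge _ (hw n); rewrite -e leNgt wl.
pose v n := w (n + N0)%N; pose s n := Num.sqrt (vh1 (v n) (v n)).
have hv n : HV (v n) by exact: hw.
have sq n : s n ^+ 2 = vh1 (v n) (v n) by rewrite sqr_sqrtr// vh1_ge0.
have s0 n : 0 < s n by rewrite sqrtr_gt0; apply: wpos; rewrite leq_addl.
pose z n := vlin (s n)^-1 (v n) 0 (v n).
have hz n : HV (z n) := HV_lin _ _ (hv n) (hv n).
have vz n : v n = vlin (s n) (z n) 0 (z n).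
  apply/funext => i; apply/funext => x; rewrite /z /vlin /lin; field.
  by rewrite gt_eqF.
have z1 n : vh1 (z n) (z n) = 1.
  have := vh1_sqr (s n)^-1 0 (hv n) (hv n); rewrite -/(z n) => ->.
  by rewrite -sq; field; rewrite gt_eqF.
have Bz n : B (v n) (v n) = s n ^+ 2 * B (z n) (z n).
  by rewrite {1 2}vz (bil_sqr (K + 1) mW bW sW LR (s n) 0 (hz n) (hz n)); ring.
have vsmall e : 0 < e -> \forall n \near \oo, vh1 (v n) (v n) <= e.
  move=> e0.
  have hh : \forall n \near \oo, harmonic n < e by exact: (cvgr_lt _ (@cvg_harmonic R)).
  have [N _ hN] := hh; exists N => // n Nn; have [_ h _ _] := wP (n + N0)%N.
  by apply: le_trans h (ltW (hN _ _)); apply: leq_trans Nn (leq_addr _ _).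
have cB : B (z n) (z n) @[n --> \oo] --> (0 : R).
  apply/cvgrPdist_le => e e0; have e2 : 0 < e / 2 by lra.
  have [d d0 T] := lyapunov_taylor e2.
  have hh : \forall n \near \oo, harmonic n < e / 2 by exact: (cvgr_lt _ (@cvg_harmonic R)).
  have [N _ hN] := hh.
  near=> n.
  have nd : vh1 (v n) (v n) <= d by near: n; exact: vsmall.
  have Nn : (N <= n)%N by near: n; exact: nbhs_infty_ge.
  have {}hN := hN _ (leq_trans Nn (leq_addr N0 n)).
  have [_ _ _ wl] := wP (n + N0)%N; have := T _ (hv n) nd.
  rewrite ler_norml => /andP[k _]; rewrite sub0r normrN (ger0_norm (Bge _ (hz n))).
  rewrite -(ler_pM2l (exprn_gt0 2 (s0 n))) -Bz.
  rewrite -/(v n) in wl; rewrite sq.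
  have := ler_wpM2r (vh1_ge0 (v n)) (ltW hN).
  move: k wl; move: (lyapunov _) (lyapunov _) (B _ _) (vh1 _ _) (harmonic _) => *; lra.
have z1' n : vh1 (z n) (z n) <= 1 by rewrite z1.
have [Z hZ ZP] := bil_compact mW bW sW LR K1 (Wm_decay p1 beta0 u0 decay_u) Bge hz z1' cB.
have BZ : B Z Z = 0.
  have [C C0' hC] := bil_le mW bW LR K1.
  apply/eqP; rewrite eq_le Bge// andbT; apply/ler_addgt0Pl => e e0.
  have hB : \forall n \near \oo, B (z n) (z n) < e / 4.
    by apply: (cvgr_lt _ cB); rewrite divr_gt0.
  have [N _ hN] := hB.
  have e1 : 0 < e / 4 / (C + 1) by rewrite !divr_gt0// ltr_wpDl.
  have [n Nn hn] := ZP _ N e1.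
  have hD := HV_lin 1 (-1) hZ (hz n).
  (* Writing Z as a difference of Z - z_n and - z_n lets [bil_parallelogram] bound the form at Z by
     quantities that tend to 0. *)
  have -> : Z = vlin 1 (vlin 1 Z (-1) (z n)) (-1) (vlin (-1) (z n) 0 (z n)).
    by apply/funext => i; apply/funext => x; rewrite /vlin /lin; ring.
  have hm := HV_lin (-1) 0 (hz n) (hz n).
  rewrite addr0; apply: le_trans (bil_parallelogram mW bW sW LR Bge hD hm) _.
  rewrite (bil_sqr (K + 1) mW bW sW LR (-1) 0 (hz n) (hz n)).
  have b1 := hC _ hD; have b2 := ler_wpM2l C0' hn.
  have b3 : C * (e / 4 / (C + 1)) <= e / 4.
    rewrite mulrA ler_pdivrMr ?ltr_wpDl// mulrC ler_pM2l ?divr_gt0//; lra.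
  have := hN _ Nn; lra.
have [th hth] := kernel_real p1 beta0 Cu Cu' u0 decay_u ode hessK nondeg hZ BZ.
have /choice[c hc] j := kernel_imag p1 beta0 Cu Cu' u0 decay_u ode hessK nondeg j hZ BZ.
pose T := tangent u (- th) c.
have hT : HV T.
  exact: HV_tangent (H1_u p1 beta0 Cu Cu' u0 decay_u ode) (H1_u1 p1 beta0 Cu Cu' u0 decay_u ode) _ c.
have ZT i : aeq (Z i) (T i).
  case: i => j []; rewrite /T /tangent/=; first exact: hc.
  by rewrite opprK; exact: hth.
have ZT0 := vh1_sub_null hZ hT ZT.
(* The squared distance to the competitor is at most 2 s^2 / 16 + 2 s^2 / 16 = s^2 / 4, less than
   the s^2 / 2 required by near-optimality of the base point. *)
have e16 : 0 < 16^-1 :> R by [].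
have [d d0 oT] := orbit_tangent (- th) c e16.
have [N _ hN] := vsmall (d ^+ 2) (exprn_gt0 2 d0).
have e32 : 0 < 64^-1 :> R by [].
have [n Nn hn] := ZP _ N e32.
have sd : 0 < s n <= d.
  rewrite s0/= -(@ler_pXn2r _ 2)// ?nnegrE ?(ltW (s0 n)) ?(ltW d0)// sq; exact: hN.
have := oT _ sd; set Y := act _ _ _; set E := vlin 1 Y _ _ => hE.
have hY : HV Y by exact: act_HV.
have hEE : HV E := HV_lin 1 (-1) hY (HV_lin 1 (s n) hR hT).
have [_ _ near_opt _] := wP (n + N0)%N.
have := near_opt (- th * s n) (fun j => c j * s n); rewrite -/(v n) -/Y.
have hZz := HV_lin 1 (-1) hZ (hz n); have hZT := HV_lin 1 (-1) hZ hT.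
pose F := vlin 1 (vlin 1 Z (-1) (z n)) (-1) (vlin 1 Z (-1) T).
have hF : HV F := HV_lin 1 (-1) hZz hZT.
have -> : vlin 1 (vlin 1 Rv 1 (v n)) (-1) Y = vlin (-1) E (- s n) F.
  rewrite vz; apply/funext => i; apply/funext => x; rewrite /E /F /T /vlin /lin; ring.
rewrite -sq; apply/negP; rewrite -ltNge.
have g1 := vh1_lin_le (-1) (- s n) hEE hF.
have g2 := vh1_lin_le 1 (-1) hZz hZT; rewrite -/F ZT0 in g2.
have g3 : vh1 F F <= 16^-1 by apply: le_trans g2 _; rewrite sqrrN expr1n; lra.
have ss : 0 < s n ^+ 2 by exact: exprn_gt0.
have g4 := ler_wpM2l (ltW ss) g3.
rewrite !sqrrN expr1n in g1.
by move: g1 hE g4 ss; move: (vh1 _ _) (vh1 E E) (vh1 F F) (s n ^+ 2) => *; lra.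
Unshelve. all: by end_near.
Qed.

End Coercivity.

(** * The H^1 distance to the orbit *)

Section OrbitDistance.
Context {R : realType}.
Local Notation I := (bool * bool)%type.
Implicit Types (U V w : I -> R -> R).

Definition vnorm U := Num.sqrt (vh1 U U).

Lemma vnorm_ge0 U : 0 <= vnorm U.
Proof. exact: sqrtr_ge0. Qed.

Lemma vnorm_sqr U : vnorm U ^+ 2 = vh1 U U.
Proof. by rewrite sqr_sqrtr ?vh1_ge0. Qed.

Lemma vnorm_subC U V : HV U -> HV V -> vnorm (vlin 1 U (-1) V) = vnorm (vlin 1 V (-1) U).
Proof.
move=> hU hV; congr Num.sqrt; rewrite (vh1_sqr 1 (-1) hU hV) (vh1_sqr 1 (-1) hV hU) (vh1C V U).
ring.
Qed.

Lemma abs_sub_lt (a b v e : R) : a <= b + v -> b <= a + v -> v < e -> `|a - b| < e.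
Proof. by move=> ? ? ?; rewrite ltr_norml; apply/andP; split; lra. Qed.

Lemma mem_min_max (a m b : R) : a <= m -> m <= b -> Num.min a b <= m <= Num.max a b.
Proof. by move=> am mb; rewrite ge_min am le_max mb orbT. Qed.

(** Expands the square of (|V| + e) U - (|U| + e) V; the positive e avoids dividing by a zero norm
    and is then sent to 0. *)
Lemma vh1_CS U V : HV U -> HV V -> vh1 U V <= vnorm U * vnorm V.
Proof.
move=> hU hV; have a0 := vnorm_ge0 U; have b0 := vnorm_ge0 V.
have key e : 0 < e -> vh1 U V <= (vnorm U + e) * (vnorm V + e).
  move=> e0; have a1 : 0 < vnorm U + e by rewrite ltr_wpDl.
  have b1 : 0 < vnorm V + e by rewrite ltr_wpDl.
  have := vh1_ge0 (vlin (vnorm V + e) U (- (vnorm U + e)) V); rewrite vh1_sqr// -!vnorm_sqr.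
  set a := vnorm U in a0 a1 *; set b := vnorm V in b0 b1 *; set s := vh1 U V => h.
  have k1 : a ^+ 2 <= (a + e) ^+ 2 by rewrite lerXn2r ?nnegrE ?(ltW a1)// lerDl ltW.
  have k2 : b ^+ 2 <= (b + e) ^+ 2 by rewrite lerXn2r ?nnegrE ?(ltW b1)// lerDl ltW.
  have k3 := ler_wpM2l (sqr_ge0 (b + e)) k1; have k4 := ler_wpM2l (sqr_ge0 (a + e)) k2.
  have ab : 0 < (a + e) * (b + e) by exact: mulr_gt0.
  by rewrite -(ler_pM2l ab); lra.
apply/ler_addgt0Pl => e e0.
set a := vnorm U in a0 key *; set b := vnorm V in b0 key *.
pose d := Num.min 1 (e / (a + b + 1)).
have q0 : 0 < a + b + 1 by rewrite ltr_wpDl// addr_ge0.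
have d0 : 0 < d by rewrite lt_min ltr01 divr_gt0.
have d1 : d <= 1 by rewrite ge_min lexx.
have d2 : d * (a + b + 1) <= e by rewrite -ler_pdivlMr// ge_min lexx orbT.
apply: le_trans (key _ d0) _.
by have := ler_wpM2l (ltW d0) d1; lra.
Qed.

Lemma vnorm_triangle U V : HV U -> HV V -> vnorm (vlin 1 U 1 V) <= vnorm U + vnorm V.
Proof.
move=> hU hV; have s0 : 0 <= vnorm U + vnorm V by rewrite addr_ge0 ?vnorm_ge0.
apply: le_trans (ler_norm _) _; apply: le_of_sqr => //.
rewrite vnorm_sqr vh1_sqr// -!vnorm_sqr; have := vh1_CS hU hV.
by move: (vnorm U) (vnorm V) (vh1 U V) => *; lra.
Qed.

Variable r : I -> R -> R.
Hypothesis hr : HV r.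

Definition orbit_gap U y th := vnorm (vlin 1 U (-1) (act y th r)).
(** The phases range over all reals, so that composing with a symmetry stays within the index
    set. *)
Definition orbit_distance U := inf [set d | exists y th, d = orbit_gap U y th].

Let gap_inf U : has_inf [set d | exists y th, d = orbit_gap U y th].
Proof.
split; first by exists (orbit_gap U 0 (fun=> 0)), 0, (fun=> 0).
by exists 0 => _ [y [th ->]]; exact: vnorm_ge0.
Qed.

Lemma orbit_distance_le U y th : orbit_distance U <= orbit_gap U y th.
Proof. by apply: ge_inf; [have [] := gap_inf U|exists y, th]. Qed.

Lemma orbit_distance_ge U l : (forall y th, l <= orbit_gap U y th) -> l <= orbit_distance U.
Proof.
move=> h; apply: lb_le_inf; first by have [] := gap_inf U.
by move=> _ [y [th ->]].
Qed.

Lemma orbit_distance_ge0 U : 0 <= orbit_distance U.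
Proof. by apply: orbit_distance_ge => y th; exact: vnorm_ge0. Qed.

Lemma orbit_distance_lt U e : orbit_distance U < e -> exists y th, orbit_gap U y th < e.
Proof.
rewrite -subr_gt0 => e0; have [_ [y [th ->]]] := inf_adherent e0 (gap_inf U).
by rewrite addrC subrK; exists y, th.
Qed.

Lemma orbit_distance_lipschitz U V : HV U -> HV V ->
  orbit_distance U <= orbit_distance V + vnorm (vlin 1 U (-1) V).
Proof.
move=> hU hV; rewrite -lerBlDr; apply: orbit_distance_ge => y th; rewrite lerBlDr.
apply: le_trans (orbit_distance_le U y th) _.
have hA : HV (act y th r) by exact: act_HV.
rewrite addrC /orbit_gap; have := vnorm_triangle (HV_lin 1 (-1) hU hV) (HV_lin 1 (-1) hV hA).
apply: le_trans; rewrite le_eqVlt; apply/orP; left; apply/eqP; congr vnorm.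
by apply/funext => i; apply/funext => x; rewrite /vlin /lin; ring.
Qed.

(** Symmetries act by isometries and their parameters add up. *)
Lemma orbit_gap_act U y th y' th' : HV U ->
  orbit_gap (act (- y) (fun j => - th j) U) y' th' = orbit_gap U (y + y') (fun j => th j + th' j).
Proof.
move=> hU; set V := act _ _ _; have hV : HV V by exact: act_HV.
have hA : HV (act y' th' r) by exact: act_HV.
rewrite /orbit_gap /vnorm -(act_vh1 y th (HV_lin 1 (-1) hV hA)) act_vlin actD; congr Num.sqrt.
have -> : act y th V = U; last by [].
rewrite /V actD subrr -[RHS]act0; congr act.
by apply/funext => j; rewrite subrr.
Qed.

End OrbitDistance.

(** * From coercivity to stability *)

Section Stability.
Context {R : realType}.
Local Notation I := (bool * bool)%type.
Implicit Types (U V w : I -> R -> R).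
Variables (p beta K : R) (u : bool -> R -> R).
Hypotheses (p1 : 1 <= p) (beta0 : 0 < beta) (K0 : 0 <= K).
Local Notation Rv := (real_state u).
Local Notation lyap := (lyapunov p beta u K).
Local Notation dist := (orbit_distance Rv).
Hypothesis hR : HV Rv.
Hypothesis upper : exists C d : R, [/\ 0 <= C, 0 < d & forall w, HV w -> vh1 w w <= d ->
  lyap (vlin 1 Rv 1 w) - lyap Rv <= C * vh1 w w].
Hypothesis coercive : exists2 c : R, 0 < c & forall w, HV w -> vh1 w w <= c ->
  (forall y th, vh1 w w <= 2 * vh1 (vlin 1 (vlin 1 Rv 1 w) (-1) (act y th Rv))
     (vlin 1 (vlin 1 Rv 1 w) (-1) (act y th Rv))) ->
  c * vh1 w w <= lyap (vlin 1 Rv 1 w) - lyap Rv.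

Lemma lyapunov_act y th U : HV U -> lyap (act y th U) = lyap U.
Proof.
by move=> hU; rewrite /lyapunov /vaction (act_vip y th hU) (act_en p1 beta0 y th hU).
Qed.

(** The inverse symmetry brings U near R itself, where the coercivity estimate is stated; the
    Lyapunov function does not see this move. *)
Lemma orbit_displacement U y th : HV U -> exists w, [/\ HV w,
  vlin 1 Rv 1 w = act (- y) (fun j => - th j) U & vh1 w w = orbit_gap Rv U y th ^+ 2].
Proof.
move=> hU; pose V := act (- y) (fun j => - th j) U; have hV : HV V by exact: act_HV.
exists (vlin 1 V (-1) Rv); split; first exact: HV_lin.
  by apply/funext => i; apply/funext => x; rewrite /vlin /lin -/V; ring.
have := orbit_gap_act hR y th 0 (fun=> 0) hU; rewrite /orbit_gap act0 addr0 => e.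
rewrite -vnorm_sqr e; congr (vnorm (vlin _ _ _ (act _ _ _)) ^+ 2).
by apply/funext => j; rewrite addr0.
Qed.

(** The infimum need not be attained, so a point within 5 / 4 of it is used: (5 / 4)^2 <= 2 fits the
    factor in the coercivity hypothesis. A positive distance is what makes such a point exist. *)
Lemma orbit_distance_coercive : exists c m : R, [/\ 0 < c, 0 < m & forall U, HV U ->
  0 < dist U <= m -> c * dist U ^+ 2 <= lyap U - lyap Rv].
Proof.
have [c c0 hc] := coercive; pose m := Num.sqrt c / 2.
have sc0 : 0 < Num.sqrt c by rewrite sqrtr_gt0.
have mc : m ^+ 2 = c / 4 by rewrite /m exprMn sqr_sqrtr ?(ltW c0)//; field.
exists c, m; split => //; first by rewrite divr_gt0.
move=> U hU /andP[D0 Dm]; have Dlt : dist U < 5 / 4 * dist U by lra.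
have [y [th gD]] := orbit_distance_lt Dlt; have [w [hw Rw ww]] := orbit_displacement y th hU.
have sqle (a b : R) : 0 <= a -> a <= b -> a ^+ 2 <= b ^+ 2.
  by move=> a0 ab; rewrite lerXn2r ?nnegrE// (le_trans a0).
have g0 : 0 <= orbit_gap Rv U y th by exact: vnorm_ge0.
have k1 := sqle _ _ g0 (ltW gD); have k2 := sqle _ _ (ltW D0) Dm; rewrite mc in k2.
have k3 := sqle _ _ (ltW D0) (orbit_distance_le Rv U y th).
have k4 : (5 / 4 * dist U) ^+ 2 <= 2 * dist U ^+ 2 by have := sqr_ge0 (dist U); lra.
have wc : vh1 w w <= c by rewrite ww; lra.
have := hc w hw wc; rewrite Rw lyapunov_act// ww => h.
apply: le_trans (h _); first by rewrite ler_pM2l.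
move=> y' th'; rewrite -vnorm_sqr -/(orbit_gap _ _ _ _) orbit_gap_act//.
have k5 := sqle _ _ (ltW D0) (orbit_distance_le Rv U (y + y') (fun j => th j + th' j)).
exact: (le_trans k1 (le_trans k4 (ler_wpM2l (ler0n R 2) k5))).
Qed.

(* The conserved Lyapunov function keeps the distance to the orbit out of an
   interval, which a continuous function of time cannot jump over. *)
Lemma orbit_distance_stable (e : R) : 0 < e -> exists2 delta : R, 0 < delta &
  forall f : R -> I -> R -> R, (forall t, 0 <= t -> HV (f t)) ->
  (forall t, 0 <= t -> vnorm (vlin 1 (f s) (-1) (f t))
     @[s --> within [set s | 0 <= s] (nbhs t)] --> (0 : R)) ->
  (forall t, 0 <= t -> lyap (f t) = lyap (f 0)) -> dist (f 0) < delta ->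
  forall t, 0 <= t -> dist (f t) <= e.
Proof.
move=> e0; have [c [m0 [c0 m00 hc]]] := orbit_distance_coercive.
have [C [d [C0 d0 hC]]] := upper.
pose m := Num.min e m0; have mp : 0 < m by rewrite lt_min e0.
have mhalf : m / 2 <= m by rewrite ler_pdivrMr// ler_peMr ?ler1n// ltW.
have me : m <= e by rewrite ge_min lexx.
have mm : m <= m0 by rewrite ge_min lexx orbT.
(* An initial displacement with square below this raises the Lyapunov function by at most c m^2 /
   8. *)
have q0 : 0 < Num.min d (c * (m ^+ 2 / 8) / (C + 1)).
  by rewrite lt_min d0 !(mulr_gt0, invr_gt0) ?exprn_gt0// ltr_wpDl.
pose delta := Num.min (m / 2) (Num.sqrt (Num.min d (c * (m ^+ 2 / 8) / (C + 1)))).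
exists delta; first by rewrite lt_min divr_gt0//= sqrtr_gt0.
move=> f hf cf lf f0.
have f0m : dist (f 0) < m / 2 by apply: lt_le_trans f0 _; rewrite ge_min lexx.
have H0 : lyap (f 0) - lyap Rv <= c * (m ^+ 2 / 8).
  have [y [th g]] := orbit_distance_lt f0; have h0 := hf 0 (lexx 0).
  have [w [hw Rw ww]] := orbit_displacement y th h0.
  have g2 : vh1 w w <= Num.min d (c * (m ^+ 2 / 8) / (C + 1)).
    rewrite ww -[leRHS]sqr_sqrtr ?(ltW q0)// lerXn2r ?nnegrE ?sqrtr_ge0//.
    by apply: le_trans (ltW g) _; rewrite ge_min lexx orbT.
  move: g2; rewrite le_min => /andP[g1 g2].
  have := hC w hw g1; rewrite Rw lyapunov_act// => h; apply: le_trans h _.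
  rewrite ler_pdivlMr ?ltr_wpDl// in g2; apply: le_trans g2.
  by have := vh1_ge0 w; lra.
(* Coercivity gives a squared distance of at most m^2 / 8, strictly below (m / 2)^2, so no value in
   [m / 2, m] is taken. *)
have gap t : 0 <= t -> dist (f t) <= m -> dist (f t) < m / 2.
  move=> t0 tm; have D0 := orbit_distance_ge0 Rv (f t).
  have [->|Dn] := eqVneq (dist (f t)) 0; first by rewrite divr_gt0.
  have Dp : 0 < dist (f t) <= m0 by rewrite lt0r Dn D0 (le_trans tm).
  have := hc _ (hf t t0) Dp; rewrite (lf t t0) => h; have := le_trans h H0; rewrite (ler_pM2l c0) => k.
  rewrite ltNge; apply/negP => j.
  have : (m / 2) ^+ 2 <= dist (f t) ^+ 2 by rewrite lerXn2r ?nnegrE ?divr_ge0// ltW.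
  move=> /le_trans/(_ k).
  have -> : (m / 2) ^+ 2 = m ^+ 2 / 4 by field.
  by rewrite (ler_pM2l (exprn_gt0 2 mp)) lef_pV2 ?posrE// ler_nat.
(* Reflecting time extends the distance to a continuous function on the whole line. *)
pose h (t : R) : R := dist (f `|t|).
have ch : continuous h.
  move=> t; apply/cvgrPdist_lt => a a0.
  have := cf `|t| (normr_ge0 t); move=> /cvgrPdist_lt/(_ a a0).
  rewrite near_withinE => /nbhs_ballP[b b0 hb].
  apply/nbhs_ballP; exists b => // s; rewrite /ball/= => ts.
  have /hb : ball `|t| b `|s| by rewrite /ball/=; apply: le_lt_trans (ler_dist_dist _ _) ts.
  move=> /(_ (normr_ge0 s)); rewrite sub0r normrN ger0_norm ?vnorm_ge0// => k.
  have ht := hf _ (normr_ge0 t); have hs := hf _ (normr_ge0 s).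
  have l1 := orbit_distance_lipschitz hR ht hs; rewrite (vnorm_subC ht hs) in l1.
  exact: (abs_sub_lt l1 (orbit_distance_lipschitz hR hs ht) k).
move=> t t0; rewrite leNgt; apply/negP => te.
have b1 : h 0 <= m by rewrite /h normr0; exact: le_trans (ltW f0m) mhalf.
have b2 : m <= h t by rewrite /h (ger0_norm t0); exact: le_trans me (ltW te).
have [s] := IVT t0 (continuous_subspaceT ch) (mem_min_max b1 b2).
rewrite in_itv/= => /andP[s0 _]; rewrite /h (ger0_norm s0) => hs.
have := gap s s0; rewrite hs lexx => /(_ isT).
by rewrite ltNge mhalf.
Qed.

End Stability.

(** * Translation between the stated orbit distance and the real one *)

Section OrbitPoints.
Context {R : realType}.
Implicit Types (V : @pairC R) (r : @pairR R).

Definition component r (j : bool) := if j then r.2 else r.1.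

Lemma parts_complexify r : parts (complexify r) = real_state (component r).
Proof. by apply/funext => -[[] []]. Qed.

Lemma parts_orbit_point r y t1 t2 : parts (orbit_point r y t1 t2) =
  act y (fun j => if j then t2 else t1) (real_state (component r)).
Proof.
apply/funext => -[[] []]; apply/funext => x;
  rewrite /act /turn /vaff /lin /real_state /component /parts/= !mul1r; ring.
Qed.

(** Periodicity reconciles arbitrary real phases with the range [0, 2 pi) of [orbit_dist]. *)
Lemma act_mod y th U : exists th' : bool -> R,
  (forall j, 0 <= th' j < 2 * pi) /\ act y th U = act y th' U.
Proof.
have p0 : 0 < 2 * pi :> R by rewrite mulr_gt0// pi_gt0.
have key (t : R) : exists s : R, [/\ 0 <= s < 2 * pi, cos s = cos t & sin s = sin t].
  pose k := Num.floor (t / (2 * pi)); exists (t - k%:~R * (2 * pi)).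
  have := floor_itv (t / (2 * pi)); rewrite -/k ler_pdivlMr// ltr_pdivrMr// intrD mulr1z => /andP[k1 k2].
  have pk (f : R -> R) : periodic f (pi *+ 2) -> f (t - k%:~R * (2 * pi)) = f t.
    move=> per; rewrite [2 * pi]mulr_natl.
    case: (k) => n.
      by rewrite -[in RHS](subrK (n%:R * (pi *+ 2)) t) mulr_natl (periodicn per).
    by rewrite NegzE mulrNz mulNr opprK mulr_natl (periodicn per).
  split; first by apply/andP; split; lra.
    exact: (pk cos (@cosD2pi R)).
  exact: (pk sin (@sinD2pi R)).
have /choice[th' hth] := fun j => key (th j); exists th'.
split=> [j|]; first by have [] := hth j.
apply/funext => -[j b]; have [_ c s] := hth j.
by rewrite /act /turn/= c s.
Qed.

Lemma H1norm_vnorm V : H1xH1 V -> H1norm V = vnorm (parts V).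
Proof.
move=> hV; rewrite -[LHS]ger0_norm ?H1norm_ge0// -sqrtr_sqr.
by rewrite H1norm_sqr.
Qed.

Lemma H1xH1_sub V V' : H1xH1 V -> H1xH1 V' -> H1xH1 (pair_sub V V').
Proof.
move=> /H1xH1P h /H1xH1P h'; apply/H1xH1P; rewrite parts_sub; exact: HV_lin.
Qed.

Variable r : @pairR R.
Local Notation Rv := (real_state (component r)).
Hypothesis hR : HV Rv.

Lemma orbit_pointE V y t1 t2 : H1xH1 V -> H1norm (pair_sub V (orbit_point r y t1 t2)) =
  orbit_gap Rv (parts V) y (fun j => if j then t2 else t1).
Proof.
move=> hV; rewrite H1norm_vnorm; first by rewrite parts_sub parts_orbit_point.
by apply: H1xH1_sub => //; apply/H1xH1P; rewrite parts_orbit_point; exact: act_HV.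
Qed.

Lemma orbit_dist_lt V (e : R) : H1xH1 V -> (orbit_dist r V < e%:E)%E -> orbit_distance Rv (parts V) < e.
Proof.
move=> hV /ereal_inf_lt[_ [y [t1 [t2 [_ _ ->]]]]]; rewrite lte_fin orbit_pointE//.
exact: le_lt_trans (orbit_distance_le _ _ _ _).
Qed.

Lemma orbit_dist_le V (e : R) : H1xH1 V -> orbit_distance Rv (parts V) < e -> (orbit_dist r V <= e%:E)%E.
Proof.
move=> hV /orbit_distance_lt[y [th g]]; have [th' [ht e']] := act_mod y th Rv.
have E : (fun j : bool => if j then th' true else th' false) = th' by apply/funext => -[].
apply: (@le_trans _ _ (orbit_gap Rv (parts V) y th)%:E); last by rewrite lee_fin ltW.
apply: ereal_inf_lbound; exists y, (th' false), (th' true); split => //.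
congr (_%:E); rewrite (orbit_pointE y (th' false) (th' true) hV) E.
exact: (congr1 (fun X => vnorm (vlin 1 (parts V) (-1) X)) e').
Qed.

End OrbitPoints.

(** * Consequences of the hypotheses on the ground state, and the conclusion *)

Section GroundState.
Context {R : realType}.
Implicit Types (V : @pairC R).
Variables (p beta : R) (r : @pairR R).
Hypotheses (p1 : 1 <= p) (beta0 : 0 < beta).
Local Notation u := (component r).
Local Notation Rv := (real_state u).

Lemma regular_profile_C1 (f : R -> R) : regular_profile f ->
  [/\ C1 f, C1 (derive1 f), forall x, 0 <= f x & edecay f].
Proof.
case=> -[d1 d2 c2] _ f0 _ df; split; [split; first exact: d1|split; [exact: d2|exact: c2]|exact: f0|exact: df].
by move=> x; apply/differentiable_continuous/derivable1_diffP.
Qed.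

Lemma nlin_continuous (f g : R -> R) : continuous f -> continuous g -> (forall x, 0 <= f x) ->
  (forall x, 0 <= g x) -> continuous (fun x => nlin p beta (f x) (g x)).
Proof.
move=> cf cg f0 g0.
have pc (h : R -> R) s : continuous h -> (forall x, 0 <= h x) -> 0 < s -> continuous (fun x => h x `^ s).
  move=> ch h0 s0; have -> : (fun x => h x `^ s) = (fun x => `|h x| `^ s).
    by apply/funext => x; rewrite ger0_norm.
  move=> x; apply: (@continuous_comp _ _ _ h (fun y : R => `|y| `^ s)); first exact: ch.
  exact: powR_norm_continuous s0 _.
have q0 : 0 < p := lt_le_trans ltr01 p1.
have [q1 q2] : 0 < 2 * p + 1 /\ 0 < p + 1 by split; lra.
move=> x; apply: cvgD; first exact: pc cf f0 q1 x.
apply: cvgM; last exact: pc cg g0 q2 x.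
by apply: cvgM; [exact: cvg_cst|exact: pc cf f0 q0 x].
Qed.

Lemma ground_state_ode : elliptic_solution p beta r -> (forall j, C1 (u j)) -> (forall j, C1 (derive1 (u j))) ->
  (forall j x, 0 <= u j x) ->
  forall j x, derive1 (derive1 (u j)) x = 2 * (u j x - nlin p beta (u j x) (u (~~ j) x)).
Proof.
move=> [_ _ _ _ [w1 w2]] Cu Cu' u0 j.
have wj : weak_elliptic (u j) (fun x => nlin p beta (u j x) (u (~~ j) x)).
  by case: j; rewrite /nlin /component/=; [exact: w2|exact: w1].
apply: (weak_ode (Cu j) (Cu' j) _ wj).
exact: nlin_continuous (C1_continuous (Cu j)) (C1_continuous (Cu (~~ j))) (u0 j) (u0 (~~ j)).
Qed.

Lemma nondegenerate_kernel : nondegenerate_state p beta r -> (forall j, C1 (u j)) ->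
  forall v : bool -> R -> R, (forall j, H1 (v j)) ->
  (forall j, weak_elliptic (v j) (fun x => wre p beta (u j x) (u (~~ j) x) * v j x
     + wmix p beta (u j x) (u (~~ j) x) * v (~~ j) x)) ->
  exists theta, forall j, aeq (v j) (fun x => theta * derive1 (u j) x).
Proof.
move=> [_ nd] Cu v hv wv.
have Du j : aeq (wderiv (u j)) (derive1 (u j)).
  have wu := C1_weak_deriv (Cu j).
  exact: weak_deriv_unique (xgetI (fun=> 0) (x := derive1 (u j)) wu) wu.
have [|th [h1 h2]] := nd (v false, v true).
  split; [exact: (iffRL (H1P _) (hv false))|exact: (iffRL (H1P _) (hv true))|exact: wv false|].
  have := wv true; congr weak_elliptic; apply/funext => x /=.
  by rewrite /wre /wmix /component/=; ring.
exists th => -[].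
  by apply: ae_mono (ae_and h2 (Du true)) => x /= [/eqP]; rewrite subr_eq0 => /eqP -> ->.
by apply: ae_mono (ae_and h1 (Du false)) => x /= [/eqP]; rewrite subr_eq0 => /eqP -> ->.
Qed.

Lemma ground_state_mass : HV Rv -> nonzero r -> 0 < vip Rv Rv.
Proof.
move=> hR nz; rewrite lt0r vip_ge0 andbT; apply/eqP => z; apply: nz.
have key j : aeq (u j) (fun=> 0).
  apply: (ip_eq0 (H1_L2 (hR (j, false)))); apply/eqP; rewrite eq_le ip_ge0 andbT.
  by rewrite -z; exact: (coordinate_le Rv (j, false)).
by split; [exact: (key false)|exact: (key true)].
Qed.

Lemma energy_minimizer_en : HV Rv -> energy_minimizer p beta r ->
  forall U, HV U -> vip U U = vip Rv Rv -> en p beta Rv <= en p beta U.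
Proof.
move=> hR hmin U hU UR.
have hc : H1xH1 (complexify r) by apply/H1xH1P; rewrite parts_complexify.
have hV : H1xH1 (of_parts U) by apply/H1xH1P; rewrite of_partsK.
have e1 : energy p beta (complexify r) = en p beta Rv by rewrite -parts_complexify; exact: energyE p1 beta0 hc.
have e2 : energy p beta (of_parts U) = en p beta U.
  exact: etrans (energyE p1 beta0 hV) (congr1 (en p beta) (of_partsK U)).
have L2n V : H1xH1 V -> L2norm V = Num.sqrt (vip (parts V) (parts V)).
  move=> hV'; have h := iffLR (H1xH1P V) hV'.
  rewrite -(L2norm_sqr (fun i => H1_L2 (h i))) sqrtr_sqr.
  rewrite ger0_norm; first by [].
  exact: sqrtr_ge0.
have UV : L2norm (of_parts U) = L2norm (complexify r).
  apply: etrans (L2n _ hV) (etrans (congr1 Num.sqrt _) (esym (L2n _ hc))).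
  apply: etrans (congr1 (fun X => vip X X) (of_partsK U)) _.
  exact: etrans UR (esym (congr1 (fun X => vip X X) (parts_complexify r))).
have hm : (energy p beta (complexify r))%:E = _ := hmin.
have h : ((energy p beta (complexify r))%:E <= (energy p beta (of_parts U))%:E)%E.
  by rewrite [leLHS]hm; apply: ereal_inf_lbound; exists (of_parts U).
have le_congr (a b c d : R) : a = c -> b = d -> a <= b -> c <= d by move=> -> ->.
by apply: le_congr e1 e2 _; rewrite lee_fin in h.
Qed.

End GroundState.

Theorem corollary1p4 (R : realType) (p beta : R) (r : (R -> R) * (R -> R))
  (hbeta : 0 < beta) (hp : 1 <= p < 2)
  (hCauchy : cauchy_well_posed p beta)
  (hground : ground_state p beta r)
  (hreg1 : regular_profile r.1) (hreg2 : regular_profile r.2)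
  (hmin : energy_minimizer p beta r)
  (hnondeg : nondegenerate_state p beta r) :
  orbitally_stable p beta r.
Proof.
have /andP[p1 p2] := hp.
have [ell nz _] := hground.
have reg j : regular_profile (component r j) by case: j.
have Cu j : C1 (component r j) by case: (regular_profile_C1 (reg j)).
have Cu' j : C1 (derive1 (component r j)) by case: (regular_profile_C1 (reg j)).
have u0 j : forall x, 0 <= component r j x by case: (regular_profile_C1 (reg j)).
have du j : edecay (component r j) by case: (regular_profile_C1 (reg j)).
have ode := ground_state_ode p1 ell Cu Cu' u0.
have hR := HV_Rv p1 hbeta Cu Cu' u0 du ode.
have M0 := ground_state_mass hR nz.
have [K K0 hess0] := hess_nonneg p1 p2 hbeta Cu Cu' u0 du ode (energy_minimizer_en p1 hbeta hR hmin) M0.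
have co := lyapunov_coercive p1 hbeta Cu Cu' u0 du ode K0 hess0 (nondegenerate_kernel hnondeg Cu).
(* The Lyapunov increment is [B] plus a controlled error, and [B] is bounded on H^1. *)
have up : exists C d : R, [/\ 0 <= C, 0 < d & forall w, HV w -> vh1 w w <= d ->
    lyapunov p beta (component r) K (vlin 1 (real_state (component r)) 1 w)
    - lyapunov p beta (component r) K (real_state (component r)) <= C * vh1 w w].
  have [d d0 T] := lyapunov_taylor p1 hbeta Cu Cu' u0 du ode K0 ltr01.
  have [C0 bW] := Wm_bdd p1 hbeta u0 du; have mW := Wm_mble p beta Cu.
  have K1 : 0 <= K + 1 by rewrite addr_ge0.
  have [C C0' hC] := bil_le mW bW (L2_Rv p1 hbeta Cu Cu' u0 du ode) K1.
  exists (C + 1), d; split => //; first by rewrite addr_ge0.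
  move=> w hw wd; have := T w hw wd; rewrite ler_norml => /andP[_ k]; have := hC w hw.
  rewrite lerBlDr in k => j; apply: le_trans k _.
  by rewrite mulrDl [leRHS]addrC lerD2l.
move=> eps e0; have e2 : 0 < eps / 2 by rewrite divr_gt0.
(* The successive losses of strictness, from distance to [orbit_dist] and then to the supremum, use
   eps / 4 < eps / 2 < eps. *)
have e4 : 0 < eps / 4 by rewrite divr_gt0.
have [delta d0 stable] := orbit_distance_stable p1 hbeta hR up co e4.
exists delta => // Psi0 hPsi0 dPsi0 Psi hPsi.
have [_ _ /(_ _ hPsi) cons] := hCauchy Psi0 hPsi0.
have [[hH hC _ _] [ae1 ae2]] := hPsi.
have hH' t : 0 <= t -> HV (parts (Psi t)) by move=> /hH /H1xH1P.
have h0 := iffLR (H1xH1P _) hPsi0.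
have main t : 0 <= t -> orbit_distance (real_state (component r)) (parts (Psi t)) <= eps / 4.
  apply: (stable (fun t => parts (Psi t))) => //.
  - move=> s s0; have := hC s s0; apply: cvg_trans; apply: near_eq_cvg.
    rewrite near_withinE; apply: nearW => a a0.
    by rewrite H1norm_vnorm ?parts_sub//; exact: H1xH1_sub (hH _ a0) (hH _ s0).
  - have mass s : 0 <= s -> vip (parts (Psi s)) (parts (Psi s)) = vip (parts Psi0) (parts Psi0).
      move=> s0; have [c1 c2 _] := cons s s0.
      rewrite -!L2norm_sqr => [|i|i]; [|exact: H1_L2 (h0 i)|exact: H1_L2 (hH' s s0 i)].
      by rewrite /L2norm c1 c2.
    have energy s : 0 <= s -> en p beta (parts (Psi s)) = en p beta (parts Psi0).
      move=> s0; have [_ _ c3] := cons s s0.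
      exact: etrans (esym (energyE p1 hbeta (hH s s0))) (etrans c3 (energyE p1 hbeta hPsi0)).
    move=> s s0; rewrite /lyapunov /vaction (mass s s0) (energy s s0).
    by rewrite (mass 0 (lexx 0)) (energy 0 (lexx 0)).
  (* The solution takes its initial datum only almost everywhere, but the two functions are at H^1
     distance zero. *)
  - apply: le_lt_trans (orbit_dist_lt hR hPsi0 dPsi0).
    apply: le_trans (orbit_distance_lipschitz hR (hH' 0 (lexx 0)) h0) _.
    rewrite /vnorm (vh1_sub_null (hH' 0 (lexx 0)) h0) ?sqrtr0 ?addr0//.
    by case=> -[] []; [apply: ae_mono ae2|apply: ae_mono ae2|apply: ae_mono ae1|apply: ae_mono ae1];
      move=> x /= ex; rewrite /parts/= ex.
apply: (@le_lt_trans _ _ (eps / 2)%:E); last by rewrite lte_fin; lra.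
apply: ge_ereal_sup => _ [t t0 <-]; apply: (orbit_dist_le hR) => //; first exact: hH.
apply: le_lt_trans (main t t0) _; lra.
Qed.
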